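(* Let $H$ be a Hopf algebra over $k$ with antipode $S$ and let $\varsigma\in H$ be a grouplike element such that the antipode is a twisted involution, that is, $S^2(h)=\varsigma h\varsigma^{-1}$ for all $h\in H$. Then $H^\bullet(H,k_\varsigma)$, respectively $\mathrm{Ext}^\bullet_H(k,k_\varsigma)$ (when it is computed by $H^\bullet(H,k_\varsigma)$, e.g. if $H$ is $k$-projective), is a Batalin-Vilkovisky algebra.
   Context: $k$ is a commutative ring. Grouplike means $\Delta(\varsigma)=\varsigma\otimes\varsigma$ and $\varepsilon(\varsigma)=1$. $k_\varsigma$ is $k$ with the trivial left $H$-module structure $h\cdot\lambda=\varepsilon(h)\lambda$ and the contraaction $\gamma:\mathrm{Hom}_k(H,k)\to k$, $f\mapsto f(\varsigma)$. $H^\bullet(H,k_\varsigma)$ is the cohomology of $C^n=\mathrm{Hom}_k(H^{\otimes n},k)$ with $\beta=\sum_{i=0}^{n+1}(-1)^i\delta_i$, where $(\delta_if)(h^1,\ldots,h^{n+1})$ is $f(h^1,\ldots,h^n)\varepsilon(h^{n+1})$ if $i=0$, $f(h^1,\ldots,h^{n-i+1}h^{n-i+2},\ldots,h^{n+1})$ if $1\le i\le n$, and $\varepsilon(h^1)f(h^2,\ldots,h^{n+1})$ if $i=n+1$. Its Gerstenhaber structure is the one induced by the operad with multiplication on $C$ given by $(\varphi\circ_i\psi)(h^1,\ldots,h^{p+q-1})=\varphi\big(h^1,\ldots,h^{p-i},\psi(h^{p-i+1}_{(1)},\ldots,h^{p+q-i}_{(1)})\,h^{p-i+1}_{(2)}\cdots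 h^{p+q-i}_{(2)},h^{p+q-i+1},\ldots,h^{p+q-1}\big)$ for $\varphi\in C^p,\psi\in C^q$, identity $\varepsilon$, multiplication $\mu(h,h')=\varepsilon(hh')$, unit $1\in k$. A Gerstenhaber algebra is a graded commutative algebra $(V,\smile)$, $V=\bigoplus_{p\in\mathbb N}V^p$, with a graded Lie bracket $\{\cdot,\cdot\}:V^{p+1}\otimes V^{q+1}\to V^{p+q+1}$ on $V[1]$ such that $\{\gamma,\alpha\smile\beta\}=\{\gamma,\alpha\}\smile\beta+(-1)^{pq}\alpha\smile\{\gamma,\beta\}$ for $\gamma\in V^{p+1},\alpha\in V^q$. It is a Batalin-Vilkovisky algebra if there is a $k$-linear $B:V^n\to V^{n-1}$, $B^2=0$, with $\{\alpha,\beta\}=(-1)^p\big(B(\alpha\smile\beta)-B(\alpha)\smile\beta-(-1)^p\alpha\smile B(\beta)\big)$ for $\alpha\in V^p$, $\beta\in V$. *)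

(* Defs.v *)
From HB Require Import structures.
From mathcomp Require Import all_boot all_algebra.
From mathcomp Require Import boolp functions.

Set Implicit Arguments.
Unset Strict Implicit.
Unset Printing Implicit Defensive.

Import GRing.Theory.
Import Quotient.

Local Open Scope ring_scope.
Local Open Scope quotient_scope.

Record submodule (k : comNzRingType) (M : lmodType k) := Submodule {
  in_submodule :> M -> Prop;
  submodule0 : in_submodule 0;
  submodule_lin : forall (a : k) (u v : M),
    in_submodule u -> in_submodule v -> in_submodule (a *: u + v) }.

(* [subquotient Z B] is the module Z / (B \cap Z). *)
Section Subquotient.
Variables (k : comNzRingType) (M : lmodType k) (Z B : submodule M).

Definition sq_num : {pred M} := fun x => `[< Z x >].

Lemma sq_num_closed : submod_closed sq_num.
Proof.
split; first by apply/asboolP; exact: submodule0.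
by move=> a u v /asboolP Zu /asboolP Zv; apply/asboolP; exact: submodule_lin.
Qed.

HB.instance Definition _ := GRing.isSubmodClosed.Build k M sq_num sq_num_closed.

Record sq_sub := SqSub { sq_val : M; _ : sq_val \in sq_num }.

HB.instance Definition _ := [isSub for sq_val].
HB.instance Definition _ := [Choice of sq_sub by <:].
HB.instance Definition _ := [SubChoice_isSubLmodule of sq_sub by <:].

Definition sq_den : {pred sq_sub} := fun x => `[< B (val x) >].

Lemma sq_den_closed : submod_closed sq_den.
Proof.
split; first by apply/asboolP; rewrite raddf0; exact: submodule0.
move=> a u v /asboolP Bu /asboolP Bv; apply/asboolP.
by rewrite linearP; exact: submodule_lin.
Qed.

HB.instance Definition _ :=
  GRing.isSubmodClosed.Build k sq_sub sq_den sq_den_closed.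

Definition subquotient := {quot sq_den}.

HB.instance Definition _ := GRing.Zmodule.on subquotient.
HB.instance Definition _ := EqQuotient.on subquotient.

Definition sq_scale (a : k) (x : subquotient) : subquotient :=
  \pi_subquotient (a *: repr x).

Lemma sq_scale_pi a x :
  sq_scale a (\pi_subquotient x) = \pi_subquotient (a *: x).
Proof.
apply/eqP; rewrite -[_ == _]/(_ == _ %[mod {quot sq_den}]) -idealrBE -scalerBr.
by apply: rpredZ; rewrite idealrBE; apply/eqP; exact: reprK.
Qed.

Lemma sq_piD x y : \pi_subquotient (x + y) =
  \pi_subquotient x + \pi_subquotient y.
Proof. exact: (Quotient.pi_add sq_den). Qed.

Lemma sq_scaleA a b v : sq_scale a (sq_scale b v) = sq_scale (a * b) v.
Proof.
by elim/quotW: v => v; rewrite (sq_scale_pi b v) !sq_scale_pi scalerA.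
Qed.

Lemma sq_scale1 : left_id 1 sq_scale.
Proof. by elim/quotW=> v; rewrite sq_scale_pi scale1r. Qed.

Lemma sq_scaleDr : right_distributive sq_scale +%R.
Proof.
move=> a; elim/quotW=> u; elim/quotW=> v.
by rewrite -sq_piD !sq_scale_pi scalerDr sq_piD.
Qed.

Lemma sq_scaleDl v : {morph sq_scale^~ v : a b / a + b}.
Proof.
by elim/quotW: v => v a b; rewrite !sq_scale_pi scalerDl sq_piD.
Qed.

HB.instance Definition _ := GRing.Zmodule_isLmodule.Build k subquotient
  sq_scaleA sq_scale1 sq_scaleDr sq_scaleDl.

Lemma sq_piZ (a : k) (x : sq_sub) :
  \pi_subquotient (a *: x) = a *: \pi_subquotient x.
Proof. exact/esym/sq_scale_pi. Qed.

(* Junk value 0 when x is not in Z. *)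
Definition sq_class (x : M) : subquotient := \pi_subquotient (insubd 0 x).

Lemma sq_class_lin (a : k) (x y : M) : Z x -> Z y ->
  sq_class (a *: x + y) = a *: sq_class x + sq_class y.
Proof.
move=> Zx Zy; rewrite /sq_class -sq_piZ -sq_piD.
have Zn u : Z u -> u \in sq_num by move=> ?; apply/asboolP.
congr \pi_subquotient; apply: val_inj; rewrite linearP /= !val_insubd !Zn //.
exact: submodule_lin.
Qed.

Lemma sq_class_ind (P : subquotient -> Prop) :
  (forall x : M, Z x -> P (sq_class x)) -> forall c, P c.
Proof.
move=> h; elim/quotW=> -[x Zx].
have := h x (asboolW Zx); rewrite /sq_class.
by have -> : insubd 0 x = SqSub Zx by apply: val_inj; rewrite val_insubd Zx.
Qed.

Lemma sq_class_eq0 (x : M) : Z x -> sq_class x = 0 <-> B x.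
Proof.
move=> Zx; have Zn : x \in sq_num by apply/asboolP.
have p0 : \pi_subquotient 0 = 0.
  by apply: (@addrI _ (\pi_subquotient 0)); rewrite -sq_piD !addr0.
rewrite /sq_class -p0; split => [/eqP|Bx].
  rewrite -[_ == _]/(_ == _ %[mod {quot sq_den}]) -idealrBE subr0.
  by move=> /asboolP; rewrite val_insubd Zn.
apply/eqP; rewrite -[_ == _]/(_ == _ %[mod {quot sq_den}]) -idealrBE subr0.
by apply/asboolP; rewrite val_insubd Zn.
Qed.

End Subquotient.

(* M \otimes_k N: the free module on M * N modulo the bilinearity relations. *)
Section TensorProduct.
Variables (k : comNzRingType) (M N : lmodType k).

Definition free_gen (x : M) (y : N) : M * N -> k^o :=
  fun p => (p == (x, y))%:R.

Definition finite_support (f : M * N -> k^o) : Prop :=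
  exists s : seq (M * N), forall p, p \notin s -> f p = 0.

Lemma finite_support0 : finite_support 0.
Proof. by exists [::]. Qed.

Lemma finite_support_lin (a : k) (f g : M * N -> k^o) :
  finite_support f -> finite_support g -> finite_support (a *: f + g).
Proof.
move=> [s sf] [t tg]; exists (s ++ t) => p; rewrite mem_cat negb_or.
case/andP=> /sf fp /tg gp.
by rewrite -[LHS]/(a *: f p + g p) fp gp scaler0 addr0.
Qed.

Definition free_module := Submodule finite_support0 finite_support_lin.

Record bilinear_relations (U : submodule (M * N -> k^o)) : Prop := {
  rel_addl : forall x x' y,
    U (free_gen (x + x') y - free_gen x y - free_gen x' y);
  rel_addr : forall x y y',
    U (free_gen x (y + y') - free_gen x y - free_gen x y');
  rel_scalel : forall a x y, U (free_gen (a *: x) y - a *: free_gen x y);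
  rel_scaler : forall a x y, U (free_gen x (a *: y) - a *: free_gen x y) }.

Definition in_tensor_relations (f : M * N -> k^o) : Prop :=
  forall U, bilinear_relations U -> U f.

Lemma tensor_relations0 : in_tensor_relations 0.
Proof. by move=> U _; exact: submodule0. Qed.

Lemma tensor_relations_lin (a : k) (f g : M * N -> k^o) :
  in_tensor_relations f -> in_tensor_relations g ->
  in_tensor_relations (a *: f + g).
Proof. by move=> rf rg U hU; apply: submodule_lin; [exact: rf|exact: rg]. Qed.

Definition tensor_relations :=
  Submodule tensor_relations0 tensor_relations_lin.

Definition tensor := subquotient free_module tensor_relations.
HB.instance Definition _ := GRing.Lmodule.on tensor.

Definition tens (x : M) (y : N) : tensor :=
  sq_class free_module tensor_relations (free_gen x y).

Lemma free_gen_finite x y : free_module (free_gen x y).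
Proof. by exists [:: (x, y)] => p; rewrite inE /free_gen => /negPf ->. Qed.

Lemma tens_scale a x y : a *: tens x y = tens (a *: x) y.
Proof.
have E (f g : M * N -> k^o) : free_module f -> free_module g ->
    tensor_relations (g - f) ->
  sq_class free_module tensor_relations f
  = sq_class free_module tensor_relations g.
  move=> Zf Zg r; apply/esym/subr0_eq; rewrite addrC -scaleN1r.
  rewrite -sq_class_lin //; apply/sq_class_eq0; last by rewrite scaleN1r addrC.
  exact: submodule_lin.
have Z0 : free_module 0 by exact: submodule0.
rewrite /tens -[LHS]addr0.
have -> : 0 = sq_class free_module tensor_relations 0.
  by apply/esym/sq_class_eq0 => //; exact: submodule0.
rewrite -sq_class_lin //; last exact: free_gen_finite.
rewrite addr0; apply: E; last by move=> U /rel_scalel.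
  by rewrite -[_ *: _]addr0; apply: submodule_lin => //; exact: free_gen_finite.
exact: free_gen_finite.
Qed.

Lemma tensor_sum_pure (t : tensor) :
  exists s : seq (M * N), t = \sum_(p <- s) tens p.1 p.2.
Proof.
move: t; apply: sq_class_ind => f [s].
elim: s f => [|[x y] s IH] f sf.
  exists [::]; rewrite big_nil; apply/sq_class_eq0; first by exists [::].
  suff -> : f = 0 by exact: submodule0.
  by apply/funext => p; rewrite sf.
pose g : M * N -> k^o := (- f (x, y)) *: free_gen x y + f.
have gs p : p \notin s -> g p = 0.
  move=> ps; rewrite -[LHS]/(- f (x, y) * (p == (x, y))%:R + f p).
  have [->|/negPf pxy] := eqVneq p (x, y); first by rewrite mulr1 addNr.
  by rewrite mulr0 add0r sf // inE pxy.
have [u gu] := IH g gs.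
exists ((f (x, y) *: x, y) :: u); rewrite big_cons -gu /= -tens_scale.
rewrite /tens -sq_class_lin; last first.
- by exists s.
- exact: free_gen_finite.
congr sq_class; rewrite /g addrA -scalerDl.
by rewrite (subrr (f (x, y) : k)) scale0r add0r.
Qed.

End TensorProduct.

Notation "x \otimes y" := (tens x y) (at level 40, left associativity).

(* Coassociativity, multiplicativity, counit and antipode axioms are written   *)
(* in Sweedler notation: [sweedler_of Delta h] lists pairs (h_(1), h_(2)) with *)
(* Delta h = \sum h_(1) \otimes h_(2).                                         *)
Section SweedlerNotation.
Variables (k : comNzRingType) (H : lmodType k) (Delta : H -> tensor H H).

Definition sweedler_of (h : H) : seq (H * H) :=
  projT1 (cid (tensor_sum_pure (Delta h))).

Lemma sweedler_ofE h : Delta h = \sum_(p <- sweedler_of h) p.1 \otimes p.2.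
Proof. exact: projT2 (cid (tensor_sum_pure (Delta h))). Qed.

End SweedlerNotation.

Record hopf_algebra (k : comNzRingType) (H : algType k) := HopfAlgebra {
  hDelta : H -> tensor H H;
  hEps : H -> k;
  hS : H -> H;
  hDelta_lin : linear hDelta;
  hDelta1 : hDelta 1 = 1 \otimes 1;
  hDeltaM : forall g h, hDelta (g * h) =
    \sum_(x <- sweedler_of hDelta g) \sum_(y <- sweedler_of hDelta h)
      (x.1 * y.1) \otimes (x.2 * y.2);
  hEps_lin : scalar hEps;
  hEps1 : hEps 1 = 1;
  hEpsM : forall g h, hEps (g * h) = hEps g * hEps h;
  hCoassoc : forall h,
    \sum_(x <- sweedler_of hDelta h) \sum_(y <- sweedler_of hDelta x.1)
      y.1 \otimes (y.2 \otimes x.2) =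
    \sum_(x <- sweedler_of hDelta h) \sum_(y <- sweedler_of hDelta x.2)
      x.1 \otimes (y.1 \otimes y.2);
  hCounitl : forall h, \sum_(x <- sweedler_of hDelta h) hEps x.1 *: x.2 = h;
  hCounitr : forall h, \sum_(x <- sweedler_of hDelta h) hEps x.2 *: x.1 = h;
  hS_lin : linear hS;
  hAntipodel : forall h,
    \sum_(x <- sweedler_of hDelta h) hS x.1 * x.2 = (hEps h)%:A;
  hAntipoder : forall h,
    \sum_(x <- sweedler_of hDelta h) x.1 * hS x.2 = (hEps h)%:A }.

Definition grouplike (k : comNzRingType) (H : algType k) (HA : hopf_algebra H)
    (s : H) : Prop :=
  hDelta HA s = s \otimes s /\ hEps HA s = 1.

(* [recast n x] is x : V m seen in V n when m = n, and 0 otherwise.  In the    *)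
(* axioms below the degrees agree, except where truncated subtraction meets a *)
(* component of negative degree; there the recast element is already 0.       *)
Definition recast (k : comNzRingType) (V : nat -> lmodType k) (n m : nat)
    (x : V m) : V n :=
  match @eqP _ m n with
  | ReflectT e => ecast i (V i) e x
  | ReflectF _ => 0
  end.
Arguments recast {k} V n {m} x.

(* The bracket maps V^p * V^q to V^(p+q-1), which is 0 if p = q = 0: see       *)
(* [bracket00].                                                               *)
Record gerstenhaber_data (k : comNzRingType) (V : nat -> lmodType k) :=
  GerstenhaberData {
  gone : V 0%N;
  gcup : forall p q, V p -> V q -> V (p + q)%N;
  gbracket : forall p q, V p -> V q -> V (p + q).-1 }.

Section BatalinVilkovisky.
Variables (k : comNzRingType) (V : nat -> lmodType k).
Variable G : gerstenhaber_data V.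
Local Notation one := (gone G).
Local Notation cup := (@gcup _ _ G _ _).
Local Notation bracket := (@gbracket _ _ G _ _).

(* As p - 1 and p + 1 have the same parity, the sign (-1)^((p-1)(q-1)) is      *)
(* written (-1)^((p+1)(q+1)).                                                 *)
Record is_gerstenhaber : Prop := {
  cup_linl : forall p q (b : V q), linear (fun a : V p => cup a b);
  cup_linr : forall p q (a : V p), linear (fun b : V q => cup a b);
  cupA : forall p q r (a : V p) (b : V q) (c : V r),
    cup a (cup b c) = recast V (p + (q + r)) (cup (cup a b) c);
  cup1l : forall p (a : V p), cup one a = a;
  cup1r : forall p (a : V p), cup a one = recast V (p + 0) a;
  cupC : forall p q (a : V p) (b : V q),
    cup a b = (-1) ^+ (p * q) *: recast V (p + q) (cup b a);
  bracket00 : forall a b : V 0%N, bracket a b = 0;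
  bracket_linl : forall p q (b : V q), linear (fun a : V p => bracket a b);
  bracket_linr : forall p q (a : V p), linear (fun b : V q => bracket a b);
  bracketC : forall p q (a : V p) (b : V q),
    bracket a b =
    - ((-1) ^+ (p.+1 * q.+1) *: recast V (p + q).-1 (bracket b a));
  bracket_jacobi : forall p q r (a : V p) (b : V q) (c : V r),
    recast V (p + q + r).-2 (bracket a (bracket b c)) =
    recast V (p + q + r).-2 (bracket (bracket a b) c) +
    (-1) ^+ (p.+1 * q.+1) *:
      recast V (p + q + r).-2 (bracket b (bracket a c));
  bracket_leibniz : forall p q r (c : V p) (a : V q) (b : V r),
    bracket c (cup a b) =
    recast V (p + (q + r)).-1 (cup (bracket c a) b) +
    (-1) ^+ (p.+1 * q) *:
      recast V (p + (q + r)).-1 (cup a (bracket c b)) }.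

Definition is_BV : Prop :=
  is_gerstenhaber /\
  exists B : forall n, {linear V n -> V n.-1},
  [/\ forall a : V 0%N, B 0%N a = 0,
      forall n (a : V n), B n.-1 (B n a) = 0 &
      forall p q (a : V p) (b : V q),
        bracket a b =
        (-1) ^+ p *: (B (p + q)%N (cup a b)
                      - recast V (p + q).-1 (cup (B p a) b)
                      - (-1) ^+ p *: recast V (p + q).-1 (cup a (B q b)))].

End BatalinVilkovisky.

Definition transports (k : comNzRingType) (V W : nat -> lmodType k)
    (Phi : forall n, {linear W n -> V n})
    (GW : gerstenhaber_data W) (GV : gerstenhaber_data V) : Prop :=
  [/\ Phi 0%N (gone GW) = gone GV,
      forall p q (a : W p) (b : W q),
        Phi (p + q)%N (gcup GW a b) = gcup GV (Phi p a) (Phi q b) &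
      forall p q (a : W p) (b : W q),
        Phi (p + q).-1 (gbracket GW a b) = gbracket GV (Phi p a) (Phi q b)].

(* Linear maps f : H^{\otimes n} -> k are represented by n-linear forms, as   *)
(* functions on lists (h^1, ..., h^n), extended by 0 to the lists of other    *)
(* lengths.                                                                   *)
Section Cochains.
Variables (k : comNzRingType) (H : algType k) (HA : hopf_algebra H).
Local Notation eps := (hEps HA).
Local Notation sweedler := (sweedler_of (hDelta HA)).

Definition cochain (n : nat) (f : seq H -> k^o) : Prop :=
  (forall s1 s2, size s1 + (size s2).+1 = n ->
     scalar (fun x => f (s1 ++ x :: s2) : k)) /\
  (forall s, size s != n -> f s = 0).

(* Positions in lists start at 0, so h^j is [nth 0 s j.-1]. *)
Definition delta (n i : nat) (f : seq H -> k^o) (s : seq H) : k :=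
  if i == 0%N then f (take n s) * eps (nth 0 s n)
  else if i == n.+1 then eps (nth 0 s 0) * f (drop 1 s)
  else f (take (n - i) s ++
          nth 0 s (n - i) * nth 0 s (n - i).+1 :: drop (n - i).+2 s).

Definition beta (n : nat) (f : seq H -> k^o) : seq H -> k^o :=
  fun s => if size s == n.+1
           then \sum_(0 <= i < n.+2) (-1) ^+ i * delta n i f s else 0.

Definition is_cocycle (n : nat) (f : seq H -> k^o) : Prop :=
  cochain n f /\ beta n f = 0.

Definition is_coboundary (n : nat) (f : seq H -> k^o) : Prop :=
  if n is m.+1 then exists2 g, cochain m g & f = beta m g else f = 0.

Lemma cochain0 n : cochain n 0.
Proof. by split=> // s1 s2 _ a x y; rewrite mulr0 addr0. Qed.

Lemma cochain_lin n (a : k) (f g : seq H -> k^o) :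
  cochain n f -> cochain n g -> cochain n (a *: f + g).
Proof.
have E s : (a *: f + g) s = a * f s + g s by [].
move=> [f1 f0] [g1 g0]; split=> [s1 s2 sn b x y|s sn]; rewrite !E.
  by rewrite f1 // g1 // !mulrDr !mulrA [a * b]mulrC !addrA -!mulrA;
     congr (_ + _); rewrite -!addrA; congr (_ + _); rewrite addrC.
by rewrite f0 // g0 // mulr0 addr0.
Qed.

Lemma beta_lin n (a : k) (f g : seq H -> k^o) :
  beta n (a *: f + g) = a *: beta n f + beta n g.
Proof.
apply/funext => s; rewrite -[RHS]/(a * beta n f s + beta n g s) /beta.
case: eqP => _; last by rewrite mulr0 addr0.
rewrite mulr_sumr -big_split /=; apply: eq_bigr => i _.
have E t : (a *: f + g) t = a * f t + g t by [].
rewrite mulrCA -mulrDr; congr (_ * _); rewrite /delta.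
case: eqP => _; first by rewrite E mulrDl mulrA.
by case: eqP => _; rewrite E // mulrDr mulrCA.
Qed.

Lemma beta0 n : beta n 0 = 0.
Proof.
by have := beta_lin n (-1) 0 0; rewrite scaler0 addr0 scaleN1r addNr.
Qed.

Lemma is_cocycle0 n : is_cocycle n 0.
Proof. by split; [exact: cochain0|exact: beta0]. Qed.

Lemma is_cocycle_lin n (a : k) (f g : seq H -> k^o) :
  is_cocycle n f -> is_cocycle n g -> is_cocycle n (a *: f + g).
Proof.
move=> [cf bf] [cg bg]; split; first exact: cochain_lin.
by rewrite beta_lin bf bg scaler0 addr0.
Qed.

Lemma is_coboundary0 n : is_coboundary n 0.
Proof.
by case: n => [//|n]; exists 0; [exact: cochain0|rewrite beta0].
Qed.

Lemma is_coboundary_lin n (a : k) (f g : seq H -> k^o) :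
  is_coboundary n f -> is_coboundary n g -> is_coboundary n (a *: f + g).
Proof.
case: n => [-> ->|n [f' cf ->] [g' cg ->]]; first by rewrite scaler0 addr0.
by exists (a *: f' + g'); [exact: cochain_lin|rewrite beta_lin].
Qed.

Definition cocycles n := Submodule (is_cocycle0 n) (@is_cocycle_lin n).
Definition coboundaries n :=
  Submodule (is_coboundary0 n) (@is_coboundary_lin n).

(* H^n(H, k_sigma); neither the action on k_sigma nor the complex depends on   *)
(* the grouplike element sigma, which only enters through the contraaction.   *)
Definition cohomology (n : nat) : lmodType k :=
  subquotient (cocycles n) (coboundaries n).

Definition coh_class (n : nat) (f : seq H -> k^o) : cohomology n :=
  sq_class (cocycles n) (coboundaries n) f.

(* The terms (h^1_(1), ..., h^q_(1)), (h^1_(2), ..., h^q_(2)) of the product  *)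
(* of the coproducts of h^1, ..., h^q.                                        *)
Fixpoint sweedler_seq (s : seq H) : seq (seq H * seq H) :=
  if s is h :: s' then
    [seq (x.1 :: y.1, x.2 :: y.2) | x <- sweedler h, y <- sweedler_seq s']
  else [:: ([::], [::])].

Definition operad_insert (psi : seq H -> k^o) (s : seq H) : H :=
  \sum_(x <- sweedler_seq s) (psi x.1 : k) *: \prod_(h <- x.2) h.

Definition operad_comp (p q i : nat) (phi psi : seq H -> k^o) :
    seq H -> k^o :=
  fun s => if (0 < i <= p)%N && (size s == (p + q).-1) then
      phi (take (p - i) s ++
           operad_insert psi (take q (drop (p - i) s)) ::
           drop (p - i + q) s)
    else 0.

Definition operad_mu : seq H -> k^o :=
  fun s => if s is [:: h; h'] then eps (h * h') else 0.

Definition operad_unit : seq H -> k^o :=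
  fun s => if s is [::] then 1 else 0.

(* The usual conventions for a nonsymmetric operad with multiplication mu:    *)
(* phi \smile psi = (mu o_2 phi) o_1 psi,                                     *)
(* {phi, psi} = phi{psi} - (-1)^((p-1)(q-1)) psi{phi} with                    *)
(* phi{psi} = \sum_i (-1)^((i-1)(q-1)) phi o_i psi.                           *)
Definition cochain_cup (p q : nat) (phi psi : seq H -> k^o) : seq H -> k^o :=
  operad_comp p.+1 q 1 (operad_comp 2 p 2 operad_mu phi) psi.

Definition cochain_brace (p q : nat) (phi psi : seq H -> k^o) :
    seq H -> k^o :=
  \sum_(1 <= i < p.+1) ((-1) ^+ (i.-1 * q.+1) : k) *: operad_comp p q i phi psi.

Definition cochain_bracket (p q : nat) (phi psi : seq H -> k^o) :
    seq H -> k^o :=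
  cochain_brace p q phi psi
  - ((-1) ^+ (p.+1 * q.+1) : k) *: cochain_brace q p psi phi.

Definition induced_by_operad (G : gerstenhaber_data cohomology) : Prop :=
  [/\ is_cocycle 0 operad_unit /\ gone G = coh_class 0 operad_unit,
      forall p q f g, is_cocycle p f -> is_cocycle q g ->
        is_cocycle (p + q) (cochain_cup p q f g) /\
        gcup G (coh_class p f) (coh_class q g) =
        coh_class (p + q) (cochain_cup p q f g) &
      forall p q f g, is_cocycle p f -> is_cocycle q g ->
        is_cocycle (p + q).-1 (cochain_bracket p q f g) /\
        gbracket G (coh_class p f) (coh_class q g) =
        coh_class (p + q).-1 (cochain_bracket p q f g)].

End Cochains.

Definition projective (R : nzRingType) (P : lmodType R) : Prop :=
  forall (M N : lmodType R) (g : {linear M -> N}) (f : {linear P -> N}),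
    (forall y, exists x, g x = y) ->
    exists h : {linear P -> M}, forall x, g (h x) = f x.

Section Ext.
Variables (k : comNzRingType) (H : algType k) (HA : hopf_algebra H).
Local Notation eps := (hEps HA).

(* H-linearity of maps into k with the trivial action. *)
Definition trivial_linear (P : lmodType H) (f : P -> k) : Prop :=
  forall (h : H) (x y : P), f (h *: x + y) = eps h * f x + f y.

Record projective_resolution := ProjectiveResolution {
  res_mod : nat -> lmodType H;
  res_d : forall n, {linear res_mod n.+1 -> res_mod n};
  res_aug : res_mod 0%N -> k;
  res_proj : forall n, projective (res_mod n);
  res_aug_lin : trivial_linear res_aug;
  res_aug_surj : forall a, exists x, res_aug x = a;
  res_exact0 : forall x, res_aug x = 0 <-> exists y, res_d 0 y = x;
  res_exactS : forall n x, res_d n x = 0 <-> exists y, res_d n.+1 y = x }.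

Variable P : projective_resolution.
Local Notation PM := (res_mod P).

Definition is_ext_cocycle (n : nat) (f : PM n -> k^o) : Prop :=
  trivial_linear f /\ forall y, f (res_d P n y) = 0.

Definition is_ext_coboundary (n : nat) : (PM n -> k^o) -> Prop :=
  match n with
  | 0 => fun f => f = 0
  | m.+1 => fun f =>
      exists2 g : PM m -> k^o, trivial_linear g & f = g \o res_d P m
  end.

Lemma trivial_linear0 (M : lmodType H) : trivial_linear (0 : M -> k^o).
Proof. by move=> h x y; rewrite mulr0 addr0. Qed.

Lemma trivial_linear_lin (M : lmodType H) (a : k) (f g : M -> k^o) :
  trivial_linear f -> trivial_linear g -> trivial_linear (a *: f + g).
Proof.
have E s : (a *: f + g) s = a * f s + g s by [].
move=> lf lg h x y; rewrite !E lf lg !mulrDr mulrCA -!addrA.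
by congr (_ + _); rewrite addrCA.
Qed.

Lemma is_ext_cocycle0 n : is_ext_cocycle (0 : PM n -> k^o).
Proof. by split=> //; exact: trivial_linear0. Qed.

Lemma is_ext_cocycle_lin n (a : k) (f g : PM n -> k^o) :
  is_ext_cocycle f -> is_ext_cocycle g -> is_ext_cocycle (a *: f + g).
Proof.
move=> [lf df] [lg dg]; split; first exact: trivial_linear_lin.
move=> y; rewrite -[LHS]/(a * f (res_d P n y) + g (res_d P n y)).
by rewrite df dg mulr0 addr0.
Qed.

Lemma is_ext_coboundary0 n : is_ext_coboundary (0 : PM n -> k^o).
Proof. by case: n => [//|n]; exists 0 => //; exact: trivial_linear0. Qed.

Lemma is_ext_coboundary_lin n (a : k) (f g : PM n -> k^o) :
  is_ext_coboundary f -> is_ext_coboundary g ->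
  is_ext_coboundary (a *: f + g).
Proof.
case: n f g => [f g -> ->|n f g [f' lf ->] [g' lg ->]].
  by rewrite /= scaler0 addr0.
by exists (a *: f' + g') => //; exact: trivial_linear_lin.
Qed.

Definition ext_cocycles n :=
  Submodule (@is_ext_cocycle0 n) (@is_ext_cocycle_lin n).
Definition ext_coboundaries n :=
  Submodule (@is_ext_coboundary0 n) (@is_ext_coboundary_lin n).

(* Ext^n_H(k, k_sigma) = H^n(Hom_H(P, k)). *)
Definition Ext (n : nat) : lmodType k :=
  subquotient (ext_cocycles n) (ext_coboundaries n).

Definition ext_class (n : nat) (f : PM n -> k^o) : Ext n :=
  sq_class (ext_cocycles n) (ext_coboundaries n) f.

Definition ext_computed_by (Phi : forall n, {linear Ext n -> cohomology HA n})
  : Prop := forall n, bijective (Phi n).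

(* A chain map over id_k from the bar resolution, whose n-th module is        *)
(* H \otimes H^{\otimes n}, to P: an H-linear map on H \otimes H^{\otimes n}   *)
(* is given by its values theta n (h^1, ..., h^n) on 1 \otimes h^1 \otimes    *)
(* ... \otimes h^n, which are n-linear over k.                                *)
Record bar_comparison (theta : forall n, seq H -> PM n) : Prop := {
  bar_multilinear : forall n s1 s2, size s1 + (size s2).+1 = n ->
    forall (a : k) (x y : H),
    theta n (s1 ++ (a *: x + y) :: s2) =
    (a%:A : H) *: theta n (s1 ++ x :: s2) + theta n (s1 ++ y :: s2);
  bar_aug : res_aug (theta 0%N [::]) = 1;
  bar_d : forall n s, size s = n.+1 ->
    res_d P n (theta n.+1 s) =
      nth 0 s 0 *: theta n (drop 1 s)
      + \sum_(0 <= i < n) ((-1) ^+ i.+1 : H) *: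
          theta n (take i s ++ nth 0 s i * nth 0 s i.+1 :: drop i.+2 s)
      + ((-1) ^+ n.+1 : H) *: (((eps (nth 0 s n))%:A : H) *: theta n (take n s))
}.

Definition induced_by_bar (theta : forall n, seq H -> PM n)
    (Phi : forall n, {linear Ext n -> cohomology HA n}) : Prop :=
  forall n (f : PM n -> k^o), is_ext_cocycle f ->
    let f_theta : seq H -> k^o :=
      fun s => if size s == n then f (theta n s) else 0 in
    is_cocycle HA n f_theta /\ Phi n (ext_class f) = coh_class HA n f_theta.

End Ext.

(* Main.v *)
Require Import Defs.
From HB Require Import structures.
From mathcomp Require Import all_boot all_algebra.
From mathcomp Require Import boolp functions.
From mathcomp Require Import ring zify.

Set Implicit Arguments.
Unset Strict Implicit.
Unset Printing Implicit Defensive.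

Import GRing.Theory.
Local Open Scope ring_scope.

(** The cochain complex is first rewritten in homogeneous coordinates. A cochain
of degree n becomes a multilinear functional F on words x0 ... xn of n + 1
letters of H which is invariant under the diagonal action of H ([Hinv]); the
maps [conv] and [homog] are inverse to each other, and up to sign the
differential beta becomes the simplicial differential [dd], which drops one
letter x_i against eps x_i.

All operations on homogeneous cochains are sums over overlapping cuts of a word
([cut], [cuts]): the letter at which the word is cut is comultiplied, and its
two halves go to the end of one piece and to the beginning of the next.
Evaluating F and G on the two pieces of a cut is the cup product ([dot]);
evaluating G on the middle one of three pieces and F on the outer two, joined
together, is the pre-Lie insertion of the operad ([Br], [conv_Br]); moving the
first of two pieces behind the second, with every letter multiplied by sigma, is
the operator B ([BD]). This last operation preserves invariance exactly because
sum S(h_(2)) sigma h_(1) = eps(h) sigma ([hS_twist], [Hinv2_turn]), and this is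
where S^2(h) = sigma h sigma^-1 enters.

One formula, [dd_cuts], computes the differential of any operation defined by
cuts: the differential of the pieces plus the alternating sum of the degenerate
cuts, in which one piece is empty. On closed functionals only the degenerate
cuts survive, so every identity that holds up to homotopy is witnessed by one
family of cuts: [Br] for the commutativity of the cup product ([dd_Br]), [Kp]
for the equality of the operadic bracket with the bracket derived from B
([dd_Kp], [bracket_BV_coboundary]), [BB] for B^2 = 0 ([dd_BB]) and [Br2] for the
Leibniz rule ([dd_Br2], [Leibniz_coboundary]). The Jacobi identity needs no
further homotopy: for a bracket derived from an operator B of square zero, it is
a formal consequence of the Leibniz rule ([bv_jacobiE]).

For Ext, the structure is pulled back along any family of bijections
([transport_BV]). If H is k-projective, every module of the resolution is
k-projective, the resolution has a k-linear contraction, and this yields a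
multilinear comparison map [theta] from the bar resolution. A dual basis of
every projective module gives a map in the other direction, used only through
its transpose [of_cochain]. The two composites are homotopic to the identity by
the recursions [res_homotopy] and [bar_homotopy]. *)

(** * Bilinear maps out of the tensor product *)

(** Sums of one finitely supported function over two lists that contain its support. *)
Lemma big_support (T : eqType) (V : zmodType) (s s' : seq T) (g : T -> V) :
  uniq s -> uniq s' -> (forall y, y \notin s -> g y = 0) ->
  (forall y, y \notin s' -> g y = 0) -> \sum_(y <- s) g y = \sum_(y <- s') g y.
Proof.
move=> us us' gs gs'.
have E r : \sum_(y <- r) g y = \sum_(y <- [seq y <- r | g y != 0]) g y.
  rewrite big_filter [RHS]big_mkcond; apply: eq_bigr => y _.
  by case: eqP.
rewrite E [RHS]E; apply: perm_big; apply: uniq_perm; rewrite ?filter_uniq //.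
move=> y; rewrite !mem_filter; case: eqP => //= gy.
have [//|/gs //] := boolP (y \in s); have [//|/gs' //] := boolP (y \in s').
Qed.

Section TensorLift.
Variables (k : comNzRingType) (M N V : lmodType k) (B : M -> N -> V).
Hypothesis Bl : forall y, linear (B^~ y).
Hypothesis Br : forall x, linear (B x).

Let ev (s : seq (M * N)) (f : M * N -> k^o) : V :=
  \sum_(p <- s) (f p : k) *: B p.1 p.2.

Lemma ev_support (s t : seq (M * N)) (f : M * N -> k^o) : uniq s -> uniq t ->
  (forall p, p \notin s -> f p = 0) -> (forall p, p \notin t -> f p = 0) ->
  ev s f = ev t f.
Proof.
move=> us ut fs ft; apply: big_support => // p hp; first by rewrite fs // scale0r.
by rewrite ft // scale0r.
Qed.

Lemma ev_lin (s : seq (M * N)) (a : k) f g : ev s (a *: f + g) = a *: ev s f + ev s g.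
Proof.
rewrite /ev scaler_sumr -big_split; apply: eq_bigr => p _ /=.
have -> : ((a *: f + g) p : k) = a * f p + g p by [].
by rewrite scalerDl scalerA.
Qed.

(** The finitely supported functions on which B evaluates to 0. They form a submodule
which contains the bilinearity relations, hence all relations of the tensor product. *)
Definition ev_ker (f : M * N -> k^o) : Prop :=
  exists s : seq (M * N), [/\ uniq s, forall p, p \notin s -> f p = 0 & ev s f = 0].

Lemma ev_widen (s s' : seq (M * N)) (f : M * N -> k^o) : uniq s ->
  (forall p, p \notin s -> f p = 0) -> exists s'' : seq (M * N),
  [/\ uniq s'', {subset s <= s''}, {subset s' <= s''} & ev s'' f = ev s f].
Proof.
move=> us fs; exists (undup (s ++ s')); split=> [|p ps|p ps|].
- exact: undup_uniq.
- by rewrite mem_undup mem_cat ps.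
- by rewrite mem_undup mem_cat ps orbT.
apply: ev_support => //; first exact: undup_uniq.
by move=> p; rewrite mem_undup mem_cat negb_or => /andP[/fs].
Qed.

Lemma ev_ker0 : ev_ker 0.
Proof. by exists [::]; split=> //; rewrite /ev big_nil. Qed.

Lemma ev_ker_lin (a : k) f g : ev_ker f -> ev_ker g -> ev_ker (a *: f + g).
Proof.
move=> [s [us fs es]] [t [ut gt et]].
have uu : uniq (undup (s ++ t)) by exact: undup_uniq.
have fu p : p \notin undup (s ++ t) -> f p = 0.
  by rewrite mem_undup mem_cat negb_or => /andP[/fs].
have gu p : p \notin undup (s ++ t) -> g p = 0.
  by rewrite mem_undup mem_cat negb_or => /andP[_ /gt].
exists (undup (s ++ t)); split=> // [p pst|].
  by rewrite -[LHS]/(a *: f p + g p) fu // gu // scaler0 addr0.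
by rewrite ev_lin (ev_support uu us) // es (ev_support uu ut) // et scaler0 addr0.
Qed.

Let kerU := Submodule ev_ker0 ev_ker_lin.

Lemma ev_gen s x y : uniq s -> (x, y) \in s -> ev s (free_gen x y) = B x y.
Proof.
move=> us xs; rewrite /ev (bigD1_seq (x, y)) //= big1 ?addr0.
  by rewrite /free_gen eqxx scale1r.
by move=> p /negPf pn; rewrite /free_gen pn scale0r.
Qed.

Lemma B0 x : B x 0 = 0.
Proof. by have := Br x (-1) 0 0; rewrite scaler0 addr0 scaleN1r addNr. Qed.
Lemma B0l x : B 0 x = 0.
Proof. by have := Bl x (-1) 0 0; rewrite scaler0 addr0 scaleN1r addNr. Qed.

Lemma ker_rel : bilinear_relations kerU.
Proof.
have G (s : seq (M * N)) (x : M) (y : N) p : p \notin s -> (x, y) \in s -> free_gen x y p = 0 :> k.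
  move=> ps xs; rewrite /free_gen; case: eqP => // pe.
  by rewrite pe xs in ps.
split=> [x x' y|x y y'|a x y|a x y] /=.
- exists (undup [:: (x + x', y); (x, y); (x', y)]).
  set s := undup _.
  have us : uniq s by exact: undup_uniq.
  have i1 : (x + x', y) \in s by rewrite mem_undup !inE eqxx.
  have i2 : (x, y) \in s by rewrite mem_undup !inE eqxx !orbT.
  have i3 : (x', y) \in s by rewrite mem_undup !inE eqxx !orbT.
  split=> // [p ps|].
    rewrite -[LHS]/(free_gen (x + x') y p - free_gen x y p - free_gen x' y p).
    by rewrite !(G s) // !subr0.
  have -> : free_gen (x + x') y - free_gen x y - free_gen x' y =
    (-1 : k) *: free_gen x y + ((-1 : k) *: free_gen x' y + free_gen (x + x') y).
    by rewrite !scaleN1r addrC [RHS]addrC -!addrA; congr (_ + _); rewrite addrC.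
  rewrite !ev_lin !ev_gen // -{2}[x]scale1r Bl !scaleN1r scale1r.
  by rewrite addrA -opprD addNr.
- exists (undup [:: (x, y + y'); (x, y); (x, y')]).
  set s := undup _.
  have us : uniq s by exact: undup_uniq.
  have i1 : (x, y + y') \in s by rewrite mem_undup !inE eqxx.
  have i2 : (x, y) \in s by rewrite mem_undup !inE eqxx !orbT.
  have i3 : (x, y') \in s by rewrite mem_undup !inE eqxx !orbT.
  split=> // [p ps|].
    rewrite -[LHS]/(free_gen x (y + y') p - free_gen x y p - free_gen x y' p).
    by rewrite !(G s) // !subr0.
  have -> : free_gen x (y + y') - free_gen x y - free_gen x y' =
    (-1 : k) *: free_gen x y + ((-1 : k) *: free_gen x y' + free_gen x (y + y')).
    by rewrite !scaleN1r addrC [RHS]addrC -!addrA; congr (_ + _); rewrite addrC.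
  rewrite !ev_lin !ev_gen // -{2}[y]scale1r Br !scaleN1r scale1r.
  by rewrite addrA -opprD addNr.
- exists (undup [:: (a *: x, y); (x, y)]).
  set s := undup _.
  have us : uniq s by exact: undup_uniq.
  have i1 : (a *: x, y) \in s by rewrite mem_undup !inE eqxx.
  have i2 : (x, y) \in s by rewrite mem_undup !inE eqxx !orbT.
  split=> // [p ps|].
    rewrite -[LHS]/(free_gen (a *: x) y p - a *: free_gen x y p).
    by rewrite !(G s) // scaler0 !subr0.
  have -> : free_gen (a *: x) y - a *: free_gen x y =
    (- a) *: free_gen x y + free_gen (a *: x) y.
    by rewrite scaleNr addrC.
  by rewrite !ev_lin !ev_gen // -[a *: x]addr0 Bl B0l addr0 scaleNr addNr.
- exists (undup [:: (x, a *: y); (x, y)]).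
  set s := undup _.
  have us : uniq s by exact: undup_uniq.
  have i1 : (x, a *: y) \in s by rewrite mem_undup !inE eqxx.
  have i2 : (x, y) \in s by rewrite mem_undup !inE eqxx !orbT.
  split=> // [p ps|].
    rewrite -[LHS]/(free_gen x (a *: y) p - a *: free_gen x y p).
    by rewrite !(G s) // scaler0 !subr0.
  have -> : free_gen x (a *: y) - a *: free_gen x y =
    (- a) *: free_gen x y + free_gen x (a *: y).
    by rewrite scaleNr addrC.
  by rewrite !ev_lin !ev_gen // -[a *: y]addr0 Br B0 addr0 scaleNr addNr.
Qed.

Lemma sum_finite (s : seq (M * N)) :
  finite_support (\sum_(p <- s) free_gen p.1 p.2).
Proof.
elim: s => [|p s IH]; first by rewrite big_nil; exact: finite_support0.
rewrite big_cons -[free_gen _ _]scale1r; apply: finite_support_lin => //.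
exact: free_gen_finite.
Qed.

Lemma sum_tens (s : seq (M * N)) :
  \sum_(p <- s) p.1 \otimes p.2 =
  sq_class (free_module M N) (tensor_relations M N)
    (\sum_(p <- s) free_gen p.1 p.2).
Proof.
elim: s => [|p s IH].
  rewrite !big_nil; apply/esym/sq_class_eq0; first exact: finite_support0.
  exact: submodule0.
rewrite !big_cons IH -[free_gen _ _]scale1r sq_class_lin ?scale1r //.
- exact: free_gen_finite.
exact: sum_finite.
Qed.

(** A bilinear map takes equal values on two presentations of one tensor. *)
Lemma tensor_eq_bilinear (s t : seq (M * N)) :
  \sum_(p <- s) p.1 \otimes p.2 = \sum_(p <- t) p.1 \otimes p.2 ->
  \sum_(p <- s) B p.1 p.2 = \sum_(p <- t) B p.1 p.2.
Proof.
rewrite !sum_tens => E.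
set fs := (\sum_(p <- s) free_gen p.1 p.2 : M * N -> k^o) in E.
set ft := (\sum_(p <- t) free_gen p.1 p.2 : M * N -> k^o) in E.
have Zd : free_module M N ((-1 : k) *: ft + fs).
  by apply: submodule_lin; exact: sum_finite.
have e0 : sq_class (free_module M N) (tensor_relations M N)
    ((-1 : k) *: ft + fs) = 0.
  rewrite sq_class_lin; [|exact: sum_finite|exact: sum_finite].
  by rewrite E scaleN1r addNr.
have [u [uu fu eu]] := (sq_class_eq0 _ Zd).1 e0 kerU ker_rel.
have gen r v : uniq v -> {subset r <= v} ->
    ev v (\sum_(p <- r) free_gen p.1 p.2) = \sum_(p <- r) B p.1 p.2.
  move=> uv; elim: r => [|[x y] r IH] rv.
    by rewrite !big_nil /ev big1 // => p _; rewrite scale0r.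
  rewrite !big_cons -[free_gen _ _]scale1r ev_lin scale1r ev_gen //.
    by congr (_ + _); apply: IH => p pr; apply: rv; rewrite inE pr orbT.
  by apply: rv; rewrite inE eqxx.
have [v [uv _ sv Ev]] := ev_widen (s ++ t) uu fu.
move: eu; rewrite -Ev ev_lin !gen //; last 2 first.
- by move=> p ps; apply: sv; rewrite mem_cat ps.
- by move=> p ps; apply: sv; rewrite mem_cat ps orbT.
by rewrite scaleN1r addrC => /subr0_eq.
Qed.

(** The linear map on [tensor M N] induced by the bilinear map [B]. *)
Definition tensor_lift (t : tensor M N) : V :=
  \sum_(p <- projT1 (cid (tensor_sum_pure t))) B p.1 p.2.

Lemma tensor_lift_sum (s : seq (M * N)) :
  tensor_lift (\sum_(p <- s) p.1 \otimes p.2) = \sum_(p <- s) B p.1 p.2.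
Proof.
apply: tensor_eq_bilinear; apply/esym.
exact: projT2 (cid (tensor_sum_pure _)).
Qed.

Lemma tensor_lift_tens x y : tensor_lift (x \otimes y) = B x y.
Proof. by have := tensor_lift_sum [:: (x, y)]; rewrite !big_seq1. Qed.

Lemma tensor_lift_lin : linear tensor_lift.
Proof.
move=> a u v; have [s ->] := tensor_sum_pure u; have [t ->] := tensor_sum_pure v.
have -> : a *: (\sum_(p <- s) p.1 \otimes p.2) =
    \sum_(p <- [seq (a *: p.1, p.2) | p <- s]) p.1 \otimes p.2 :> tensor M N.
  by rewrite scaler_sumr big_map; apply: eq_bigr => p _; rewrite tens_scale.
rewrite -big_cat !tensor_lift_sum big_cat big_map scaler_sumr /=.
congr (_ + _); apply: eq_bigr => p _.
by rewrite -[a *: p.1]addr0 Bl B0l addr0.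
Qed.

End TensorLift.

Lemma linear_sum_of (k : comNzRingType) (U V : lmodType k) (f : U -> V) I
  (s : seq I) (F : I -> U) : linear f ->
  f (\sum_(i <- s) F i) = \sum_(i <- s) f (F i).
Proof.
move=> fl; elim: s => [|i s IH]; last first.
  by rewrite !big_cons -IH -[F i]scale1r fl !scale1r.
rewrite !big_nil; have := fl (-1) 0 0.
by rewrite scaler0 addr0 scaleN1r addNr.
Qed.

Lemma linear_homog (k : comNzRingType) (U V : lmodType k) (f : U -> V) a x :
  linear f -> f (a *: x) = a *: f x.
Proof.
move=> fl; rewrite -[a *: x]addr0 fl; have := fl (-1) 0 0.
by rewrite scaler0 addr0 scaleN1r addNr => ->; rewrite addr0.
Qed.

Lemma bilinear_double_sum (k : comNzRingType) (M N V : lmodType k)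
    (B : M -> N -> V) (Bl : forall y, linear (B^~ y))
    (Br : forall x, linear (B x)) I J (s t : seq I) (S T : I -> seq J)
    (F F' : I -> J -> M) (G G' : I -> J -> N) :
  \sum_(i <- s) \sum_(j <- S i) F i j \otimes G i j =
  \sum_(i <- t) \sum_(j <- T i) F' i j \otimes G' i j ->
  \sum_(i <- s) \sum_(j <- S i) B (F i j) (G i j) =
  \sum_(i <- t) \sum_(j <- T i) B (F' i j) (G' i j).
Proof.
move=> e; have LL := tensor_lift_lin Bl Br.
have E (r : seq I) (R : I -> seq J) (P : I -> J -> M) (Q : I -> J -> N) :
    tensor_lift B (\sum_(i <- r) \sum_(j <- R i) P i j \otimes Q i j) =
    \sum_(i <- r) \sum_(j <- R i) B (P i j) (Q i j).
  rewrite (linear_sum_of _ _ LL); apply: eq_bigr => i _.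
  rewrite (linear_sum_of _ _ LL); apply: eq_bigr => j _.
  by rewrite tensor_lift_tens.
by rewrite -!E e.
Qed.

(** * Sweedler sums *)

Section SweedlerCalculus.
Variables (k : comNzRingType) (H : algType k) (HA : hopf_algebra H).
Local Notation eps := (hEps HA).
Local Notation Delta := (hDelta HA).

(** The Sweedler sum of B h_(1) h_(2). For bilinear B it does not depend on the
presentation of the coproduct of h, see [sw_presentation]. *)
Definition sw (V : nmodType) (h : H) (B : H -> H -> V) : V :=
  \sum_(x <- sweedler_of Delta h) B x.1 x.2.

(** The k-linear forms on H. They are kept as functions with values in k, so that
ring computations apply to them. *)
Definition klin (f : H -> k) : Prop :=
  forall a x y, f (a *: x + y) = a * f x + f y.

Section Generic.
Variable V : lmodType k.
Implicit Types B : H -> H -> V.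

(** k-bilinear functions on H. *)
Definition bilin B := (forall y, linear (B^~ y)) /\ (forall x, linear (B x)).

Lemma sw_lift h B : bilin B -> sw h B = tensor_lift B (Delta h).
Proof. by case=> Bl Br; rewrite sweedler_ofE tensor_lift_sum. Qed.

Lemma sw_presentation h B s : bilin B ->
  Delta h = \sum_(p <- s) p.1 \otimes p.2 -> sw h B = \sum_(p <- s) B p.1 p.2.
Proof. by move=> Bb e; rewrite sw_lift // e; case: Bb => *; rewrite tensor_lift_sum. Qed.

Lemma sw_lin_arg B : bilin B -> linear (fun h => sw h B).
Proof.
move=> Bb a g h; rewrite !sw_lift // hDelta_lin.
by case: Bb => *; rewrite tensor_lift_lin.
Qed.

Lemma sw_coassoc (T : H -> H -> H -> V) h :
  (forall b c, linear (fun a => T a b c)) ->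
  (forall a c, linear (fun b => T a b c)) ->
  (forall a b, linear (fun c => T a b c)) ->
  sw h (fun a c => sw a (fun x y => T x y c)) =
  sw h (fun a b => sw b (fun y z => T a y z)).
Proof.
move=> T1 T2 T3; pose B a t := tensor_lift (T a) t.
have Bl t : linear (B^~ t).
  move=> c x y; have [s ->] := tensor_sum_pure t; rewrite /B.
  rewrite !tensor_lift_sum // scaler_sumr -big_split.
  by apply: eq_bigr => p _; exact: T1.
have Br a : linear (B a) by apply: tensor_lift_lin.
have C := bilinear_double_sum Bl Br (hCoassoc HA h).
apply: etrans; [|apply: etrans; [exact: C|]].
  apply: eq_bigr => i _; apply: eq_bigr => j _.
  by rewrite /B tensor_lift_tens.
apply: eq_bigr => i _; apply: eq_bigr => j _.
by rewrite /B tensor_lift_tens.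
Qed.

Lemma sw_1 B : bilin B -> sw 1 B = B 1 1.
Proof.
move=> Bb; rewrite (@sw_presentation _ _ [:: (1, 1)]) // ?big_seq1 //.
exact: hDelta1.
Qed.

Lemma sw_grouplike s B : grouplike HA s -> bilin B -> sw s B = B s s.
Proof.
move=> [e _] Bb; rewrite (@sw_presentation _ _ [:: (s, s)]) // ?big_seq1 //.
Qed.

Lemma sw_mul g h B : bilin B ->
  sw (g * h) B = sw g (fun a b => sw h (fun c e => B (a * c) (b * e))).
Proof.
move=> Bb; rewrite sw_lift // hDeltaM; case: Bb => Bl Br.
have LL := tensor_lift_lin Bl Br.
rewrite (linear_sum_of _ _ LL); apply: eq_bigr => x _.
rewrite (linear_sum_of _ _ LL); apply: eq_bigr => y _.
by rewrite tensor_lift_tens.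
Qed.

Lemma sw_counitl h (f : H -> V) : linear f ->
  sw h (fun a b => eps a *: f b) = f h.
Proof.
move=> fl; rewrite -{2}[h](hCounitl HA) (linear_sum_of _ _ fl).
by apply: eq_bigr => x _; rewrite linear_homog.
Qed.

Lemma sw_counitr h (f : H -> V) : linear f ->
  sw h (fun a b => eps b *: f a) = f h.
Proof.
move=> fl; rewrite -{2}[h](hCounitr HA) (linear_sum_of _ _ fl).
by apply: eq_bigr => x _; rewrite linear_homog.
Qed.

Lemma sw_antipodel h (f : H -> V) : linear f ->
  sw h (fun a b => f (hS HA a * b)) = eps h *: f 1.
Proof.
move=> fl; rewrite -linear_homog // -(hAntipodel HA).
by rewrite (linear_sum_of _ _ fl).
Qed.

Lemma sw_antipoder h (f : H -> V) : linear f ->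
  sw h (fun a b => f (a * hS HA b)) = eps h *: f 1.
Proof.
move=> fl; rewrite -linear_homog // -(hAntipoder HA).
by rewrite (linear_sum_of _ _ fl).
Qed.

End Generic.

Lemma eq_sw (V : nmodType) h (B B' : H -> H -> V) :
  (forall a b, B a b = B' a b) -> sw h B = sw h B'.
Proof. by move=> e; apply: eq_bigr. Qed.

Lemma sw_exchange (V : nmodType) g h (B : H -> H -> H -> H -> V) :
  sw g (fun a b => sw h (B a b)) = sw h (fun c e => sw g (fun a b => B a b c e)).
Proof. exact: exchange_big. Qed.

Lemma sw_mulrl (R : nzSemiRingType) h (c : R) (B : H -> H -> R) :
  sw h (fun a b => c * B a b) = c * sw h B.
Proof. by rewrite [RHS]mulr_sumr. Qed.

Lemma sw_mulrr (R : nzSemiRingType) h (c : R) (B : H -> H -> R) :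
  sw h (fun a b => B a b * c) = sw h B * c.
Proof. by rewrite [RHS]mulr_suml. Qed.

Lemma sw_add (V : nmodType) h (B B' : H -> H -> V) :
  sw h (fun a b => B a b + B' a b) = sw h B + sw h B'.
Proof. exact: big_split. Qed.

Lemma sw_opp (V : zmodType) h (B : H -> H -> V) :
  sw h (fun a b => - B a b) = - sw h B.
Proof. exact: sumrN. Qed.

Lemma sw_scale (V : lmodType k) h (c : k) (B : H -> H -> V) :
  sw h (fun a b => c *: B a b) = c *: sw h B.
Proof. by rewrite [RHS]scaler_sumr. Qed.

Lemma S_lin : linear (hS HA). Proof. exact: hS_lin. Qed.

(** Both sides are equal to the sum of S(g_(1) h_(1)) g_(2) h_(2) S(h_(3)) S(g_(3)). *)
Lemma hS_mul g h : hS HA (g * h) = hS HA h * hS HA g.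
Proof.
set S := hS HA; have Sl : linear S := S_lin.
have lS a b : linear (fun x => a * S x * b).
  by move=> c x y; rewrite Sl mulrDr mulrDl -scalerAr -scalerAl.
have ll a b : linear (fun x : H => a * x * b).
  by move=> c x y; rewrite mulrDr mulrDl -scalerAr -scalerAl.
transitivity (sw g (fun g1 g' => sw g' (fun g2 g3 =>
   sw h (fun h1 h' => sw h' (fun h2 h3 =>
     S (g1 * h1) * (g2 * h2 * S h3 * S g3)))))).
  transitivity (sw g (fun g1 g' => sw h (fun h1 h' =>
     (eps g' * eps h') *: S (g1 * h1)))).
    transitivity (sw g (fun g1 g' => eps g' *: S (g1 * h))); last first.
      apply: eq_sw => g1 g'; rewrite -[in LHS](@sw_counitr H h (fun x => S (g1 * x))).
        by rewrite -sw_scale; apply: eq_sw => a b; rewrite scalerA.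
      by move=> c x y; rewrite mulrDr -scalerAr Sl.
    rewrite (@sw_counitr H g (fun x => S (x * h))) //.
    by move=> c x y; rewrite mulrDl -scalerAl Sl.
  apply: eq_sw => g1 g'; rewrite sw_exchange; apply: eq_sw => h1 h'.
  transitivity (sw g' (fun a b => eps h' *: (S (g1 * h1) * (a * S b)))).
    rewrite (@sw_antipoder H g' (fun x => eps h' *: (S (g1 * h1) * x))) ?mulr1.
      by rewrite scalerA.
    by move=> c x y; rewrite mulrDr -scalerAr scalerDr !scalerA mulrC.
  apply: eq_sw => a b.
  rewrite -[eps h' *: _](_ : eps h' *: ((S (g1 * h1) * a) * 1 * S b) = _); last first.
    by rewrite mulr1 mulrA.
  rewrite -(@sw_antipoder H h' (fun x => (S (g1 * h1) * a) * x * S b)) //.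
  by apply: eq_sw => c e; rewrite !mulrA.
transitivity (sw g (fun g' g3 => sw g' (fun g1 g2 =>
   sw h (fun h' h3 => sw h' (fun h1 h2 =>
     S (g1 * h1) * (g2 * h2) * S h3 * S g3))))).
  rewrite [RHS]sw_coassoc.
  - apply: eq_sw => g1 g'; apply: eq_sw => g2 g3; rewrite [RHS]sw_coassoc.
    + by apply: eq_sw => h1 h'; apply: eq_sw => h2 h3; rewrite !mulrA.
    + by move=> b c e x y; rewrite mulrDr -scalerAr Sl !mulrDl -!scalerAl.
    + by move=> b c e x y; rewrite mulrDr -scalerAr mulrDr !mulrDl -scalerAr -!scalerAl.
    by move=> b c e x y; rewrite Sl mulrDr !mulrDl -scalerAr -!scalerAl.
  - move=> b c e x y; rewrite -sw_scale -sw_add; apply: eq_sw => ? ?.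
    rewrite -sw_scale -sw_add; apply: eq_sw => ? ?.
    by rewrite mulrDl -scalerAl Sl !mulrDl -!scalerAl.
  - move=> b c e x y; rewrite -sw_scale -sw_add; apply: eq_sw => ? ?.
    rewrite -sw_scale -sw_add; apply: eq_sw => ? ?.
    by rewrite mulrDl -scalerAl mulrDr !mulrDl -scalerAr -!scalerAl.
  move=> b c e x y; rewrite -sw_scale -sw_add; apply: eq_sw => ? ?.
  rewrite -sw_scale -sw_add; apply: eq_sw => ? ?.
  by rewrite Sl mulrDr -scalerAr.
transitivity (sw g (fun g' g3 => sw h (fun h' h3 =>
   (eps g' * eps h') *: (S h3 * S g3)))).
  apply: eq_sw => g' g3; rewrite sw_exchange; apply: eq_sw => h' h3.
  rewrite -hEpsM -[S h3 * S g3]mul1r mulrA.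
  rewrite -(@sw_antipodel H _ (fun x => x * S h3 * S g3)).
    rewrite sw_mul; first by apply: eq_sw => ? ?; apply: eq_sw => ? ?.
    split=> [z|z] c x y; first by rewrite -/S Sl !mulrDl -!scalerAl.
    by rewrite mulrDr -scalerAr !mulrDl -!scalerAl.
  by move=> c x y; rewrite !mulrDl -!scalerAl.
transitivity (sw g (fun g' g3 => eps g' *: (S h * S g3))).
  apply: eq_sw => g' g3; rewrite -(@sw_counitl H h (fun x => S x * S g3)).
    by rewrite -sw_scale; apply: eq_sw => ? ?; rewrite scalerA.
  by move=> c x y; rewrite Sl mulrDl -scalerAl.
rewrite (@sw_counitl H g (fun x => S h * S x)) //.
by move=> c x y; rewrite Sl mulrDr -scalerAr.
Qed.

Lemma hS_1 : hS HA 1 = 1.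
Proof.
have := @sw_antipodel H 1 id (fun _ _ _ => erefl).
rewrite sw_1 ?mulr1 ?hEps1 ?scale1r // ; split=> z c x y /=.
  by rewrite S_lin mulrDl -scalerAl.
by rewrite mulrDr -scalerAr.
Qed.

End SweedlerCalculus.

(** * Functionals on words, the diagonal action and the differential *)

Lemma expr_parity (R : nzRingType) n : (-1) ^+ n = (if odd n then -1 else 1 : R).
Proof. by rewrite -signr_odd; case: odd. Qed.

(** Reduces an identity between signs to the finitely many cases given by the
parities of the exponents. *)
Ltac parity :=
  rewrite ?expr_parity ?(oddD, oddM, oddB, oddS) /=;
  repeat match goal with
  | |- context [odd ?n] => case: (odd n)
  end; rewrite /=.

Section LinearFunctionals.
Variables (k : comNzRingType) (A : Type) (T : (A -> k) -> k).

(** Linear operators on functionals. Sums over coproducts and cuts commute with them. *)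
Definition lfun : Prop :=
  forall c F G, T (fun a => c * F a + G a) = c * T F + T G.

Hypothesis Tl : lfun.

Lemma eq_lfun F G : (forall a, F a = G a) -> T F = T G.
Proof. by move=> e; congr T; apply/funext. Qed.

Lemma lfun0 : T (fun=> 0) = 0.
Proof.
have E := Tl (-1) (fun=> 0) (fun=> 0).
by rewrite (@eq_lfun _ (fun=> 0)) in E; [rewrite E; ring|move=> a; ring].
Qed.

Lemma lfun_add F G : T (fun a => F a + G a) = T F + T G.
Proof.
by rewrite -[T F]mul1r -Tl; apply: eq_lfun => a; rewrite mul1r.
Qed.

Lemma lfun_mul c F : T (fun a => c * F a) = c * T F.
Proof.
by rewrite -[RHS]addr0 -[X in _ = _ + X]lfun0 -Tl; apply: eq_lfun => a; rewrite addr0.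
Qed.

Lemma lfun_mulr c F : T (fun a => F a * c) = T F * c.
Proof. by rewrite mulrC -lfun_mul; apply: eq_lfun => a; rewrite mulrC. Qed.

Lemma lfun_opp F : T (fun a => - F a) = - T F.
Proof. by rewrite -mulN1r -lfun_mul; apply: eq_lfun => a; rewrite mulN1r. Qed.

Lemma lfun_sub F G : T (fun a => F a - G a) = T F - T G.
Proof. by rewrite lfun_add lfun_opp. Qed.

Lemma lfun_sum I (s : seq I) (F : I -> A -> k) :
  T (fun a => \sum_(i <- s) F i a) = \sum_(i <- s) T (F i).
Proof.
elim: s => [|i s IH].
  by rewrite big_nil -[RHS]lfun0; apply: eq_lfun => a; rewrite big_nil.
by rewrite [RHS]big_cons -IH -lfun_add; apply: eq_lfun => a; rewrite big_cons.
Qed.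
End LinearFunctionals.

Section Words.
Variables (k : comNzRingType) (H : algType k) (HA : hopf_algebra H).
Local Notation eps := (hEps HA).
Local Notation sw := (sw HA).
Local Notation word := (seq H).
Local Notation klin := (@klin k H).
Implicit Types (F G : word -> k) (u v w : word).

Lemma eps_klin : klin eps. Proof. exact: hEps_lin. Qed.

Lemma swk_coassoc (T : H -> H -> H -> k) h :
  (forall b c, klin (fun a => T a b c)) ->
  (forall a c, klin (fun b => T a b c)) ->
  (forall a b, klin (fun c => T a b c)) ->
  sw h (fun a c => sw a (fun x y => T x y c)) =
  sw h (fun a b => sw b (fun y z => T a y z)).
Proof. exact: (@sw_coassoc k H HA k^o). Qed.

(** k-bilinear forms on H. *)
Definition bilink (B : H -> H -> k) :=
  (forall y, klin (B^~ y)) /\ (forall x, klin (B x)).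

Lemma klin_sw_arg B : bilink B -> klin (fun h => sw h B).
Proof. exact: (@sw_lin_arg k H HA k^o). Qed.

Lemma swk_1 B : bilink B -> sw 1 B = B 1 1.
Proof. exact: (@sw_1 k H HA k^o). Qed.

Lemma swk_grouplike s B : grouplike HA s -> bilink B -> sw s B = B s s.
Proof. exact: (@sw_grouplike k H HA k^o). Qed.

Lemma swk_mul g h B : bilink B ->
  sw (g * h) B = sw g (fun a b => sw h (fun c e => B (a * c) (b * e))).
Proof. exact: (@sw_mul k H HA k^o). Qed.

Lemma swk_counitl h f : klin f -> sw h (fun a b => eps a * f b) = f h.
Proof. exact: (@sw_counitl k H HA k^o). Qed.

Lemma swk_counitr h f : klin f -> sw h (fun a b => eps b * f a) = f h.
Proof. exact: (@sw_counitr k H HA k^o). Qed.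

Lemma swk_antipodel h f : klin f ->
  sw h (fun a b => f (hS HA a * b)) = eps h * f 1.
Proof. exact: (@sw_antipodel k H HA k^o). Qed.

Lemma swk_antipoder h f : klin f ->
  sw h (fun a b => f (a * hS HA b)) = eps h * f 1.
Proof. exact: (@sw_antipoder k H HA k^o). Qed.

Lemma klin_sw h (B : H -> H -> H -> k) :
  (forall a b, klin (fun x => B x a b)) -> klin (fun x => sw h (B x)).
Proof.
by move=> Bl c x y; rewrite -sw_mulrl -sw_add; apply: eq_sw => a b; exact: Bl.
Qed.

Lemma klin_mul c f : klin f -> klin (fun x => c * f x).
Proof. by move=> fl a x y; rewrite fl; ring. Qed.

Lemma klin_mulr c f : klin f -> klin (fun x => f x * c).
Proof. by move=> fl a x y; rewrite fl; ring. Qed.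

Lemma klin_add f g : klin f -> klin g -> klin (fun x => f x + g x).
Proof. by move=> fl gl a x y; rewrite fl gl; ring. Qed.

Lemma klin_opp f : klin f -> klin (fun x => - f x).
Proof. by move=> fl a x y; rewrite fl; ring. Qed.

Lemma klin_left f a : klin f -> klin (fun x => f (a * x)).
Proof. by move=> fl c x y; rewrite mulrDr -scalerAr fl. Qed.

Lemma klin_right f a : klin f -> klin (fun x => f (x * a)).
Proof. by move=> fl c x y; rewrite mulrDl -scalerAl fl. Qed.

Lemma klin_S f : klin f -> klin (fun x => f (hS HA x)).
Proof. by move=> fl c x y; rewrite S_lin fl. Qed.

Lemma lfun_klin A (T : (A -> k) -> k) (F : H -> A -> k) : lfun T ->
  (forall a, klin (fun x => F x a)) -> klin (fun x => T (F x)).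
Proof.
by move=> Tl Fl c x y; rewrite -Tl; apply: eq_lfun => a; exact: Fl.
Qed.

Lemma lfun_sw A (T : (A -> k) -> k) h (F : H -> H -> A -> k) : lfun T ->
  T (fun a => sw h (fun b c => F b c a)) = sw h (fun b c => T (F b c)).
Proof. by move=> Tl; exact: lfun_sum. Qed.

(** Functionals on words that are linear in every letter. *)
Definition ML F := forall u v, klin (fun x => F (u ++ x :: v)).

Lemma ML_cons F x : ML F -> ML (fun w => F (x :: w)).
Proof. by move=> FL u v; exact: (FL (x :: u)). Qed.

Lemma ML_catl F u : ML F -> ML (fun w => F (u ++ w)).
Proof. by move=> FL u' v c x y; rewrite !catA; exact: FL. Qed.

Lemma ML_catr F v : ML F -> ML (fun w => F (w ++ v)).
Proof. by move=> FL u v' c x y; rewrite -!catA; exact: FL. Qed.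

Lemma ML_head F w : ML F -> klin (fun x => F (x :: w)).
Proof. by move=> FL; exact: (FL [::]). Qed.

Lemma ML_mul c F : ML F -> ML (fun w => c * F w).
Proof. by move=> FL u v; apply: klin_mul; exact: FL. Qed.

Lemma ML_add F G : ML F -> ML G -> ML (fun w => F w + G w).
Proof. by move=> FL GL u v; apply: klin_add; [exact: FL|exact: GL]. Qed.

Lemma ML_opp F : ML F -> ML (fun w => - F w).
Proof. by move=> FL u v; apply: klin_opp; exact: FL. Qed.

(** Multilinearity is tested in one length at a time, so a factor that depends only
on the length of the word does not affect it. *)
Lemma ML_size (c : nat -> k) F : ML F -> ML (fun w => c (size w) * F w).
Proof.
move=> FL u v; have E x : size (u ++ x :: v) = size (u ++ 1 :: v).
  by rewrite !size_cat.
by move=> a x y; rewrite (E (a *: x + y)) (E x) (E y) FL; ring.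
Qed.

(** The diagonal action: act h F (x1, ..., xm) is the sum of F(h_(1) x1, ..., h_(m) xm),
and h acts by eps h on the empty word. *)
Fixpoint act (h : H) F w : k :=
  if w is x :: w' then sw h (fun a b => act b (fun v => F (a * x :: v)) w')
  else eps h * F [::].

Lemma lfun_act h w : lfun (fun F => act h F w).
Proof.
elim: w h => [|x w IH] h c F G /=; first by ring.
rewrite -sw_mulrl -sw_add; apply: eq_sw => a b; exact: IH.
Qed.

Lemma klin_act_fun h w (F : H -> word -> k) :
  (forall v, klin (fun x => F x v)) -> klin (fun x => act h (F x) w).
Proof. exact: (lfun_klin (lfun_act h w)). Qed.

Lemma act_sw h w g (F : H -> H -> word -> k) :
  act h (fun v => sw g (fun b c => F b c v)) w = sw g (fun b c => act h (F b c) w).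
Proof. exact: (lfun_sw g F (lfun_act h w)). Qed.

Lemma act_sub h w F G :
  act h (fun v => F v - G v) w = act h F w - act h G w.
Proof. exact: (lfun_sub (lfun_act h w)). Qed.

Lemma act_mulc h w c F : act h (fun v => c * F v) w = c * act h F w.
Proof. exact: (lfun_mul (lfun_act h w)). Qed.

Lemma eq_act_size h F G w : (forall v, size v = size w -> F v = G v) ->
  act h F w = act h G w.
Proof.
elim: w h F G => [|x w IH] h F G e /=; first by rewrite e.
by apply: eq_sw => a b; apply: IH => v ev; apply: e; rewrite /= ev.
Qed.

Lemma eq_act h F G w : (forall v, F v = G v) -> act h F w = act h G w.
Proof. by move=> e; apply: eq_act_size. Qed.

Lemma klin_act F w : ML F -> klin (fun h => act h F w).
Proof.
elim: w F => [|x w IH] F FL /=.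
  by apply: klin_mulr; exact: eps_klin.
apply: klin_sw_arg; split=> y.
  apply: klin_act_fun => v.
  by apply: (klin_right (f := fun z => F (z :: v))); exact: ML_head.
exact/IH/ML_cons.
Qed.

Lemma ML_act h F : ML F -> ML (act h F).
Proof.
move=> FL u; elim: u h F FL => [|y u IH] h F FL v /=.
  apply: klin_sw => a b; apply: klin_act_fun => w.
  by apply: (klin_left (f := fun z => F (z :: w))); exact: ML_head.
by apply: klin_sw => a b; exact/IH/ML_cons.
Qed.

Lemma act_cat h F u v : ML F ->
  act h F (u ++ v) =
  sw h (fun a b => act a (fun u' => act b (fun v' => F (u' ++ v')) v) u).
Proof.
elim: u h F => [|x u IH] h F FL /=.
  by rewrite swk_counitl //; apply: klin_act.
have FL' a : ML (fun w => F (a :: w)) by exact: ML_cons.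
transitivity (sw h (fun a b => sw b (fun c e => act c (fun u' =>
    act e (fun v' => F (a * x :: u' ++ v')) v) u))).
  by apply: eq_sw => a b; rewrite IH.
rewrite -[LHS]swk_coassoc //.
- move=> b c; apply: klin_act_fun => w.
  apply: klin_act_fun => w'.
  by apply: (klin_right (f := fun z => F (z :: _))); exact: ML_head.
- move=> a c; apply: klin_act => u1 u2.
  apply: klin_act_fun => w'.
  by apply: (ML_catr (F := fun w => F (_ :: w))).
move=> a b; apply: klin_act_fun => w.
by apply: klin_act; exact: (ML_catl (F := fun w => F (_ :: w))).
Qed.

Lemma act_mul g h F w : ML F -> act (g * h) F w = act h (act g F) w.
Proof.
elim: w g h F => [|x w IH] g h F FL /=; first by rewrite hEpsM; ring.
have FL' a : ML (fun w => F (a :: w)) by exact: ML_cons.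
rewrite swk_mul; last first.
  split=> y; last exact: klin_act.
  apply: klin_act_fun => v.
  by apply: (klin_right (f := fun z => F (z :: _))); exact: ML_head.
rewrite sw_exchange; apply: eq_sw => a b.
rewrite act_sw; apply: eq_sw => c e.
by rewrite IH //; apply: eq_act => v; rewrite mulrA.
Qed.

Lemma act_1 F w : ML F -> act 1 F w = F w.
Proof.
elim: w F => [|x w IH] F FL /=; first by rewrite hEps1 mul1r.
rewrite swk_1; first by rewrite mul1r IH //; exact: ML_cons.
split=> y; last by apply: klin_act; exact: ML_cons.
apply: klin_act_fun => v.
by apply: (klin_right (f := fun z => F (z :: _))); exact: ML_head.
Qed.

(** Invariance under the diagonal action. *)
Definition Hinv F := forall h w, act h F w = eps h * F w.

Lemma lfun_act_comm A (T : (A -> k) -> k) (F : A -> word -> k) h w : lfun T ->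
  T (fun a => act h (F a) w) = act h (fun v => T (fun a => F a v)) w.
Proof.
move=> Tl; elim: w h F => [|x w IH] h F /=; first exact: (lfun_mul Tl).
rewrite (lfun_sw h (fun b c a => act c (fun v => F a (b * x :: v)) w) Tl).
by apply: eq_sw => b c; exact: (IH c (fun a v => F a (b * x :: v))).
Qed.

(** The simplicial differential: dd F (x0, ..., xn) is the alternating sum of the
values eps(x_i) F(x0, ..., xn with x_i dropped), starting with a plus sign. *)
Fixpoint dd F w : k :=
  if w is x :: w' then eps x * F w' - dd (fun v => F (x :: v)) w' else 0.

Lemma lfun_dd w : lfun (fun F => dd F w).
Proof. by elim: w => [|x w IH] c F G /=; rewrite ?IH; ring. Qed.

Lemma klin_dd_fun w (F : H -> word -> k) :
  (forall v, klin (fun x => F x v)) -> klin (fun x => dd (F x) w).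
Proof. exact: (lfun_klin (lfun_dd w)). Qed.

Lemma dd_sw w g (F : H -> H -> word -> k) :
  dd (fun v => sw g (fun b c => F b c v)) w = sw g (fun b c => dd (F b c) w).
Proof. exact: (lfun_sw g F (lfun_dd w)). Qed.

Lemma dd_sub w F G : dd (fun v => F v - G v) w = dd F w - dd G w.
Proof. exact: (lfun_sub (lfun_dd w)). Qed.

Lemma dd_add w F G : dd (fun v => F v + G v) w = dd F w + dd G w.
Proof. exact: (lfun_add (lfun_dd w)). Qed.

Lemma dd_mulc w c F : dd (fun v => c * F v) w = c * dd F w.
Proof. exact: (lfun_mul (lfun_dd w)). Qed.

Lemma dd_mulcr w c F : dd (fun v => F v * c) w = dd F w * c.
Proof. exact: (lfun_mulr (lfun_dd w)). Qed.

Lemma eq_dd F G w : (forall v, size v = (size w).-1 -> F v = G v) ->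
  dd F w = dd G w.
Proof.
elim: w F G => [|x w IH] F G e //=; rewrite e //; congr (_ - _).
case: w IH e => [|y w] IH e //; apply: IH => v ev.
by apply: e; rewrite /= ev.
Qed.

Lemma ML_dd F : ML F -> ML (dd F).
Proof.
move=> FL u; elim: u F FL => [|y u IH] F FL v /=.
  apply: klin_add; first by apply: klin_mulr; exact: eps_klin.
  apply: klin_opp; apply: klin_dd_fun => w.
  exact: ML_head.
apply: klin_add; first by apply: klin_mul; exact: FL.
by apply: klin_opp; apply: IH; exact: ML_cons.
Qed.

Lemma act_dd h F w : ML F -> act h (dd F) w = dd (act h F) w.
Proof.
elim: w h F => [|x w IH] h F FL /=; first by rewrite mulr0.
rewrite dd_sw.
transitivity (sw h (fun a b => eps a * (eps x * act b F w)
    - act b (dd (fun v => F (a * x :: v))) w)).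
  by apply: eq_sw => a b; rewrite act_sub act_mulc hEpsM mulrA.
rewrite sw_add sw_opp swk_counitl; last by apply: klin_mul; exact: klin_act.
by congr (_ - _); apply: eq_sw => a b; rewrite IH //; exact: ML_cons.
Qed.

Lemma Hinv_dd F : ML F -> Hinv F -> Hinv (dd F).
Proof.
move=> FL Fi h w; rewrite act_dd // -dd_mulc.
by apply: eq_dd => v _; exact: Fi.
Qed.

(** The differential is a graded derivation for concatenation of words. *)
Lemma dd_cat F u v : dd F (u ++ v) =
  dd (fun u' => F (u' ++ v)) u + (-1) ^+ size u * dd (fun v' => F (u ++ v')) v.
Proof.
elim: u F => [|x u IH] F /=; first by rewrite add0r expr0 mul1r.
by rewrite IH exprS; ring.
Qed.

Lemma dd_size (m : nat) F w :
  dd (fun v => (-1) ^+ (m * size v) * F v) w =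
  (-1) ^+ m * (-1) ^+ (m * size w) * dd F w.
Proof.
have [->|wn] := eqVneq w [::]; first by rewrite /= mulr0.
rewrite -dd_mulc; apply: eq_dd => v ev.
by case: w wn ev => //= x w _ ->; parity; ring.
Qed.

Lemma dd_dd F w : dd (dd F) w = 0.
Proof.
elim: w F => [|x w IH] F //=.
rewrite dd_sub IH dd_mulc; ring.
Qed.

End Words.

(** * Overlapping cuts of a word *)

Section Cuts.
Variables (k : comNzRingType) (H : algType k) (HA : hopf_algebra H).
Local Notation eps := (hEps HA).
Local Notation sw := (sw HA).
Local Notation word := (seq H).
Local Notation klin := (@klin k H).
Local Notation act := (act HA).
Local Notation dd := (dd HA).
Local Notation Hinv := (Hinv HA).
Implicit Types (F G : word -> k) (u v w : word) (P : word -> word -> k).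

(** The sum over all overlapping cuts of a word: cut P (x1, ..., xm) is the sum over i
of (-1)^(i-1) P(x1, ..., x_i(1)) (x_i(2), ..., xm), where the letter x_i is comultiplied. *)
Fixpoint cut P w : k :=
  if w is x :: w' then
    sw x (fun a b => P [:: a] (b :: w')) - cut (fun u v => P (x :: u) v) w'
  else 0.

Lemma lfun_cut_uncurried w : lfun (fun F : word * word -> k => cut (fun u v => F (u, v)) w).
Proof.
elim: w => [|x w IH] c F G /=; first by ring.
rewrite sw_add sw_mulrl.
by rewrite (IH c (fun p => F (x :: p.1, p.2)) (fun p => G (x :: p.1, p.2))) /=; ring.
Qed.

Lemma cut_mulc w c P : cut (fun u v => c * P u v) w = c * cut P w.
Proof. exact: (lfun_mul (lfun_cut_uncurried w) c (fun p => P p.1 p.2)). Qed.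

Lemma cut_mulcr w c P : cut (fun u v => P u v * c) w = cut P w * c.
Proof. exact: (lfun_mulr (lfun_cut_uncurried w) c (fun p => P p.1 p.2)). Qed.

Lemma cut_add w P Q : cut (fun u v => P u v + Q u v) w = cut P w + cut Q w.
Proof.
exact: (lfun_add (lfun_cut_uncurried w) (fun p => P p.1 p.2) (fun p => Q p.1 p.2)).
Qed.

Lemma cut_opp w P : cut (fun u v => - P u v) w = - cut P w.
Proof. exact: (lfun_opp (lfun_cut_uncurried w) (fun p => P p.1 p.2)). Qed.

Lemma cut_sub w P Q : cut (fun u v => P u v - Q u v) w = cut P w - cut Q w.
Proof. by rewrite cut_add cut_opp. Qed.

Lemma cut0 w : cut (fun _ _ => 0) w = 0.
Proof. exact: (lfun0 (lfun_cut_uncurried w)). Qed.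

Lemma cut_sum w I (s : seq I) (P : I -> word -> word -> k) :
  cut (fun u v => \sum_(i <- s) P i u v) w = \sum_(i <- s) cut (P i) w.
Proof. exact: (lfun_sum (lfun_cut_uncurried w) s (fun i p => P i p.1 p.2)). Qed.

Lemma cut_sw w h (P : H -> H -> word -> word -> k) :
  cut (fun u v => sw h (fun a b => P a b u v)) w = sw h (fun a b => cut (P a b) w).
Proof. exact: (lfun_sw HA h (fun a b p => P a b p.1 p.2) (lfun_cut_uncurried w)). Qed.

Lemma klin_cut w (P : H -> word -> word -> k) :
  (forall u v, klin (fun x => P x u v)) -> klin (fun x => cut (P x) w).
Proof.
move=> Pl; apply: (lfun_klin (lfun_cut_uncurried w) (F := fun x p => P x p.1 p.2)).
by move=> p; exact: Pl.
Qed.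

Lemma eq_cut_size w P Q :
  (forall u v, (0 < size u)%N -> (0 < size v)%N ->
     size u + size v = (size w).+1 -> P u v = Q u v)%N -> cut P w = cut Q w.
Proof.
elim: w P Q => [|x w IH] P Q e //=; congr (_ - _).
  by apply: eq_sw => a b; apply: e.
apply: IH => u v u0 v0 e'; apply: e => //.
by rewrite /= addSn e'.
Qed.

Lemma eq_cut w P Q : (forall u v, P u v = Q u v) -> cut P w = cut Q w.
Proof. by move=> e; apply: eq_cut_size. Qed.

Lemma lfun_cut A (T : (A -> k) -> k) (P : A -> word -> word -> k) w : lfun T ->
  T (fun a => cut (P a) w) = cut (fun u v => T (fun a => P a u v)) w.
Proof.
move=> Tl; elim: w P => [|x w IH] P /=; first exact: lfun0.
rewrite (lfun_sub Tl) -(IH (fun a u v => P a (x :: u) v)); congr (_ - _).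
exact: (lfun_sw HA x (fun b c a => P a [:: b] (c :: w)) Tl).
Qed.

(** Multilinearity in two words. *)
Definition ML2 P := (forall v, ML (P^~ v)) /\ (forall u, ML (P u)).

Lemma ML2_cons P x : ML2 P -> ML2 (fun u v => P (x :: u) v).
Proof.
by case=> P1 P2; split=> [v|u]; [exact: (ML_cons x (P1 v))|exact: P2].
Qed.

Lemma ML_cut P : ML2 P -> ML (cut P).
Proof.
move=> PL u; elim: u P PL => [|y u IH] P PL v /=; have [P1 P2] := PL.
  apply: klin_add.
    apply: klin_sw_arg; split=> y.
      exact: (P1 _ [::] [::]).
    exact: (P2 [:: y] [::]).
  by apply: klin_opp; apply: klin_cut => u' v'; exact: (P1 v' [::]).
apply: klin_add; last by apply: klin_opp; apply: IH; exact: ML2_cons.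
by apply: klin_sw => a b; exact: (P2 _ (b :: u)).
Qed.

(** Up to the differential of the pieces, the cut is a primitive of the difference of
the two extreme cuts, in which one of the pieces is empty. *)
Lemma dd_cut P w : ML2 P ->
  dd (cut P) w = P [::] w - P w [::]
    - cut (fun u v => dd (P^~ v) u) w
    - cut (fun u v => (-1) ^+ size u * dd (P u) v) w.
Proof.
elim: w P => [|x w IH] P PL /=; first by ring.
have [P1 P2] := PL.
rewrite dd_sub dd_sw IH; last exact: ML2_cons.
set A := sw x _; set B := cut _ w; set C := cut _ w; set D := cut _ w.
have -> : sw x (fun a b => eps a * P [::] (b :: w) - 0) = P [::] (x :: w).
  rewrite -(swk_counitl HA x (f := fun b => P [::] (b :: w))); last exact: ML_head.
  by apply: eq_sw => a b; rewrite subr0.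
have -> : cut (fun u v => eps x * P u v - dd (fun u' => P (x :: u') v) u) w
          = eps x * B - C.
  by rewrite cut_sub cut_mulc.
have -> : sw x (fun a b => (-1) ^+ 1 * (eps b * P [:: a] w - dd (fun v => P [:: a] (b :: v)) w))
          = A - P [:: x] w.
  transitivity (sw x (fun a b => dd (fun v => P [:: a] (b :: v)) w
                        + - (eps b * P [:: a] w))).
    by apply: eq_sw => a b; ring.
  rewrite sw_add sw_opp (swk_counitr HA x (f := fun a => P [:: a] w)) //.
  exact: (P1 w [::] [::]).
have -> : cut (fun u v => (-1) ^+ (size u).+1 * dd (P (x :: u)) v) w = - D.
  by rewrite -cut_opp; apply: eq_cut => u v; rewrite exprS mulN1r mulNr.
ring.
Qed.

Lemma cut_cat P u v : cut P (u ++ v) =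
  cut (fun a b => P a (b ++ v)) u +
  (-1) ^+ size u * cut (fun a b => P (u ++ a) b) v.
Proof.
elim: u P => [|x u IH] P /=; first by rewrite expr0; ring.
by rewrite IH exprS; ring.
Qed.

(** Multilinearity in three words. *)
Definition ML3 (T : word -> word -> word -> k) :=
  [/\ forall v w, ML (fun u => T u v w), forall u w, ML (fun v => T u v w)
    & forall u v, ML (T u v)].

(** Cutting the first piece again amounts to cutting the second piece again, by
coassociativity. *)
Lemma cut_coassoc T r : ML3 T ->
  cut (fun m w => cut (fun g x => T g x w) m) r =
  - cut (fun g r' => (-1) ^+ size g * cut (T g) r') r.
Proof.
elim: r T => [|x r IH] T TL /=; first by rewrite oppr0.
have [T1 T2 T3] := TL.
have -> : cut (fun u v => sw x (fun a b => T [:: a] (b :: u) v)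
                        - cut (fun g y => T (x :: g) y v) u) r =
    sw x (fun a b => cut (fun u v => T [:: a] (b :: u) v) r)
    - cut (fun m w => cut (fun g y => T (x :: g) y w) m) r.
  by rewrite cut_sub cut_sw.
rewrite IH; last first.
  by split=> [v w|u w|u v]; [exact: (ML_cons x (T1 v w))|exact: T2|exact: T3].
have -> : cut (fun u v => (-1) ^+ (size u).+1 * cut (T (x :: u)) v) r =
   - cut (fun g r' => (-1) ^+ size g * cut (T (x :: g)) r') r.
  by rewrite -cut_opp; apply: eq_cut => u v; rewrite exprS mulN1r mulNr.
have -> : sw x (fun a b => sw a (fun c e => T [:: c] [:: e] (b :: r)) - 0) =
   sw x (fun a b => sw b (fun c e => T [:: a] [:: c] (e :: r))).
  rewrite -(@swk_coassoc _ _ _ (fun a b c => T [:: a] [:: b] (c :: r))).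
  - by apply: eq_sw => a b; rewrite subr0.
  - by move=> b c; exact: (T1 _ _ [::] [::]).
  - by move=> a c; exact: (T2 _ _ [::] [::]).
  - by move=> a b; exact: (T3 _ _ [::]).
have -> : sw x (fun a b => (-1) ^+ 1 * (sw b (fun c e => T [:: a] [:: c] (e :: r))
      - cut (fun u v => T [:: a] (b :: u) v) r)) =
   sw x (fun a b => cut (fun u v => T [:: a] (b :: u) v) r)
   - sw x (fun a b => sw b (fun c e => T [:: a] [:: c] (e :: r))).
  by rewrite -sw_opp -sw_add; apply: eq_sw => a b; ring.
ring.
Qed.

(** The diagonal action on functions of two words. *)
Definition act2 h P u v :=
  sw h (fun a b => act a (fun u' => act b (P u') v) u).

Lemma act_cut h P w : ML2 P -> act h (cut P) w = cut (act2 h P) w.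
Proof.
elim: w h P => [|x w IH] h P PL /=; first by rewrite mulr0.
have [P1 P2] := PL.
have kl1 f b v : klin (fun a => P [:: a * f] (b :: v)).
  by apply: (klin_right (f := fun z => P [:: z] _)); exact: (P1 _ [::] [::]).
have kl2 g a v : klin (fun b => P [:: a] (b * g :: v)).
  by apply: (klin_right (f := fun z => P _ (z :: _))); exact: (P2 _ [::]).
transitivity (sw h (fun a b => sw a (fun c e => sw x (fun f g =>
     act b (fun v => P [:: c * f] (e * g :: v)) w)))
   - sw h (fun a b => cut (act2 b (fun u v => P (a * x :: u) v)) w)).
  rewrite -sw_opp -sw_add; apply: eq_sw => a b; rewrite act_sub; congr (_ - _).
    have -> : (fun v => sw (a * x) (fun c e => P [:: c] (e :: v))) =
       (fun v => sw a (fun c e => sw x (fun f g => P [:: c * f] (e * g :: v)))).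
      apply/funext => v; rewrite swk_mul //.
      by split=> y; [exact: (P1 _ [::] [::])|exact: (P2 _ [::])].
    by rewrite act_sw; apply: eq_sw => c e; rewrite act_sw.
  by rewrite IH //; exact: ML2_cons.
congr (_ - _); last first.
  rewrite -cut_sw; apply: eq_cut => u v; rewrite /act2 /=.
  rewrite -(@swk_coassoc _ _ _ (fun c e b => act e (fun u' => act b (P (c * x :: u')) v) u)) //.
  - move=> b c; do 2! apply: klin_act_fun => ?.
    by apply: (klin_right (f := fun z => P (z :: _) _)); exact: (P1 _ [::]).
  - move=> a b; apply: klin_act => u1 u2; apply: klin_act_fun => w'.
    exact: (P1 _ (_ :: u1)).
  - move=> a b; apply: klin_act_fun => w'.
    by apply: klin_act; exact: P2.
transitivity (sw h (fun a b => sw b (fun c e => sw x (fun f g =>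
     act e (fun v => P [:: a * f] (c * g :: v)) w)))).
  rewrite -(@swk_coassoc _ _ _ (fun c e b => sw x (fun f g =>
     act b (fun v => P [:: c * f] (e * g :: v)) w))) //.
  - by move=> b c; apply: klin_sw => f g; apply: klin_act_fun => v.
  - by move=> b c; apply: klin_sw => f g; apply: klin_act_fun => v.
  - move=> a b; apply: klin_sw => f g; apply: klin_act.
    by apply: ML_cons; exact: P2.
transitivity (sw h (fun a b => sw x (fun f g =>
   sw b (fun c e => act e (fun v => P [:: a * f] (c * g :: v)) w)))).
  by apply: eq_sw => a b; rewrite sw_exchange.
rewrite sw_exchange; apply: eq_sw => f g; rewrite /act2 /=.
apply: eq_sw => a b; rewrite (swk_counitr HA a (f := fun z => sw b (fun c e =>
  act e (fun v => P [:: z * f] (c * g :: v)) w))) //.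
by apply: klin_sw => c e; apply: klin_act_fun => v.
Qed.

(** Invariance of functions of two words. It suffices for the invariance of the cut,
because the cut letter is comultiplied ([Hinv_cut]). *)
Definition Hinv2 P := forall h u v, act2 h P u v = eps h * P u v.

Lemma Hinv_cut P : ML2 P -> Hinv2 P -> Hinv (cut P).
Proof.
by move=> PL Pi h w; rewrite act_cut // -cut_mulc; apply: eq_cut => u v; exact: Pi.
Qed.

(** * Cuts into several pieces *)

(** [Psi] is linear in every letter of every word of its argument. *)
Definition MLs (Psi : seq word -> k) := forall l1 u v l2,
  klin (fun x => Psi (l1 ++ (u ++ x :: v) :: l2)).

(** The sum over all overlapping cuts of a word into r + 1 pieces. The sign makes
[dd_cuts] hold with the alternating signs of a simplicial differential. *)
Fixpoint cuts r (Psi : seq word -> k) w : k :=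
  if r is r'.+1 then
    cut (fun u v => (-1) ^+ (r' * size u) * cuts r' (fun l => Psi (u :: l)) v) w
  else Psi [:: w].

Lemma cutsS r Psi w : cuts r.+1 Psi w =
  cut (fun u v => (-1) ^+ (r * size u) * cuts r (fun l => Psi (u :: l)) v) w.
Proof. by []. Qed.

Lemma MLs_cons Psi u : MLs Psi -> MLs (fun l => Psi (u :: l)).
Proof. by move=> PL l1; exact: (PL (u :: l1)). Qed.

Lemma MLs_head Psi l : MLs Psi -> ML (fun u => Psi (u :: l)).
Proof. by move=> PL u v; exact: (PL [::]). Qed.

Lemma eq_cuts_size r Psi Psi' w :
  (forall l, size l = r.+1 -> sumn (map size l) = (size w + r)%N -> Psi l = Psi' l) ->
  cuts r Psi w = cuts r Psi' w.
Proof.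
elim: r Psi Psi' w => [|r IH] Psi Psi' w e /=.
  by apply: e => //=; rewrite !addn0.
apply: eq_cut_size => u v u0 v0 uv; congr (_ * _); apply: IH => l ls ln.
by apply: e => /=; rewrite ?ls // ln addnA uv addSn addnS.
Qed.

Lemma eq_cuts r Psi Psi' w : (forall l, size l = r.+1 -> Psi l = Psi' l) ->
  cuts r Psi w = cuts r Psi' w.
Proof. by move=> e; apply: eq_cuts_size => l ls _; exact: e. Qed.

Lemma lfun_cuts A (T : (A -> k) -> k) (Psi : A -> seq word -> k) r w : lfun T ->
  T (fun a => cuts r (Psi a) w) = cuts r (fun l => T (fun a => Psi a l)) w.
Proof.
move=> Tl; elim: r Psi w => [|r IH] Psi w //=.
rewrite (lfun_cut _ _ Tl); apply: eq_cut => u v.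
by rewrite (lfun_mul Tl) (IH (fun a l => Psi a (u :: l))).
Qed.

Lemma cuts_mulc r c Psi w : cuts r (fun l => c * Psi l) w = c * cuts r Psi w.
Proof.
elim: r Psi w => [|r IH] Psi w //=.
by rewrite -cut_mulc; apply: eq_cut => u v; rewrite IH; ring.
Qed.

Lemma cuts_add r Psi Psi' w :
  cuts r (fun l => Psi l + Psi' l) w = cuts r Psi w + cuts r Psi' w.
Proof.
elim: r Psi Psi' w => [|r IH] Psi Psi' w //=.
by rewrite -cut_add; apply: eq_cut => u v; rewrite IH; ring.
Qed.

Lemma cuts0 r w : cuts r (fun=> 0) w = 0.
Proof.
transitivity (0 * cuts r (fun=> 0) w); last by rewrite mul0r.
by rewrite -cuts_mulc; apply: eq_cuts => l _; rewrite mul0r.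
Qed.

Lemma klin_cuts r w (Psi : H -> seq word -> k) :
  (forall l, klin (fun x => Psi x l)) -> klin (fun x => cuts r (Psi x) w).
Proof.
move=> Pl c x y; rewrite -cuts_mulc -cuts_add; apply: eq_cuts => l _; exact: Pl.
Qed.

Lemma ML2_cuts r Psi : MLs Psi -> (forall Psi', MLs Psi' -> ML (cuts r Psi')) ->
  ML2 (fun u v => (-1) ^+ (r * size u) * cuts r (fun l => Psi (u :: l)) v).
Proof.
move=> PL IH; split=> [v|u]; last by apply: ML_mul; exact/IH/MLs_cons.
apply: (ML_size (fun n => (-1) ^+ (r * n))) => u u' /=.
by apply: klin_cuts => l; exact: MLs_head.
Qed.

Lemma ML_cuts r Psi : MLs Psi -> ML (cuts r Psi).
Proof.
elim: r Psi => [|r IH] Psi PL /=; first by move=> u v; exact: (PL [::] u v [::]).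
by apply: ML_cut; exact: ML2_cuts.
Qed.

(** The differential on functions of several words, with the Koszul signs for words
graded by their length. *)
Fixpoint dds (Psi : seq word -> k) (l : seq word) : k :=
  if l is u :: l' then
    dd (fun u' => Psi (u' :: l')) u + (-1) ^+ size u * dds (fun l' => Psi (u :: l')) l'
  else 0.

(** Insertion of an empty word at position j. *)
Definition put_nil j (l : seq word) := take j l ++ [::] :: drop j l.

(** The differential of an operation defined by cuts is, up to sign, the operation
defined by the differential, plus the alternating sum of the degenerate cuts. *)
Lemma dd_cuts r Psi w : MLs Psi ->
  dd (cuts r.+1 Psi) w = (-1) ^+ r.+1 * cuts r.+1 (dds Psi) w
    + \sum_(j < r.+2) (-1) ^+ j * cuts r (fun l => Psi (put_nil j l)) w.
Proof.
elim: r Psi w => [|r IH] Psi w PL.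
  rewrite [cuts 1 Psi]/= dd_cut; last first.
    by apply: (ML2_cuts (r := 0)) => // Psi' PL'; exact: ML_cuts.
  rewrite !big_ord_recl big_ord0 /= /put_nil /=.
  have E (X : word -> word -> k) : cut (fun u v => (-1) ^+ (0 * size u) * X u v) w =
      cut (fun u v => 1 * X u v) w by apply: eq_cut => u v; rewrite mul0n.
  rewrite E {E} /=.
  rewrite !mul0n !expr0 !mul1r addr0 !expr1 !mulN1r.
  have -> : cut (fun u v => dd (fun x => 1 * Psi [:: x; v]) u) w =
            cut (fun u v => dd (fun x => Psi [:: x; v]) u) w.
    by apply: eq_cut => u v; rewrite dd_mulc mul1r.
  have -> : cut (fun u v => (-1) ^+ size u * dd (fun x => 1 * Psi [:: u; x]) v) w =
            cut (fun u v => (-1) ^+ size u * dd (fun x => Psi [:: u; x]) v) w.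
    by apply: eq_cut => u v; rewrite dd_mulc mul1r.
  have -> : cut (fun u v => 1 * (dd (fun x => Psi [:: x; v]) u +
       (-1) ^+ size u * (dd (fun x => Psi [:: u; x]) v + (-1) ^+ size v * 0))) w =
      cut (fun u v => dd (fun x => Psi [:: x; v]) u) w +
      cut (fun u v => (-1) ^+ size u * dd (fun v0 => Psi [:: u; v0]) v) w.
    by rewrite -cut_add; apply: eq_cut => u v; ring.
  ring.
pose P u v := (-1) ^+ (r.+1 * size u) * cuts r.+1 (fun l => Psi (u :: l)) v.
have -> : dd (cuts r.+2 Psi) w = dd (cut P) w by [].
rewrite dd_cut; last by apply: ML2_cuts => // Psi' PL'; exact: ML_cuts.
have -> : P w [::] = 0 by rewrite /P /= mulr0.
rewrite big_ord_recl.
have -> : P [::] w = cuts r.+1 (fun l => Psi (put_nil 0 l)) w.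
  rewrite /P muln0 expr0 mul1r; apply: eq_cuts => l _.
  by rewrite /put_nil take0 drop0.
have -> : \sum_(i < r.+2) (-1) ^+ lift ord0 i *
     cuts r.+1 (fun l => Psi (put_nil (lift ord0 i) l)) w =
   - cut (fun u v => (-1) ^+ (r * size u) * \sum_(j < r.+2) (-1) ^+ j *
        cuts r (fun l => Psi (u :: put_nil j l)) v) w.
  rewrite -cut_opp; transitivity (cut (fun u v => \sum_(j < r.+2)
    - ((-1) ^+ (r * size u) * ((-1) ^+ j * cuts r (fun l => Psi (u :: put_nil j l)) v))) w).
    rewrite cut_sum; apply: eq_bigr => j _; rewrite cutsS -cut_mulc.
    apply: eq_cut => u v; rewrite lift0 exprS.
    rewrite -[cuts r (fun l => Psi (put_nil _ (u :: l))) v]/(cuts r (fun l =>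
      Psi (u :: put_nil j l)) v); ring.
  by apply: eq_cut => u v; rewrite mulr_sumr sumrN.
have -> : cut (fun u v => dd (P^~ v) u) w =
   (-1) ^+ r.+1 * cut (fun u v => (-1) ^+ (r.+1 * size u) *
     cuts r.+1 (fun l => dd (fun u' => Psi (u' :: l)) u) v) w.
  rewrite -cut_mulc; apply: eq_cut => u v.
  rewrite /P dd_size (lfun_cuts (fun u' l => Psi (u' :: l)) _ _ (lfun_dd HA u)).
  by rewrite mulrA.
have -> : cut (fun u v => (-1) ^+ size u * dd (P u) v) w =
   cut (fun u v => (-1) ^+ size u * ((-1) ^+ (r.+1 * size u) * ((-1) ^+ r.+1 *
      cuts r.+1 (fun l => dds (fun l' => Psi (u :: l')) l) v))) w
   + cut (fun u v => (-1) ^+ (r * size u) * \sum_(j < r.+2) (-1) ^+ j *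
        cuts r (fun l => Psi (u :: put_nil j l)) v) w.
  rewrite -cut_add; apply: eq_cut => u v; rewrite /P dd_mulc IH; last exact: MLs_cons.
  by rewrite mulrDr mulrDr; congr (_ + _); rewrite mulrA; congr (_ * _); parity; ring.
have -> : cuts r.+2 (dds Psi) w =
   cut (fun u v => (-1) ^+ (r.+1 * size u) *
     cuts r.+1 (fun l => dd (fun u' => Psi (u' :: l)) u) v) w
   + cut (fun u v => (-1) ^+ size u * ((-1) ^+ (r.+1 * size u) *
      cuts r.+1 (fun l => dds (fun l' => Psi (u :: l')) l) v)) w.
  rewrite cutsS -cut_add; apply: eq_cut => u v.
  rewrite -[cuts r.+1 (fun l => dds Psi (u :: l)) v]/(cuts r.+1 (fun l =>
    dd (fun u' => Psi (u' :: l)) u + (-1) ^+ size u * dds (fun l' => Psi (u :: l')) l) v).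
  rewrite cuts_add cuts_mulc; ring.
have -> : cut (fun u v => (-1) ^+ size u * ((-1) ^+ (r.+1 * size u) * ((-1) ^+ r.+1 *
      cuts r.+1 (fun l => dds (fun l' => Psi (u :: l')) l) v))) w =
   (-1) ^+ r.+1 * cut (fun u v => (-1) ^+ size u * ((-1) ^+ (r.+1 * size u) *
      cuts r.+1 (fun l => dds (fun l' => Psi (u :: l')) l) v)) w.
  by rewrite -cut_mulc; apply: eq_cut => u v; ring.
rewrite expr0 [(-1) ^+ r.+2]exprS; ring.
Qed.
End Cuts.

(** * The diagonal action on several pieces *)

Section Patterns.
Variables (k : comNzRingType) (H : algType k) (HA : hopf_algebra H).
Local Notation eps := (hEps HA).
Local Notation sw := (sw HA).
Local Notation word := (seq H).
Local Notation klin := (@klin k H).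
Local Notation act := (act HA).
Local Notation dd := (dd HA).
Local Notation cut := (cut HA).
Local Notation cuts := (cuts HA).
Local Notation Hinv := (Hinv HA).
Implicit Types (F G X : word -> k) (u v w : word) (P : word -> word -> k).
Implicit Types (Psi : seq word -> k) (l : seq word).

(** The diagonal action on functions of several words. *)
Fixpoint acts h Psi l : k :=
  if l is u :: l' then
    sw h (fun a b => act a (fun u' => acts b (fun l' => Psi (u' :: l')) l') u)
  else eps h * Psi [::].

Lemma lfun_acts h l : lfun (fun Psi => acts h Psi l).
Proof.
elim: l h => [|u l IH] h c Psi Psi' /=; first by ring.
rewrite -sw_mulrl -sw_add; apply: eq_sw => a b.
by rewrite -(lfun_act HA a u); apply: eq_act => u'; exact: IH.
Qed.

Lemma eq_acts h Psi Psi' l :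
  (forall l', map size l' = map size l -> Psi l' = Psi' l') ->
  acts h Psi l = acts h Psi' l.
Proof.
elim: l h Psi Psi' => [|u l IH] h Psi Psi' e /=; first by rewrite e.
apply: eq_sw => a b; apply: eq_act_size => u' eu; apply: IH => l' el.
by apply: e; rewrite /= eu el.
Qed.

Lemma acts_shape (c : seq nat -> k) h Psi l :
  acts h (fun l => c (map size l) * Psi l) l = c (map size l) * acts h Psi l.
Proof.
rewrite -(lfun_mul (lfun_acts h l)); apply: eq_acts => l' e.
by rewrite e.
Qed.

Lemma klin_acts l Psi : MLs Psi -> klin (fun h => acts h Psi l).
Proof.
elim: l Psi => [|u l IH] Psi PL /=; first by apply: klin_mulr; exact: eps_klin.
apply: klin_sw_arg; split=> y.
  apply: klin_act => u1 u2; apply: (lfun_klin (lfun_acts y l)) => l'.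
  exact: (PL [::]).
by apply: klin_act_fun => u'; exact/IH/MLs_cons.
Qed.

Lemma cuts_sw h r (Psi : H -> H -> seq word -> k) w :
  sw h (fun a b => cuts r (Psi a b) w) = cuts r (fun l => sw h (fun a b => Psi a b l)) w.
Proof.
have L : lfun (fun Psi => cuts r Psi w).
  by move=> c F G; rewrite cuts_add cuts_mulc.
exact: esym (lfun_sw HA h Psi L).
Qed.

Lemma act_cuts h r Psi w : MLs Psi ->
  act h (cuts r Psi) w = cuts r (acts h Psi) w.
Proof.
elim: r h Psi w => [|r IH] h Psi w PL.
  rewrite /= (_ : sw h _ = sw h (fun a b => eps b * act a (fun u => Psi [:: u]) w)).
    rewrite (swk_counitr HA h (f := fun a => act a (fun u => Psi [:: u]) w)) //.
    by apply: klin_act => u v; exact: (PL [::]).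
  by apply: eq_sw => a b; rewrite act_mulc.
rewrite cutsS [LHS]act_cut; last by apply: ML2_cuts => // *; exact: ML_cuts.
apply: eq_cut => u v; rewrite /act2.
transitivity (sw h (fun a b => (-1) ^+ (r * size u) *
   act a (fun u' => cuts r (acts b (fun l => Psi (u' :: l))) v) u)).
  apply: eq_sw => a b; rewrite -act_mulc; apply: eq_act_size => u' eu.
  by rewrite act_mulc eu IH //; exact: MLs_cons.
rewrite sw_mulrl; congr (_ * _); rewrite [RHS]/= -cuts_sw; apply: eq_sw => a b.
exact: (lfun_cuts HA (fun u' => acts b (fun l => Psi (u' :: l))) r v (lfun_act HA a u)).
Qed.

(** Invariance on lists of r words. *)
Definition Hinvs r Psi := forall h l, size l = r -> acts h Psi l = eps h * Psi l.

Lemma Hinv_cuts r Psi : MLs Psi -> Hinvs r.+1 Psi -> Hinv (cuts r Psi).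
Proof.
move=> PL Pi h w; rewrite act_cuts // -cuts_mulc.
by apply: eq_cuts => l ls; rewrite Pi.
Qed.

(** An invariant factor G evaluated on a piece of its own drops out of the action. *)
Lemma acts_skip Psi Psi' G h g l : ML G -> MLs Psi' -> Hinv G ->
  (forall g' l', size l' = size l -> Psi (g' :: l') = G g' * Psi' l') ->
  acts h Psi (g :: l) = G g * acts h Psi' l.
Proof.
move=> GL PL Gi e /=.
transitivity (sw h (fun a b => eps a * (G g * acts b Psi' l))).
  apply: eq_sw => a b; rewrite mulrA -Gi -(lfun_mulr (lfun_act HA a g)).
  apply: eq_act => g'; rewrite -(lfun_mul (lfun_acts b l)).
  by apply: eq_acts => l' sl; apply: e; rewrite -(size_map size l') sl size_map.
by apply: swk_counitl; apply: klin_mul; exact: klin_acts.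
Qed.

Lemma acts_skip2 Psi Psi' G h u g l : ML G -> MLs Psi' -> Hinv G ->
  (forall u' g' l', size l' = size l -> Psi (u' :: g' :: l') = G g' * Psi' (u' :: l')) ->
  acts h Psi (u :: g :: l) = G g * acts h Psi' (u :: l).
Proof.
move=> GL PL Gi e; rewrite [LHS]/= [in RHS]/= -sw_mulrl; apply: eq_sw => a b.
rewrite -act_mulc; apply: eq_act => u'.
apply: (acts_skip (Psi := fun l => Psi (u' :: l))) => //; first exact: MLs_cons.
exact: e.
Qed.

(** Two adjacent pieces that are only used joined together can be joined first. *)
Lemma acts_merge Psi Psi' h u v l : MLs Psi' ->
  (forall u' v' l', size l' = size l -> Psi (u' :: v' :: l') = Psi' ((u' ++ v') :: l')) ->
  acts h Psi (u :: v :: l) = acts h Psi' ((u ++ v) :: l).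
Proof.
move=> PL e /=.
transitivity (sw h (fun a b => sw b (fun c e => act a (fun u' => act c (fun v' =>
  acts e (fun l => Psi' ((u' ++ v') :: l)) l) v) u))).
  apply: eq_sw => a b; rewrite -act_sw; apply: eq_act => u'.
  apply: eq_sw => c f; apply: eq_act => v'; apply: eq_acts => l' sl.
  by apply: e; rewrite -(size_map size l') sl size_map.
have PM t l' : ML (fun w => acts t (fun l => Psi' (w :: l)) l').
  move=> w1 w2; apply: (lfun_klin (lfun_acts t l')) => l''.
  exact: (PL [::]).
rewrite -(@swk_coassoc _ _ _ (fun a c e => act a (fun u' => act c (fun v' =>
  acts e (fun l => Psi' ((u' ++ v') :: l)) l) v) u)).
- apply: eq_sw => a b; rewrite act_cat //.
- move=> b c; apply: klin_act => w1 w2; apply: klin_act_fun => v'.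
  exact: (ML_catr v' (PM _ _)).
- move=> a c; apply: klin_act_fun => u'; apply: klin_act.
  exact: (ML_catl u' (PM _ _)).
move=> a b; do 2! apply: klin_act_fun => ?; apply: klin_acts.
exact: MLs_cons.
Qed.

Lemma acts_single Psi h u : MLs Psi -> acts h Psi [:: u] = act h (fun u => Psi [:: u]) u.
Proof.
move=> PL /=; transitivity (sw h (fun a b => eps b * act a (fun u => Psi [:: u]) u)).
  by apply: eq_sw => a b; rewrite act_mulc.
apply: (swk_counitr HA h (f := fun a => act a (fun u => Psi [:: u]) u)).
by apply: klin_act; exact: MLs_head.
Qed.

(** * Patterns *)

(** A function of r words as a function on lists of words, with value 0 on the lists
of other lengths; likewise below for r = 2, ..., 5. *)
Definition pat1 (T : word -> k) l := if l is [:: a] then T a else 0.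
Definition pat2 (T : word -> word -> k) l := if l is [:: a; b] then T a b else 0.
Definition pat3 (T : word -> word -> word -> k) l :=
  if l is [:: a; b; c] then T a b c else 0.
Definition pat4 (T : word -> word -> word -> word -> k) l :=
  if l is [:: a; b; c; e] then T a b c e else 0.
Definition pat5 (T : word -> word -> word -> word -> word -> k) l :=
  if l is [:: a; b; c; e; f] then T a b c e f else 0.

(** A sign that depends on the lengths of the words only. *)
Definition signed (e : seq nat -> nat) Psi l := (-1) ^+ e (map size l) * Psi l.

Lemma MLs_signed e Psi : MLs Psi -> MLs (signed e Psi).
Proof.
move=> PL l1 u v l2 c x y; rewrite /signed.
have E z : map size (l1 ++ (u ++ z :: v) :: l2) = map size (l1 ++ (u ++ 1 :: v) :: l2).
  by rewrite !map_cat /= !size_cat.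
by rewrite (E (c *: x + y)) (E x) (E y) PL; ring.
Qed.

Lemma Hinvs_signed e r Psi : Hinvs r Psi -> Hinvs r (signed e Psi).
Proof.
move=> Pi h l ls; rewrite (acts_shape (fun s => (-1) ^+ e s)) Pi // /signed.
by rewrite mulrCA.
Qed.

Lemma MLs_pat1 T : ML T -> MLs (pat1 T).
Proof.
move=> TL [|a l1] u v [|b l2] c x y /=; rewrite ?mulr0 ?addr0 //.
- exact: TL.
- by case: l1 => /= *; rewrite ?mulr0 ?addr0.
by case: l1 => /= *; rewrite ?mulr0 ?addr0.
Qed.

Lemma MLs_pat2 T : ML2 T -> MLs (pat2 T).
Proof.
move=> [T1 T2] [|a [|b l1]] u v [|a' [|b' l2]] c x y /=; rewrite ?mulr0 ?addr0 //;
  try exact: T1; try exact: T2;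
  by case: l1 => /= *; rewrite ?mulr0 ?addr0.
Qed.

Lemma MLs_pat3 T : ML3 T -> MLs (pat3 T).
Proof.
move=> [T1 T2 T3] [|a [|b [|d l1]]] u v [|a' [|b' [|d' l2]]] c x y /=;
  rewrite ?mulr0 ?addr0 //;
  try exact: T1; try exact: T2; try exact: T3;
  by case: l1 => /= *; rewrite ?mulr0 ?addr0.
Qed.

(** Multilinearity in four words. *)
Definition ML4 (T : word -> word -> word -> word -> k) :=
  [/\ forall b c e, ML (fun a => T a b c e), forall a c e, ML (fun b => T a b c e),
     forall a b e, ML (fun c => T a b c e) & forall a b c, ML (T a b c)].

Lemma MLs_pat4 T : ML4 T -> MLs (pat4 T).
Proof.
move=> [T1 T2 T3 T4] [|a [|b [|d [|f l1]]]] u v [|a' [|b' [|d' [|f' l2]]]] c x y /=;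
  rewrite ?mulr0 ?addr0 //;
  try exact: T1; try exact: T2; try exact: T3; try exact: T4;
  by case: l1 => /= *; rewrite ?mulr0 ?addr0.
Qed.

(** Multilinearity in five words. *)
Definition ML5 (T : word -> word -> word -> word -> word -> k) :=
  [/\ forall b c e f, ML (fun a => T a b c e f), forall a c e f, ML (fun b => T a b c e f),
     forall a b e f, ML (fun c => T a b c e f), forall a b c f, ML (fun e => T a b c e f) &
     forall a b c e, ML (T a b c e)].

Lemma MLs_pat5 T : ML5 T -> MLs (pat5 T).
Proof.
move=> [T1 T2 T3 T4 T5] [|a [|b [|d [|f [|g l1]]]]] u v
   [|a' [|b' [|d' [|f' [|g' l2]]]]] c x y /=;
  rewrite ?mulr0 ?addr0 //;
  try exact: T1; try exact: T2; try exact: T3; try exact: T4; try exact: T5;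
  by case: l1 => /= *; rewrite ?mulr0 ?addr0.
Qed.

Lemma dd_sign (f : nat -> nat) F u : (forall n, odd (f n.+2) = odd (f n)) ->
  dd (fun u' => (-1) ^+ f (size u') * F u') u = (-1) ^+ f (size u).+1 * dd F u.
Proof.
move=> fe; case: u => [|x u]; first by rewrite /= mulr0.
rewrite -dd_mulc; apply: eq_dd => v -> /=.
by rewrite !expr_parity fe.
Qed.

Lemma cuts1E Psi w : cuts 1 Psi w = cut (fun u v => Psi [:: u; v]) w.
Proof. by rewrite cutsS; apply: eq_cut => u v; rewrite mul0n mul1r. Qed.

Lemma cuts2E Psi w : cuts 2 Psi w =
  cut (fun u r => (-1) ^+ size u * cut (fun g v => Psi [:: u; g; v]) r) w.
Proof.
by rewrite cutsS; apply: eq_cut => u r; rewrite mul1n cuts1E.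
Qed.

Lemma cuts3E Psi w : cuts 3 Psi w =
  cut (fun u r => cut (fun g s => (-1) ^+ size g *
    cut (fun v x => Psi [:: u; g; v; x]) s) r) w.
Proof.
rewrite cutsS; apply: eq_cut => u r; rewrite cuts2E.
by rewrite mulnC exprM sqrr_sign mul1r.
Qed.

End Patterns.

(** * Turning a word by the grouplike element *)

Section Turn.
Variables (k : comNzRingType) (H : algType k) (HA : hopf_algebra H).
Variables (sigma sigma_inv : H).
Hypothesis sigma_grouplike : grouplike HA sigma.
Hypothesis sigma_invl : sigma_inv * sigma = 1.
Hypothesis twisted_involution :
  forall h : H, hS HA (hS HA h) = sigma * h * sigma_inv.
Local Notation eps := (hEps HA).
Local Notation sw := (sw HA).
Local Notation word := (seq H).
Local Notation klin := (@klin k H).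
Local Notation act := (act HA).
Local Notation dd := (dd HA).
Local Notation cut := (cut HA).
Local Notation Hinv := (Hinv HA).
Implicit Types (F G X : word -> k) (u v w : word) (P : word -> word -> k).
Implicit Types (Psi : seq word -> k) (l : seq word).

(** Left multiplication of every letter by [sigma], which is the diagonal action of
[sigma] as [sigma] is grouplike. *)
Definition sh w := [seq sigma * x | x <- w].

Lemma sh_cat u v : sh (u ++ v) = sh u ++ sh v. Proof. exact: map_cat. Qed.

Lemma size_sh u : size (sh u) = size u. Proof. exact: size_map. Qed.

Lemma ML_sh F : ML F -> ML (fun v => F (sh v)).
Proof.
move=> FL u v c x y; rewrite !sh_cat /=.
by rewrite mulrDr -scalerAr; exact: FL.
Qed.

Lemma act_sigma F w : ML F -> act sigma F w = F (sh w).
Proof.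
elim: w F => [|x w IH] F FL /=; first by rewrite sigma_grouplike.2 mul1r.
rewrite (swk_grouplike sigma_grouplike).
  by rewrite IH //; exact: ML_cons.
split=> y; last by apply: klin_act; exact: ML_cons.
by apply: klin_act_fun => v; apply: (klin_right (f := fun z => F (z :: v))); exact: ML_head.
Qed.

Lemma Hinv_sh F w : ML F -> Hinv F -> F (sh w) = F w.
Proof. by move=> FL Fi; rewrite -act_sigma // Fi sigma_grouplike.2 mul1r. Qed.

Lemma dd_sh F w : dd (fun v => F (sh v)) w = dd F (sh w).
Proof.
elim: w F => [|x w IH] F //=; rewrite hEpsM sigma_grouplike.2 mul1r.
by rewrite (IH (fun v => F (sigma * x :: v))).
Qed.

Lemma cut_sh P w : ML2 P -> cut P (sh w) = cut (fun u v => P (sh u) (sh v)) w.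
Proof.
elim: w P => [|x w IH] P PL //=; have [P1 P2] := PL.
rewrite IH; last exact: ML2_cons.
congr (_ - _); rewrite swk_mul; last first.
  by split=> y; [exact: (P1 _ [::] [::])|exact: (P2 _ [::])].
rewrite (swk_grouplike sigma_grouplike) //.
by split=> y; apply: klin_sw => a b;
   [apply: (klin_right (f := fun z => P [:: z] _)); exact: (P1 _ [::] [::])
   |apply: (klin_right (f := fun z => P _ (z :: _))); exact: (P2 _ [::])].
Qed.

(** Invariance moves the action from one part of a word to the other, through the
antipode. *)
Lemma act_transfer F a u v : ML F -> Hinv F ->
  act a (fun u' => F (u' ++ v)) u = act (hS HA a) (fun v' => F (u ++ v')) v.
Proof.
move=> FL Fi.
have MLa (q : H) v' : ML (fun u' => act q (fun v => F (u' ++ v)) v').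
  move=> u1 u2; apply: klin_act_fun => v''.
  exact: (ML_catr v'' FL).
transitivity (sw a (fun p r => sw r (fun q y =>
    act p (fun u' => act (q * hS HA y) (fun v => F (u' ++ v)) v) u))).
  transitivity (sw a (fun p r => eps r * act p (fun u' => F (u' ++ v)) u)).
    by rewrite swk_counitr //; apply: klin_act; exact: ML_catr.
  apply: eq_sw => p r.
  rewrite (swk_antipoder HA r (f := fun z => act p (fun u' => act z (fun v => F (u' ++ v)) v) u)).
    by congr (_ * _); apply: eq_act => u'; rewrite act_1 //; exact: ML_catl.
  by apply: klin_act_fun => u'; apply: klin_act; exact: ML_catl.
rewrite -(@swk_coassoc _ _ _ (fun p q y =>
    act p (fun u' => act (q * hS HA y) (fun v => F (u' ++ v)) v) u)).
- rewrite -(swk_counitl HA a (f := fun y => act (hS HA y) (fun v' => F (u ++ v')) v)); last first.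
    by apply: (klin_S HA (f := fun z => act z _ v)); apply: klin_act; exact: ML_catl.
  apply: eq_sw => x y; rewrite -act_mulc.
  rewrite [RHS](@eq_act _ _ HA _ _ (fun v' => sw x (fun p q => act p (fun u' =>
      act q (fun v' => F (u' ++ v')) v') u))); last first.
    by move=> v'; rewrite -act_cat // Fi.
  rewrite act_sw; apply: eq_sw => p q.
  rewrite (lfun_act_comm HA (fun v' u' => act q (fun v' => F (u' ++ v')) v') p u (lfun_act HA (hS HA y) v)).
  by apply: eq_act => u'; rewrite act_mul //; exact: ML_catl.
- by move=> b c; apply: klin_act.
- move=> p y; apply: klin_act_fun => u'.
  apply: (klin_right (f := fun z => act z _ v)); apply: klin_act; exact: ML_catl.
move=> p q; apply: klin_act_fun => u'.
apply: (klin_S HA (f := fun y => act (q * y) _ v)).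
apply: (klin_left (f := fun z => act z _ v)); apply: klin_act; exact: ML_catl.
Qed.

(** The only use of the hypothesis on the square of the antipode: S(h_(2)) sigma h_(1)
is S(S(h_(1)) h_(2)) sigma, because sigma h_(1) = S^2(h_(1)) sigma. *)
Lemma hS_twist h (f : H -> k) : klin f ->
  sw h (fun a b => f (hS HA b * (sigma * a))) = eps h * f sigma.
Proof.
move=> fl; transitivity (sw h (fun a b => f (hS HA (hS HA a * b) * sigma))).
  apply: eq_sw => a b; congr f; rewrite hS_mul -mulrA twisted_involution.
  by rewrite -(mulrA _ sigma_inv) sigma_invl mulr1.
rewrite (swk_antipodel HA h (f := fun z => f (hS HA z * sigma))).
  by rewrite hS_1 mul1r.
by apply: (klin_S HA (f := fun z => f (z * sigma))); exact: klin_right.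
Qed.

(** F evaluated with the first piece v moved behind u and multiplied by [sigma]. *)
Definition turn F v u := F (u ++ sh v).

Lemma ML_turn F : ML F -> ML2 (turn F).
Proof.
move=> FL; split=> [u|v]; last by apply: ML_catr.
by apply: (ML_sh (F := fun v => F (u ++ v))); apply: ML_catl.
Qed.

Lemma Hinv2_turn F : ML F -> Hinv F -> Hinv2 HA (turn F).
Proof.
move=> FL Fi h v u; rewrite /act2 /turn.
have FLu : ML (fun v => F (u ++ v)) by exact: ML_catl.
transitivity (sw h (fun a b =>
    act (hS HA b * (sigma * a)) (fun v => F (u ++ v)) v)); last first.
  rewrite (hS_twist h (f := fun z => act z (fun v => F (u ++ v)) v)).
    by rewrite act_sigma.
  exact: klin_act.
apply: eq_sw => a b; rewrite act_mul // act_mul; last exact: ML_act.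
apply: eq_act => v'; rewrite act_sigma; last exact: ML_act.
by rewrite (act_transfer _ _ _ FL Fi).
Qed.

End Turn.

(** * Cup product, insertion and the operator B on homogeneous cochains *)

(** Proves an identity between signs from an equation [e] between natural numbers. *)
Ltac by_parity e :=
  move: (congr1 odd e); rewrite ?oddD /=; parity => //= *; ring.

Section Operations.
Variables (k : comNzRingType) (H : algType k) (HA : hopf_algebra H).
Variables (sigma sigma_inv : H).
Hypothesis sigma_grouplike : grouplike HA sigma.
Hypothesis sigma_invl : sigma_inv * sigma = 1.
Hypothesis twisted_involution :
  forall h : H, hS HA (hS HA h) = sigma * h * sigma_inv.
Local Notation eps := (hEps HA).
Local Notation sw := (sw HA).
Local Notation word := (seq H).
Local Notation acts := (acts HA).
Local Notation dd := (dd HA).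
Local Notation cut := (cut HA).
Local Notation cuts := (cuts HA).
Local Notation Hinv := (Hinv HA).
Implicit Types (F G X : word -> k) (u v w : word) (P : word -> word -> k).
Implicit Types (Psi : seq word -> k) (l : seq word).

Local Notation sh := (sh sigma).
Local Notation turn := (turn sigma).

(** Functionals that vanish on the words of length other than n. A homogeneous cochain
of degree p lives on the words of length p + 1. *)
Definition on_length n F := forall w, size w != n -> F w = 0.

Lemma on_length_cuts n r Psi :
  (forall l, size l = r.+1 -> sumn (map size l) != (n + r)%N -> Psi l = 0) ->
  on_length n (cuts r Psi).
Proof.
move=> e w wn; transitivity (cuts r (fun=> 0) w); last exact: cuts0.
apply: eq_cuts_size => l ls ln; apply: e => //; rewrite ln.
by rewrite eqn_add2r.
Qed.

Lemma on_length_nil n F : on_length n.+1 F -> F [::] = 0.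
Proof. by apply. Qed.

(** The cup product of homogeneous cochains, up to the sign in [conv_dotE]. *)
Definition dot F G w := cut (fun u v => F u * G v) w.

Lemma ML2_tensor F G : ML F -> ML G -> ML2 (fun u v => F u * G v).
Proof.
move=> FL GL; split=> [v|u]; last exact: ML_mul.
by move=> a b; apply: klin_mulr; exact: FL.
Qed.

Lemma ML_dot F G : ML F -> ML G -> ML (dot F G).
Proof. by move=> FL GL; apply: ML_cut; exact: ML2_tensor. Qed.

Lemma ML_mulr c F : ML F -> ML (fun w => F w * c).
Proof. by move=> FL u v; apply: klin_mulr; exact: FL. Qed.

Lemma on_length_dot p q F G : on_length p.+1 F -> on_length q.+1 G -> on_length (p + q).+1 (dot F G).
Proof.
move=> Fh Gh w wn; rewrite /dot -(cut0 HA w); apply: eq_cut_size => u v _ _ e.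
have [eu|/Fh ->] := eqVneq (size u) p.+1; last by rewrite mul0r.
have [ev|/Gh ->] := eqVneq (size v) q.+1; last by rewrite mulr0.
by move: wn; rewrite -eqSS -e eu ev addSn addnS eqxx.
Qed.

Lemma Hinv_dot F G : ML F -> ML G -> Hinv F -> Hinv G -> Hinv (dot F G).
Proof.
move=> FL GL Fi Gi; apply: Hinv_cut; first exact: ML2_tensor.
move=> h u v; rewrite /act2.
transitivity (sw h (fun a b => eps a * (F u * (eps b * G v)))).
  apply: eq_sw => a b; rewrite mulrA -Fi -Gi -(lfun_mulr (lfun_act HA a u)).
  by apply: eq_act => u'; rewrite act_mulc.
rewrite (swk_counitl HA h (f := fun b => F u * (eps b * G v))); first by ring.
by apply: klin_mul; apply: klin_mulr; exact: eps_klin.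
Qed.

Lemma dd_dot p F G w : ML F -> ML G -> on_length p.+1 F -> G [::] = 0 ->
  dd (dot F G) w = - dot (dd F) G w + (-1) ^+ p * dot F (dd G) w.
Proof.
move=> FL GL Fh G0; rewrite dd_cut; last exact: ML2_tensor.
rewrite (on_length_nil Fh) G0 mul0r mulr0 subr0 sub0r; congr (_ + _).
  by congr (- _); apply: eq_cut => u v; rewrite dd_mulcr.
rewrite -cut_opp -cut_mulc; apply: eq_cut => u v.
have [->|/Fh Fu] := eqVneq (size u) p.+1; first by rewrite dd_mulc exprS; ring.
by rewrite dd_mulc Fu; ring.
Qed.

(** The operator B on homogeneous cochains; the operator [bop] on cochains is its
opposite. *)
Definition BD F w := cut (fun v u => (-1) ^+ (size u * size v) * turn F v u) w.

Lemma ML_sign_mul (f : nat -> nat) F : ML F -> ML (fun u => (-1) ^+ f (size u) * F u).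
Proof. exact: (ML_size (fun n => (-1) ^+ f n)). Qed.

Lemma ML_cut_param (P : word -> word -> word -> k) r :
  (forall g v, ML (fun u => P u g v)) -> ML (fun u => cut (P u) r).
Proof. by move=> PL a b; apply: klin_cut => g v; exact: PL. Qed.

Lemma ML2_signed_turn F : ML F ->
  ML2 (fun v u => (-1) ^+ (size u * size v) * turn F v u).
Proof.
move=> /(ML_turn sigma) [T1 T2]; split=> [u|v].
  exact: (ML_sign_mul (fun n => size u * n)%N).
exact: (ML_sign_mul (fun n => n * size v)%N).
Qed.

Lemma ML_BD F : ML F -> ML (BD F).
Proof. by move=> FL; apply: ML_cut; exact: ML2_signed_turn. Qed.

Lemma on_length_BD n F : on_length n.+1 F -> on_length n (BD F).
Proof.
move=> Fh w wn; rewrite /BD -(cut0 HA w); apply: eq_cut_size => u v _ _ e.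
rewrite /turn Fh ?mulr0 // size_cat size_sh addnC.
by rewrite e eqSS.
Qed.

Lemma BD_deg0 F w : on_length 1 F -> BD F w = 0.
Proof.
move=> Fh; rewrite /BD -(cut0 HA w); apply: eq_cut_size => u v u0 v0 e.
rewrite /turn Fh ?mulr0 // size_cat size_sh.
by case: (size u) (size v) u0 v0 => [|m] [|n] //; rewrite addSn addnS.
Qed.

Lemma Hinv_BD F : ML F -> Hinv F -> Hinv (BD F).
Proof.
move=> FL Fi; apply: Hinv_cut; first exact: ML2_signed_turn.
move=> h v u; rewrite mulrCA.
rewrite -(Hinv2_turn sigma_grouplike sigma_invl twisted_involution FL Fi).
rewrite /act2 -sw_mulrl; apply: eq_sw => a b; rewrite -act_mulc.
apply: eq_act_size => v' ev; rewrite -act_mulc.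
by apply: eq_act_size => u' eu; rewrite ev eu.
Qed.

Lemma dd_BD F w : ML F -> Hinv F -> dd (BD F) w = - BD (dd F) w.
Proof.
move=> FL Fi; rewrite dd_cut; last exact: ML2_signed_turn.
rewrite /turn cats0 /= muln0 mul0n (Hinv_sh sigma_grouplike) // subrr sub0r.
rewrite -opprD; congr (- _); rewrite -cut_add; apply: eq_cut => v u.
rewrite /turn dd_cat -(dd_sh sigma_grouplike (fun v => F (u ++ v))).
rewrite (@dd_sign _ _ HA (fun n => size u * n)%N (fun v => F (u ++ sh v))); last first.
  by move=> n; parity.
rewrite (@dd_sign _ _ HA (fun n => n * size v)%N (fun u => F (u ++ sh v))); last first.
  by move=> n; parity.
by parity; ring.
Qed.

(** The insertion of G into F: G is evaluated on the middle one of three pieces, and F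
on the outer two, joined together. *)
Definition Br F G := cuts 2 (signed (fun s => nth 0 s 0 * nth 0 s 1)%N
  (pat3 (fun u g v => F (u ++ v) * G g))).

Lemma ML3_Br F G : ML F -> ML G -> ML3 (fun u g v => F (u ++ v) * G g).
Proof.
move=> FL GL; split=> [g v|u v|u g].
- by apply: ML_mulr; exact: ML_catr.
- exact: ML_mul.
by apply: ML_mulr; exact: ML_catl.
Qed.

Lemma ML_Br F G : ML F -> ML G -> ML (Br F G).
Proof.
by move=> FL GL; apply: ML_cuts; apply: MLs_signed; apply: MLs_pat3; exact: ML3_Br.
Qed.

(** On closed functionals the insertion is a homotopy for graded commutativity. *)
Lemma dd_Br p q F G w : ML F -> ML G -> on_length p.+1 F -> on_length q.+1 G ->
  (forall v, dd F v = 0) -> (forall v, dd G v = 0) ->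
  dd (Br F G) w = dot G F w + (-1) ^+ (p.+1 * q.+1) * dot F G w.
Proof.
move=> FL GL Fh Gh F0 G0; rewrite dd_cuts; last first.
  by apply: MLs_signed; apply: MLs_pat3; exact: ML3_Br.
(* The functionals are closed, so that only the degenerate cuts remain. *)
rewrite (@eq_cuts _ _ _ _ _ (fun=> 0)); last first.
  case=> [|u [|g [|v [|? ?]]]] //= _; rewrite /signed /=.
  rewrite (@dd_sign _ _ HA (fun n => n * size g)%N (fun u => F (u ++ v) * G g)); last first.
    by move=> n; parity.
  rewrite (@dd_sign _ _ HA (fun n => size u * n)%N (fun g => F (u ++ v) * G g)); last first.
    by move=> n; parity.
  rewrite dd_mulc dd_mulcr dd_mulc dd_mulcr G0.
  have := F0 (u ++ v); rewrite dd_cat => /eqP; rewrite addr_eq0 => /eqP ->.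
  by parity; ring.
rewrite cuts0 mulr0 add0r !big_ord_recl big_ord0 addr0 !cuts1E /put_nil /signed /=.
rewrite expr0 mul1r; congr (_ + _).
  by apply: eq_cut => u v; ring.
rewrite [X in _ * X + _](_ : _ = 0) ?mulr0 ?add0r; last first.
  by rewrite -(cut0 HA w); apply: eq_cut => u v; rewrite (on_length_nil Gh) !mulr0.
rewrite /bump /= -cut_mulc -cut_mulc; apply: eq_cut => u v.
rewrite cats0 expr2; have [->|/Fh ->] := eqVneq (size u) p.+1; last by ring.
have [->|/Gh ->] := eqVneq (size v) q.+1; last by ring.
ring.
Qed.

Lemma acts_pat2 h P u v : ML2 P -> Hinv2 HA P ->
  acts h (pat2 P) [:: u; v] = eps h * P u v.
Proof.
move=> PL Pi; rewrite -Pi /=; apply: eq_sw => a b; apply: eq_act => u'.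
have := @acts_single _ _ HA (pat1 (P u')) b v; rewrite /= => -> //.
by apply: MLs_pat1; exact: PL.2.
Qed.

Lemma ML2_cat F : ML F -> ML2 (fun u v => F (u ++ v)).
Proof. by move=> FL; split=> [v|u]; [exact: ML_catr|exact: ML_catl]. Qed.

Lemma Hinv2_cat F : ML F -> Hinv F -> Hinv2 HA (fun u v => F (u ++ v)).
Proof. by move=> FL Fi h u v; rewrite /act2 -act_cat. Qed.

Lemma Hinv_Br F G : ML F -> ML G -> Hinv F -> Hinv G -> Hinv (Br F G).
Proof.
move=> FL GL Fi Gi; apply: Hinv_cuts.
  by apply: MLs_signed; apply: MLs_pat3; exact: ML3_Br.
apply: Hinvs_signed => h [|u [|g [|v [|? ?]]]] // _.
have ML2F := ML2_cat FL.
rewrite (@acts_skip2 _ _ HA _ (pat2 (fun u v => F (u ++ v))) G) //.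
- rewrite acts_pat2 //; [|exact: Hinv2_cat].
  by rewrite /=; ring.
- exact: MLs_pat2.
by move=> u' g' [|v' [|? ?]] //= _; ring.
Qed.

Lemma on_length_Br p q F G : on_length p.+1 F -> on_length q.+1 G -> on_length (p + q) (Br F G).
Proof.
move=> Fh Gh; apply: on_length_cuts => -[|u [|g [|v [|? ?]]]] //= _ ne.
rewrite /signed /=.
have [ev|/Gh ->] := eqVneq (size g) q.+1; last by rewrite !mulr0.
rewrite Fh ?mul0r ?mulr0 // size_cat; move: ne; rewrite ev; lia.
Qed.

(** * The inserted cochain cut out of a turned word *)

(** The insertion of G into F, with the pieces of F turned by [sigma]. *)
Definition Zp F G := cuts 2 (signed (fun s => (nth 0 s 1 + nth 0 s 2) * nth 0 s 0)%N
  (pat3 (fun v g u => turn F v u * G g))).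

(** The homotopy between the insertion [Br], the turned insertion [Zp] and the product
of G with B of F. *)
Definition Kp F G := cuts 3 (signed (fun s => nth 0 s 3 *
    (nth 0 s 0 + nth 0 s 1 + nth 0 s 2) + nth 0 s 2 * nth 0 s 1)%N
  (pat4 (fun v g w u => F (u ++ sh v ++ sh w) * G g))).

Lemma MLs_Kp F G : ML F -> ML G -> MLs (pat4 (fun v g w u => F (u ++ sh v ++ sh w) * G g)).
Proof.
move=> FL GL; apply: MLs_pat4; split=> [g w u|v w u|v g u|v g w].
- apply: ML_mulr; apply: (ML_sh sigma (F := fun v => F (u ++ v ++ sh w))).
  by apply: (ML_catr _ (F := fun v => F (u ++ v))); exact: ML_catl.
- exact: ML_mul.
- apply: ML_mulr; apply: (ML_sh sigma (F := fun w => F (u ++ sh v ++ w))).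
  by apply: (ML_catl _ (F := fun w => F (u ++ w))); exact: ML_catl.
by apply: ML_mulr; exact: ML_catr.
Qed.

Lemma ML_Kp F G : ML F -> ML G -> ML (Kp F G).
Proof. by move=> FL GL; apply: ML_cuts; apply: MLs_signed; exact: MLs_Kp. Qed.

Lemma Hinv_Kp F G : ML F -> ML G -> Hinv F -> Hinv G -> Hinv (Kp F G).
Proof.
move=> FL GL Fi Gi; apply: Hinv_cuts.
  by apply: MLs_signed; exact: MLs_Kp.
apply: Hinvs_signed => h [|v [|g [|w [|u [|? ?]]]]] // _.
rewrite (@acts_skip2 _ _ HA _ (pat3 (fun v w u => F (u ++ sh v ++ sh w))) G) //.
- rewrite (@acts_merge _ _ HA _ (pat2 (turn F))).
  + rewrite acts_pat2; [|exact: ML_turn|exact: (Hinv2_turn sigma_grouplike sigma_invl twisted_involution FL Fi)].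
    by rewrite /= /turn sh_cat; ring.
  + by apply: MLs_pat2; exact: ML_turn.
  by move=> v' w' [|u' [|? ?]] //= _; rewrite /turn sh_cat.
- apply: MLs_pat3; split=> [w' u'|v' u'|v' w'].
  + apply: (ML_sh sigma (F := fun v => F (u' ++ v ++ sh w'))).
    by apply: (ML_catr _ (F := fun v => F (u' ++ v))); exact: ML_catl.
  + apply: (ML_sh sigma (F := fun w => F (u' ++ sh v' ++ w))).
    by apply: (ML_catl _ (F := fun w => F (u' ++ w))); exact: ML_catl.
  exact: ML_catr.
by move=> v' g' [|w' [|u' [|? ?]]] //= _; ring.
Qed.

Lemma dd_Kp p q F G w : ML F -> ML G -> Hinv F -> on_length p.+1 F -> on_length q.+1 G ->
  (forall v, dd F v = 0) -> (forall v, dd G v = 0) ->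
  dd (Kp F G) w = (-1) ^+ (p.+1 * q.+1 + q.+1) * dot G (BD F) w
    + (-1) ^+ (p.+1 * q.+1) * (Zp F G w - Br F G w).
Proof.
move=> FL GL Fi Fh Gh F0 G0; rewrite dd_cuts; last first.
  by apply: MLs_signed; exact: MLs_Kp.
(* The functionals are closed, so that only the degenerate cuts remain. *)
rewrite (@eq_cuts _ _ _ _ _ (fun=> 0)); last first.
  case=> [|v [|g [|w' [|u [|? ?]]]]] //= _; rewrite /signed /=.
  rewrite (@dd_sign _ _ HA (fun n => size u * (n + size g + size w') + size w' * size g)%N);
    last by move=> n; parity.
  rewrite (@dd_sign _ _ HA (fun n => size u * (size v + n + size w') + size w' * n)%N);
    last by move=> n; parity.
  rewrite (@dd_sign _ _ HA (fun n => size u * (size v + size g + n) + n * size g)%N);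
    last by move=> n; parity.
  rewrite (@dd_sign _ _ HA (fun n => n * (size v + size g + size w') + size w' * size g)%N);
    last by move=> n; parity.
  rewrite dd_mulc G0 !dd_mulcr.
  have := F0 (u ++ sh v ++ sh w'); rewrite !dd_cat.
  rewrite -(dd_sh sigma_grouplike (fun v => F (u ++ v ++ sh w'))).
  rewrite -(dd_sh sigma_grouplike (fun w => F (u ++ sh v ++ w))) size_sh.
  by move/eqP; rewrite addr_eq0 => /eqP ->; parity; ring.
rewrite cuts0 mulr0 add0r !big_ord_recl big_ord0 addr0 /Zp /Br !cuts2E /put_nil /signed /=.
rewrite /bump /= expr0 mul1r expr1 (exprS _ 2) sqrrN expr1n mulr1 mul1r !mulN1r.
have -> : cut (fun u r => (-1) ^+ size u * cut (fun g v =>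
   (-1) ^+ (size v * (0 + size u + size g) + size g * size u) *
     (F (v ++ sh g) * G u)) r) w = (-1) ^+ (p.+1 * q.+1 + q.+1) * dot G (BD F) w.
  rewrite /dot -cut_mulc; apply: eq_cut => g r; rewrite /BD -!cut_mulc.
  apply: eq_cut => w' u; rewrite /turn.
  have [->|/Gh ->] := eqVneq (size g) q.+1; last by ring.
  have [e|ne] := eqVneq (size u + size w')%N p.+1; last first.
    by rewrite Fh ?size_cat ?size_sh //; ring.
  by_parity e.
have -> : cut (fun u r => (-1) ^+ size u * cut (fun g v =>
   (-1) ^+ (size v * (size u + 0 + size g) + size g * 0) *
     (F (v ++ sh u ++ sh g) * G [::])) r) w = 0.
  rewrite -(cut0 HA w); apply: eq_cut => u r; rewrite -(mulr0 ((-1) ^+ size u)).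
  congr (_ * _); rewrite -(cut0 HA r); apply: eq_cut => g v.
  by rewrite (on_length_nil Gh) !mulr0.
rewrite oppr0 add0r; congr (_ + _); rewrite mulrBr; congr (_ + _).
  rewrite -!cut_mulc; apply: eq_cut => v r; rewrite -!cut_mulc; apply: eq_cut => g u.
  rewrite cats0 /turn.
  have [->|/Gh ->] := eqVneq (size g) q.+1; last by ring.
  have [e|ne] := eqVneq (size u + size v)%N p.+1; last first.
    by rewrite Fh ?size_cat ?size_sh //; ring.
  by_parity e.
congr (- _); rewrite -!cut_mulc; apply: eq_cut => v r.
rewrite -!cut_mulc; apply: eq_cut => g u.
rewrite -sh_cat (Hinv_sh sigma_grouplike) //.
have [->|/Gh ->] := eqVneq (size g) q.+1; last by ring.
have [e|ne] := eqVneq (size u + size v)%N p.+1; last first.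
  by rewrite Fh ?size_cat addnC //; ring.
by_parity e.
Qed.
End Operations.

(** * B of a product *)

Section SquareOfBD.
Variables (k : comNzRingType) (H : algType k) (HA : hopf_algebra H).
Variables (sigma sigma_inv : H).
Hypothesis sigma_grouplike : grouplike HA sigma.
Hypothesis sigma_invl : sigma_inv * sigma = 1.
Hypothesis twisted_involution :
  forall h : H, hS HA (hS HA h) = sigma * h * sigma_inv.
Local Notation word := (seq H).
Local Notation acts := (acts HA).
Local Notation dd := (dd HA).
Local Notation cut := (cut HA).
Local Notation cuts := (cuts HA).
Local Notation Hinv := (Hinv HA).
Implicit Types (F G X : word -> k) (u v w : word) (P : word -> word -> k).
Implicit Types (Psi : seq word -> k) (l : seq word).

Local Notation sh := (sh sigma).
Local Notation turn := (turn sigma).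
Local Notation dot := (dot HA).
Local Notation BD := (BD HA sigma).
Local Notation Zp := (Zp HA sigma).

(** B of a product is a graded commutator of turned insertions. *)
Lemma BD_dot p q F G w : ML F -> ML G -> Hinv G -> on_length p.+1 F -> on_length q.+1 G ->
  BD (dot F G) w = Zp G F w - (-1) ^+ (p.+1 * q.+1) * Zp F G w.
Proof.
move=> FL GL Gi Fh Gh; rewrite /BD.
have ML2FG : ML2 (fun u v => F u * G v) by exact: ML2_tensor.
transitivity (cut (fun v u => (-1) ^+ (size u * size v) *
    cut (fun a b => F a * G (b ++ sh v)) u) w +
  cut (fun v u => cut (fun a b => (-1) ^+ (size u * (size a + size b)) *
    (turn F a u * G b)) v) w).
  rewrite -cut_add; apply: eq_cut => v u; rewrite /turn /dot cut_cat.
  rewrite (cut_sh sigma_grouplike); last first.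
    split=> [b|a]; last exact: ML_mul.
    by apply: (ML_mulr (G b) (F := fun a => F (u ++ a))); exact: ML_catl.
  rewrite mulrDr; congr (_ + _).
  rewrite -!cut_mulc; apply: eq_cut_size => a b _ _ e.
  rewrite (Hinv_sh sigma_grouplike _ GL Gi).
  by_parity e.
congr (_ + _).
  rewrite /Zp cuts2E; apply: eq_cut => v u.
  rewrite -!cut_mulc; apply: eq_cut_size => a b _ _ e; rewrite /signed /= /turn.
  by_parity e.
rewrite cut_coassoc; last first.
  split=> [b u|a u|a b].
  - apply: (ML_sign_mul (fun n => size u * (n + size b))%N).
    apply: ML_mulr; apply: (ML_sh sigma (F := fun v => F (u ++ v))); exact: ML_catl.
  - apply: (ML_sign_mul (fun n => size u * (size a + n))%N); exact: ML_mul.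
  apply: (ML_sign_mul (fun n => n * (size a + size b))%N).
  by apply: ML_mulr; exact: ML_catr.
congr (- _); rewrite /Zp cuts2E -cut_mulc; apply: eq_cut => a r.
rewrite -!cut_mulc; apply: eq_cut => b u; rewrite /signed /= /turn.
have [->|/Gh ->] := eqVneq (size b) q.+1; last by ring.
have [e|ne] := eqVneq (size u + size a)%N p.+1; last first.
  by rewrite Fh ?size_cat ?size_sh //; ring.
by_parity e.
Qed.

(** * The square of BD *)

(** Cuts of a word into three pieces without turning. The operators [rotl] and [rotr]
turn one or two of three pieces; their difference is the square of [BD], and both are
homotopic to [pat_id] on closed invariant functionals, by [rotl4] and [rotr4]. *)
Definition pat_id F := cuts 2 (pat3 (fun u v w => F (u ++ v ++ w))).
Definition rotl F := cuts 2 (signed (fun s => nth 0 s 0 * (nth 0 s 1 + nth 0 s 2))%N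
  (pat3 (fun a b u => F (b ++ u ++ sh a)))).
Definition rotr F := cuts 2 (signed (fun s => nth 0 s 2 * (nth 0 s 0 + nth 0 s 1))%N
  (pat3 (fun v a b => F (b ++ sh v ++ sh a)))).
Definition rotl4 F := cuts 3 (signed (fun s => nth 0 s 0 * (nth 0 s 1 + nth 0 s 2 + nth 0 s 3))%N
  (pat4 (fun z u v w => F (u ++ v ++ w ++ sh z)))).
Definition rotr4 F := cuts 3 (signed (fun s => nth 0 s 3 * (nth 0 s 0 + nth 0 s 1 + nth 0 s 2))%N
  (pat4 (fun v w z u => F (u ++ sh v ++ sh w ++ sh z)))).

Lemma BD_BD F w : ML F -> Hinv F -> BD (BD F) w = rotr F w - rotl F w.
Proof.
move=> FL Fi.
have T2 := ML2_signed_turn sigma FL.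
transitivity (cut (fun v u => (-1) ^+ (size u * size v) *
    cut (fun a b => (-1) ^+ (size a * (size b + size v)) * F (b ++ sh v ++ sh a)) u) w +
  cut (fun v u => cut (fun a b => (-1) ^+ (size a * (size u + size b)) *
     F (b ++ u ++ sh a)) v) w).
  rewrite {1}/BD -cut_add; apply: eq_cut => v u; rewrite /turn /BD cut_cat.
  rewrite (cut_sh sigma_grouplike); last first.
    by split=> [b|a]; [exact: (ML_catl u (T2.1 b))|exact: T2.2].
  rewrite mulrDr; congr (_ + _).
    congr (_ * _); apply: eq_cut => a b; rewrite /turn size_cat size_sh mulnC.
    by rewrite catA.
  rewrite -!cut_mulc; apply: eq_cut_size => a b _ _ e.
  rewrite /turn !size_cat !size_sh -!sh_cat (Hinv_sh sigma_grouplike) // mulrA.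
  by_parity e.
congr (_ + _).
  rewrite /rotr cuts2E; apply: eq_cut => v u.
  rewrite -!cut_mulc; apply: eq_cut_size => a b _ _ e; rewrite /signed /=.
  by_parity e.
rewrite cut_coassoc; last first.
  split=> [b u|a u|a b].
  - apply: (ML_sign_mul (fun n => n * (size u + size b))%N).
    apply: (ML_sh sigma (F := fun a => F (b ++ u ++ a))).
    by apply: (ML_catl u (F := fun a => F (b ++ a))); exact: ML_catl.
  - by apply: (ML_sign_mul (fun n => size a * (size u + n))%N); exact: ML_catr.
  apply: (ML_sign_mul (fun n => size a * (n + size b))%N).
  by apply: (ML_catr (sh a) (F := fun u => F (b ++ u))); exact: ML_catl.
congr (- _); rewrite /rotl cuts2E; apply: eq_cut => a r.
by congr (_ * _); apply: eq_cut => b u; rewrite /signed /= addnC.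
Qed.

Lemma MLs_rotl4 F : ML F -> MLs (pat4 (fun z u v w => F (u ++ v ++ w ++ sh z))).
Proof.
move=> FL; apply: MLs_pat4; split=> [u v w|z v w|z u w|z u v].
- apply: (ML_sh sigma (F := fun z => F (u ++ v ++ w ++ z))).
  apply: (ML_catl w (F := fun z => F (u ++ v ++ z))).
  by apply: (ML_catl v (F := fun z => F (u ++ z))); exact: ML_catl.
- exact: ML_catr.
- by apply: (ML_catr _ (F := fun z => F (u ++ z))); exact: ML_catl.
apply: (ML_catr _ (F := fun z => F (u ++ v ++ z))).
by apply: (ML_catl v (F := fun z => F (u ++ z))); exact: ML_catl.
Qed.

Lemma MLs_rotr4 F : ML F -> MLs (pat4 (fun v w z u => F (u ++ sh v ++ sh w ++ sh z))).
Proof.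
move=> FL; apply: MLs_pat4; split=> [w z u|v z u|v w u|v w z].
- apply: (ML_sh sigma (F := fun v => F (u ++ v ++ sh w ++ sh z))).
  by apply: (ML_catr _ (F := fun v => F (u ++ v))); exact: ML_catl.
- apply: (ML_sh sigma (F := fun w => F (u ++ sh v ++ w ++ sh z))).
  apply: (ML_catr _ (F := fun w => F (u ++ sh v ++ w))).
  by apply: (ML_catl _ (F := fun z => F (u ++ z))); exact: ML_catl.
- apply: (ML_sh sigma (F := fun z => F (u ++ sh v ++ sh w ++ z))).
  apply: (ML_catl _ (F := fun z => F (u ++ sh v ++ z))).
  by apply: (ML_catl _ (F := fun z => F (u ++ z))); exact: ML_catl.
exact: ML_catr.
Qed.

Lemma dd_closed_cat3 F u v w : (forall v, dd F v = 0) ->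
  dd (fun u => F (u ++ v ++ w)) u + (-1) ^+ size u * (dd (fun v => F (u ++ v ++ w)) v
     + (-1) ^+ size v * dd (fun w => F (u ++ v ++ w)) w) = 0.
Proof. by move=> F0; rewrite -(F0 (u ++ v ++ w)) dd_cat dd_cat. Qed.

Lemma dd_closed_cat4 F u v w z : (forall v, dd F v = 0) ->
  dd (fun u => F (u ++ v ++ w ++ z)) u = - ((-1) ^+ size u *
    (dd (fun v => F (u ++ v ++ w ++ z)) v
     + (-1) ^+ size v * (dd (fun w => F (u ++ v ++ w ++ z)) w
     + (-1) ^+ size w * dd (fun z => F (u ++ v ++ w ++ z)) z))).
Proof.
move=> F0; apply/eqP; rewrite -addr_eq0 -(F0 (u ++ v ++ w ++ z)).
by rewrite dd_cat dd_cat dd_cat.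
Qed.

Lemma dd_shE (F : word -> k) w : dd F (sh w) = dd (fun v => F (sh v)) w.
Proof. by rewrite dd_sh. Qed.

Lemma dd_rotl4 F w : ML F -> (forall v, dd F v = 0) ->
  dd (rotl4 F) w = pat_id F w - rotl F w.
Proof.
move=> FL F0; rewrite dd_cuts; last by apply: MLs_signed; exact: MLs_rotl4.
(* The functionals are closed, so that only the degenerate cuts remain. *)
rewrite (@eq_cuts _ _ _ _ _ (fun=> 0)); last first.
  case=> [|z [|u [|v [|x [|? ?]]]]] //= _; rewrite /signed /=.
  rewrite (@dd_sign _ _ HA (fun n => n * (size u + size v + size x))%N);
    last by move=> n; parity.
  rewrite (@dd_sign _ _ HA (fun n => size z * (n + size v + size x))%N);
    last by move=> n; parity.
  rewrite (@dd_sign _ _ HA (fun n => size z * (size u + n + size x))%N);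
    last by move=> n; parity.
  rewrite (@dd_sign _ _ HA (fun n => size z * (size u + size v + n))%N);
    last by move=> n; parity.
  rewrite (dd_closed_cat4 u v x (sh z) F0) (dd_shE (fun z => F (u ++ v ++ x ++ z))).
  by parity; ring.
rewrite cuts0 mulr0 add0r !big_ord_recl big_ord0 addr0.
rewrite /rotl /pat_id !cuts2E /put_nil /signed /=.
rewrite /bump /= expr0 mul1r expr1 (exprS _ 2) sqrrN expr1n mulr1 mul1r !mulN1r.
have e4 (a b c d e f : k) : a = e -> b = f -> c = f -> d = f ->
    a + (- b + (c - d)) = e - f by move=> -> -> -> ->; ring.
by apply: e4; apply: eq_cut => z r; congr (_ * _); apply: eq_cut => v x;
  rewrite ?cats0; parity; ring.
Qed.

Lemma dd_rotr4 F w : ML F -> Hinv F -> (forall v, dd F v = 0) ->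
  dd (rotr4 F) w = rotr F w - pat_id F w.
Proof.
move=> FL Fi F0; rewrite dd_cuts; last by apply: MLs_signed; exact: MLs_rotr4.
(* The functionals are closed, so that only the degenerate cuts remain. *)
rewrite (@eq_cuts _ _ _ _ _ (fun=> 0)); last first.
  case=> [|v [|x [|z [|u [|? ?]]]]] //= _; rewrite /signed /=.
  rewrite (@dd_sign _ _ HA (fun n => size u * (n + size x + size z))%N);
    last by move=> n; parity.
  rewrite (@dd_sign _ _ HA (fun n => size u * (size v + n + size z))%N);
    last by move=> n; parity.
  rewrite (@dd_sign _ _ HA (fun n => size u * (size v + size x + n))%N);
    last by move=> n; parity.
  rewrite (@dd_sign _ _ HA (fun n => n * (size v + size x + size z))%N);
    last by move=> n; parity.
  rewrite (dd_closed_cat4 u (sh v) (sh x) (sh z) F0).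
  rewrite (dd_shE (fun z => F (u ++ sh v ++ sh x ++ z))).
  rewrite (dd_shE (fun z => F (u ++ sh v ++ z ++ sh _))).
  rewrite (dd_shE (fun z => F (u ++ z ++ sh _ ++ sh _))) !size_sh.
  by parity; ring.
rewrite cuts0 mulr0 add0r !big_ord_recl big_ord0 addr0.
rewrite /rotr /pat_id !cuts2E /put_nil /signed /=.
rewrite /bump /= expr0 mul1r expr1 (exprS _ 2) sqrrN expr1n mulr1 mul1r !mulN1r.
have e4 (a b c d e f : k) : a = e -> b = e -> c = e -> d = f ->
    a + (- b + (c - d)) = e - f by move=> -> -> -> ->; ring.
apply: e4; apply: eq_cut => z r; congr (_ * _); apply: eq_cut => v x.
- by rewrite ?cats0; parity; ring.
- by rewrite ?cats0; parity; ring.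
by rewrite -!sh_cat (Hinv_sh sigma_grouplike) //; parity; ring.
Qed.

(** The homotopy from the square of [BD] to zero. *)
Definition BB F w := rotl4 F w + rotr4 F w.

Lemma dd_BB F w : ML F -> Hinv F -> (forall v, dd F v = 0) ->
  dd (BB F) w = BD (BD F) w.
Proof.
by move=> FL Fi F0; rewrite dd_add dd_rotl4 // dd_rotr4 // BD_BD //; ring.
Qed.

Lemma ML_BB F : ML F -> ML (BB F).
Proof.
by move=> FL; apply: ML_add; apply: ML_cuts; apply: MLs_signed;
  [exact: MLs_rotl4|exact: MLs_rotr4].
Qed.

Lemma Hinv_add F G : Hinv F -> Hinv G -> Hinv (fun w => F w + G w).
Proof.
by move=> Fi Gi h w; rewrite (lfun_add (lfun_act HA h w)) Fi Gi mulrDr.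
Qed.

Lemma Hinv_BB F : ML F -> Hinv F -> Hinv (BB F).
Proof.
move=> FL Fi.
have ML2F := ML_turn sigma FL.
have turn_inv := Hinv2_turn sigma_grouplike sigma_invl twisted_involution FL Fi.
apply: Hinv_add; apply: Hinv_cuts.
- by apply: MLs_signed; exact: MLs_rotl4.
- apply: Hinvs_signed => h [|z [|u [|v [|w [|? ?]]]]] // _.
  rewrite [pat4 _ _](_ : _ = turn F z (u ++ v ++ w)); last first.
    by rewrite /= /turn -!catA.
  rewrite -turn_inv; apply: eq_sw => a b; apply: eq_act => z'.
  have FLz : ML (fun u => F (u ++ sh z')) by exact: ML_catr.
  transitivity (acts b (pat3 (fun u v w => F ((u ++ v) ++ w ++ sh z'))) [:: u; v; w]).
    apply: (@eq_acts _ _ HA b (fun l =>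
        pat4 (fun z u v w => F (u ++ v ++ w ++ sh z)) (z' :: l)) _ [:: u; v; w]).
    by case=> [|u' [|v' [|w' [|? ?]]]] //= _; rewrite !catA.
  rewrite (@acts_merge _ _ HA _ (pat2 (fun u w => F (u ++ w ++ sh z')))).
  + rewrite (@acts_merge _ _ HA _ (pat1 (fun u => F (u ++ sh z')))).
    * by rewrite acts_single ?catA //; exact: MLs_pat1.
    * exact: MLs_pat1.
    by move=> u' w' [|? ?] //= _; rewrite catA.
  + apply: MLs_pat2; split=> [w'|u']; first by exact: ML_catr.
    by apply: (ML_catr (sh z') (F := fun w => F (u' ++ w))); exact: ML_catl.
  by move=> u' v' [|w' [|? ?]].
- by apply: MLs_signed; exact: MLs_rotr4.
apply: Hinvs_signed => h [|v [|w [|z [|u [|? ?]]]]] // _.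
have ML3F : ML3 (fun vw z u => F (u ++ sh vw ++ sh z)).
  split=> [z' u'|x' u'|x' z'].
  - apply: (ML_sh sigma (F := fun v => F (u' ++ v ++ sh z'))).
    by apply: (ML_catr _ (F := fun v => F (u' ++ v))); exact: ML_catl.
  - apply: (ML_sh sigma (F := fun w => F (u' ++ sh x' ++ w))).
    by apply: (ML_catl _ (F := fun z => F (u' ++ z))); exact: ML_catl.
  exact: ML_catr.
rewrite (@acts_merge _ _ HA _ (pat3 (fun vw z u => F (u ++ sh vw ++ sh z)))).
- rewrite (@acts_merge _ _ HA _ (pat2 (turn F))).
  + rewrite acts_pat2 //.
    by rewrite /= /turn !sh_cat -!catA.
  + exact: MLs_pat2.
  by move=> v' w' [|u' [|? ?]] //= _; rewrite /turn sh_cat.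
- exact: MLs_pat3.
by move=> v' w' [|z' [|u' [|? ?]]] //= _; rewrite sh_cat -catA.
Qed.

End SquareOfBD.

(** * Insertion into a product and insertion of a product *)

Section InsertionInProduct.
Variables (k : comNzRingType) (H : algType k) (HA : hopf_algebra H).
Local Notation word := (seq H).
Local Notation dd := (dd HA).
Local Notation cut := (cut HA).
Local Notation cuts := (cuts HA).
Local Notation Hinv := (Hinv HA).
Implicit Types (F G X : word -> k) (u v w : word) (P : word -> word -> k).
Implicit Types (Psi : seq word -> k) (l : seq word).

Local Notation dot := (dot HA).
Local Notation Br := (Br HA).

Lemma cut_exchange (P : word -> word -> word -> word -> k) u r :
  cut (fun f v => cut (P f v) u) r = cut (fun a b => cut (fun f v => P f v a b) r) u.
Proof.
exact: (lfun_cut HA (fun p => P p.1 p.2) u (lfun_cut_uncurried HA r)).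
Qed.

Lemma dot_Br F G X w : ML F -> ML G -> ML X ->
  dot (Br F G) X w = cut (fun u r => cut (fun g s => (-1) ^+ size g *
     cut (fun v x => (-1) ^+ (size u * size g) * (F (u ++ v) * G g) * X x) s) r) w.
Proof.
move=> FL GL XL; rewrite /dot.
pose T1 u r x := (-1) ^+ size u *
   cut (fun g v => (-1) ^+ (size u * size g) * (F (u ++ v) * G g)) r * X x.
have ML2T u : ML2 (fun g v => (-1) ^+ (size u * size g) * (F (u ++ v) * G g)).
  split=> [v|g].
    by apply: (ML_sign_mul (fun n => size u * n)%N); exact: ML_mul.
  by apply: ML_mul; apply: ML_mulr; exact: ML_catl.
transitivity (cut (fun m x => cut (fun u r => T1 u r x) m) w).
  by apply: eq_cut => m x; rewrite /Br cuts2E cut_mulcr.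
rewrite cut_coassoc; last first.
  split=> [r x|u x|u r]; rewrite /T1.
  - apply: ML_mulr; apply: (ML_sign_mul id); apply: ML_cut_param => g v.
    by apply: (ML_sign_mul (fun n => n * size g)%N); apply: ML_mulr; exact: ML_catr.
  - by apply: ML_mulr; apply: ML_mul; exact: ML_cut.
  exact: ML_mul.
rewrite -cut_opp; apply: eq_cut => u r.
transitivity (- cut (fun m x => cut (fun g v =>
   (-1) ^+ (size u * size g) * (F (u ++ v) * G g) * X x) m) r).
  congr (- _); rewrite -cut_mulc; apply: eq_cut => m x; rewrite /T1 cut_mulcr.
  by rewrite -mulrA signrMK.
rewrite cut_coassoc ?opprK //.
split=> [v x|g x|g v]; first exact: (ML_mulr _ ((ML2T u).1 v)).
  exact: (ML_mulr _ ((ML2T u).2 g)).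
exact: ML_mul.
Qed.

(** Insertion into a product is insertion into one of the factors, without homotopy. *)
Lemma Br_dot p q F G X w : ML F -> ML G -> ML X ->
  on_length p.+1 F -> on_length q.+1 G ->
  Br (dot G X) F w = (-1) ^+ p.+1 *
    ((-1) ^+ (p.+1 * q.+1) * dot G (Br X F) w + dot (Br G F) X w).
Proof.
move=> FL GL XL Fh Gh; rewrite mulrDr dot_Br // mulrA.
pose Th a b r := (-1) ^+ (size a + size b).+1 * cut (fun f v =>
   (-1) ^+ ((size a + size b).+1 * size f) * (G a * X (b ++ v) * F f)) r.
transitivity (cut (fun u r => cut (fun a b => Th a b r) u) w +
   cut (fun u r => cut (fun f v => cut (fun a b => (-1) ^+ (size u * size f) *
      (G (u ++ a) * X b * F f)) v) r) w).
  rewrite /Br cuts2E -cut_add; apply: eq_cut => u r.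
  transitivity (cut (fun f v => cut (fun a b => (-1) ^+ size u *
       ((-1) ^+ (size u * size f) * (G a * X (b ++ v) * F f))) u) r
     + cut (fun f v => cut (fun a b => (-1) ^+ (size u * size f) *
      (G (u ++ a) * X b * F f)) v) r).
    rewrite -cut_add -cut_mulc; apply: eq_cut => f v; rewrite /signed /=.
    rewrite {1}/dot cut_cat mulrDl mulrDr mulrDr; congr (_ + _).
      by rewrite -cut_mulcr -!cut_mulc.
    rewrite -cut_mulc -cut_mulcr -!cut_mulc; apply: eq_cut => a b.
    by parity; ring.
  congr (_ + _); rewrite cut_exchange; apply: eq_cut_size => a b _ _ e.
  by rewrite /Th e -cut_mulc; apply: eq_cut => f v; parity; ring.
congr (_ + _).
  rewrite cut_coassoc; last first.
    split=> [b r|a r|a b].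
    - apply: (ML_sign_mul (fun n => (n + size b).+1)).
      apply: ML_cut_param => f v.
      apply: (ML_sign_mul (fun n => (n + size b).+1 * size f)%N).
      by apply: ML_mulr; exact: ML_mulr.
    - apply: (ML_sign_mul (fun n => (size a + n).+1)).
      apply: ML_cut_param => f v.
      apply: (ML_sign_mul (fun n => (size a + n).+1 * size f)%N).
      by apply: ML_mulr; apply: ML_mul; exact: ML_catr.
    apply: ML_mul; apply: ML_cut; split=> [v|f].
      by apply: (ML_sign_mul (fun n => (size a + size b).+1 * n)%N); exact: ML_mul.
    by apply: ML_mul; apply: ML_mulr; apply: ML_mul; exact: ML_catl.
  rewrite /dot -cut_opp -cut_mulc; apply: eq_cut => a r.
  rewrite /Br cuts2E -!cut_mulc -cut_opp; apply: eq_cut => b s.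
  rewrite /Th -!cut_mulc -cut_opp; apply: eq_cut => f v; rewrite /signed /=.
  have [->|/Fh ->] := eqVneq (size f) p.+1; last by ring.
  have [->|/Gh ->] := eqVneq (size a) q.+1; last by ring.
  by parity; ring.
rewrite -cut_mulc; apply: eq_cut => u r; rewrite -cut_mulc; apply: eq_cut => f v.
rewrite -!cut_mulc; apply: eq_cut => a b.
have [->|/Fh ->] := eqVneq (size f) p.+1; last by ring.
by parity; ring.
Qed.

(** The simultaneous insertion of G and X into F, the homotopy for the Leibniz rule. *)
Definition Br2 F G X := cuts 4 (signed (fun s => nth 0 s 0 * (nth 0 s 1 + nth 0 s 3)
    + nth 0 s 2 * nth 0 s 3)%N
  (pat5 (fun u g v x w => F (u ++ v ++ w) * (G g * X x)))).

Lemma MLs_Br2 F G X : ML F -> ML G -> ML X ->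
  MLs (pat5 (fun u g v x w => F (u ++ v ++ w) * (G g * X x))).
Proof.
move=> FL GL XL; apply: MLs_pat5; split=> *.
- by apply: ML_mulr; exact: ML_catr.
- by apply: ML_mul; exact: ML_mulr.
- apply: ML_mulr; apply: (ML_catr _ (F := fun v => F (_ ++ v))); exact: ML_catl.
- by apply: ML_mul; exact: ML_mul.
apply: ML_mulr; apply: (ML_catl _ (F := fun v => F (_ ++ v))); exact: ML_catl.
Qed.

Lemma ML_Br2 F G X : ML F -> ML G -> ML X -> ML (Br2 F G X).
Proof. by move=> FL GL XL; apply: ML_cuts; apply: MLs_signed; exact: MLs_Br2. Qed.

Lemma Hinv_Br2 F G X : ML F -> ML G -> ML X -> Hinv F -> Hinv G -> Hinv X ->
  Hinv (Br2 F G X).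
Proof.
move=> FL GL XL Fi Gi Xi; apply: Hinv_cuts.
  by apply: MLs_signed; exact: MLs_Br2.
apply: Hinvs_signed => h [|u [|g [|v [|x [|w [|? ?]]]]]] // _.
have ML2F := ML2_cat FL.
have ML3F : ML3 (fun u x w => F (u ++ w) * X x).
  by split=> *; [apply: ML_mulr; exact: ML_catr|exact: ML_mul|
     apply: ML_mulr; exact: ML_catl].
rewrite (@acts_skip2 _ _ HA _ (pat4 (fun u v x w => F (u ++ v ++ w) * X x)) G) //.
- rewrite (@acts_merge _ _ HA _ (pat3 (fun u x w => F (u ++ w) * X x))).
  + rewrite (@acts_skip2 _ _ HA _ (pat2 (fun u w => F (u ++ w))) X) //.
    * rewrite acts_pat2 //; last exact: Hinv2_cat.
      by rewrite /= -catA; ring.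
    * exact: MLs_pat2.
    by move=> u' g' [|v' [|? ?]] //= _; ring.
  + exact: MLs_pat3.
  by move=> u' v' [|x' [|w' [|? ?]]] //= _; rewrite catA.
- apply: MLs_pat4; split=> *.
  + by apply: ML_mulr; exact: ML_catr.
  + apply: ML_mulr; apply: (ML_catr _ (F := fun v => F (_ ++ v))); exact: ML_catl.
  + exact: ML_mul.
  apply: ML_mulr; apply: (ML_catl _ (F := fun v => F (_ ++ v))); exact: ML_catl.
by move=> u' g' [|v' [|x' [|w' [|? ?]]]] //= _; ring.
Qed.

Lemma dd_Br2 p q r F G X w : ML F -> ML G -> ML X ->
  on_length p.+1 F -> on_length q.+1 G -> on_length r.+1 X ->
  (forall v, dd F v = 0) -> (forall v, dd G v = 0) -> (forall v, dd X v = 0) ->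
  dd (Br2 F G X) w = dot G (Br F X) w - Br F (dot G X) w
    + (-1) ^+ (p.+1 * r.+1) * dot (Br F G) X w.
Proof.
move=> FL GL XL Fh Gh Xh F0 G0 X0; rewrite dd_cuts; last first.
  by apply: MLs_signed; exact: MLs_Br2.
(* The functionals are closed, so that only the degenerate cuts remain. *)
rewrite (@eq_cuts _ _ _ _ _ (fun=> 0)); last first.
  case=> [|u [|g [|v [|x [|y [|? ?]]]]]] //= _; rewrite /signed /=.
  rewrite (@dd_sign _ _ HA (fun n => n * (size g + size x) + size v * size x)%N);
    last by move=> n; parity.
  rewrite (@dd_sign _ _ HA (fun n => size u * (n + size x) + size v * size x)%N);
    last by move=> n; parity.
  rewrite (@dd_sign _ _ HA (fun n => size u * (size g + size x) + n * size x)%N);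
    last by move=> n; parity.
  rewrite (@dd_sign _ _ HA (fun n => size u * (size g + n) + size v * n)%N);
    last by move=> n; parity.
  rewrite !(dd_mulc, dd_mulcr) G0 X0.
  have := dd_closed_cat3 u v y F0.
  by move/eqP; rewrite addr_eq0 => /eqP ->; parity; ring.
rewrite cuts0 mulr0 add0r !big_ord_recl big_ord0 addr0 !cuts3E /put_nil /signed /=.
rewrite /bump /= expr0 mul1r expr1 (exprS _ 2) (exprS _ 3) (exprS _ 2) sqrrN expr1n.
(* The five degenerate cuts; those with an empty piece for G or for X vanish. *)
have e5 (a b c d e f1 f2 f3 : k) : b = 0 -> d = 0 -> a = f1 -> c = - f2 -> e = f3 ->
  a + (-1 * b + (1 * c + ((-1 * 1) * d + (-1 * (-1 * 1)) * e))) = f1 - f2 + f3.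
  by move=> -> -> -> -> ->; ring.
apply: e5.
- rewrite -(cut0 HA w); apply: eq_cut => u s; rewrite -(cut0 HA s).
  apply: eq_cut => g v; rewrite -(mulr0 ((-1) ^+ size g)); congr (_ * _).
  by rewrite -(cut0 HA v); apply: eq_cut => *; rewrite (on_length_nil Gh); ring.
- rewrite -(cut0 HA w); apply: eq_cut => u s; rewrite -(cut0 HA s).
  apply: eq_cut => g v; rewrite -(mulr0 ((-1) ^+ size g)); congr (_ * _).
  by rewrite -(cut0 HA v); apply: eq_cut => *; rewrite (on_length_nil Xh); ring.
- rewrite /dot; apply: eq_cut => g s; rewrite /Br cuts2E -cut_mulc.
  apply: eq_cut => v t; rewrite -!cut_mulc; apply: eq_cut => x y.
  by rewrite /signed /=; parity; ring.
- rewrite {1}/Br cuts2E -cut_opp; apply: eq_cut => u s.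
  pose T g x y := (-1) ^+ (size u * (size g + size x)) * (F (u ++ y) * (G g * X x)).
  transitivity (- cut (fun m y => cut (fun g x => T g x y) m) s).
    rewrite cut_coassoc ?opprK.
      by apply: eq_cut => g t; congr (_ * _); apply: eq_cut => x y; rewrite /T; parity; ring.
    split=> [x y|g y|g x]; rewrite /T.
    - apply: (ML_sign_mul (fun n => size u * (n + size x))%N); apply: ML_mul.
      exact: ML_mulr.
    - apply: (ML_sign_mul (fun n => size u * (size g + n))%N); apply: ML_mul.
      exact: ML_mul.
    by apply: ML_mul; apply: ML_mulr; exact: ML_catl.
  congr (- _); rewrite -cut_mulc; apply: eq_cut => m y.
  rewrite /signed /= /dot -!cut_mulc; apply: eq_cut_size => g x _ _ e.
  by rewrite /T; by_parity e.
rewrite dot_Br // -cut_mulc; apply: eq_cut => u s; rewrite -cut_mulc.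
apply: eq_cut => g t; rewrite -!cut_mulc; apply: eq_cut => v x.
rewrite cats0; have [->|/Xh ->] := eqVneq (size x) r.+1; last by ring.
have [e|ne] := eqVneq (size u + size v)%N p.+1; last first.
  by rewrite Fh ?size_cat //; ring.
by_parity e.
Qed.

End InsertionInProduct.

(** * From homogeneous to non-homogeneous coordinates *)

Section Homogeneous.
Variables (k : comNzRingType) (H : algType k) (HA : hopf_algebra H).
Local Notation eps := (hEps HA).
Local Notation S := (hS HA).
Local Notation sw := (sw HA).
Local Notation word := (seq H).
Local Notation klin := (@klin k H).
Local Notation act := (act HA).
Local Notation dd := (dd HA).
Local Notation cut := (cut HA).
Local Notation Hinv := (Hinv HA).
Local Notation dot := (dot HA).
Local Notation Br := (Br HA).
Implicit Types (F G : word -> k) (u v w s t : word) (P : word -> word -> k).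

Lemma sw_sum h I (r : seq I) (B : I -> H -> H -> k) :
  sw h (fun a b => \sum_(i <- r) B i a b) = \sum_(i <- r) sw h (B i).
Proof. exact: exchange_big. Qed.

(** F on the homogeneous word with non-homogeneous coordinates g; h1, ..., hn, that is
(g_(1), g_(2) h1_(1), g_(3) h1_(2) h2_(1), ...). *)
Fixpoint cv g F t : k :=
  if t is h :: t' then sw g (fun a b => cv (b * h) (fun w => F (a :: w)) t')
  else F [:: g].

Lemma cv_cons g F h t :
  cv g F (h :: t) = sw g (fun a b => cv (b * h) (fun w => F (a :: w)) t).
Proof. by []. Qed.

(** The cochain with homogeneous form F: conv F (h1, ..., hn) is the sum of
F(1, h1_(1), h1_(2) h2_(1), ..., h1_(n) h2_(n-1) ... hn). *)
Definition conv F t := cv 1 F t.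

Lemma lfun_cv g t : lfun (fun F => cv g F t).
Proof.
elim: t g => [|h t IH] g c F G //=.
rewrite -sw_mulrl -sw_add; apply: eq_sw => a b; exact: IH.
Qed.

Lemma klin_cv_fun g t (F : H -> word -> k) :
  (forall v, klin (fun x => F x v)) -> klin (fun x => cv g (F x) t).
Proof. exact: (lfun_klin (lfun_cv g t)). Qed.

Lemma eq_cv g F G t : (forall v, F v = G v) -> cv g F t = cv g G t.
Proof. by move=> e; congr cv; apply/funext. Qed.

Lemma cv_sw g t h (F : H -> H -> word -> k) :
  cv g (fun v => sw h (fun b c => F b c v)) t = sw h (fun b c => cv g (F b c) t).
Proof. exact: (lfun_sw HA h F (lfun_cv g t)). Qed.

Lemma cv_sub g t F G : cv g (fun v => F v - G v) t = cv g F t - cv g G t.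
Proof. exact: (lfun_sub (lfun_cv g t)). Qed.

Lemma cv_mulc g t c F : cv g (fun v => c * F v) t = c * cv g F t.
Proof. exact: (lfun_mul (lfun_cv g t)). Qed.

Lemma klin_cv F t : ML F -> klin (fun g => cv g F t).
Proof.
elim: t F => [|h t IH] F FL /=; first exact: ML_head.
apply: klin_sw_arg; split=> y.
  by apply: klin_cv_fun => v; exact: ML_head.
by apply: (klin_right (f := fun z => cv z _ t)); exact/IH/ML_cons.
Qed.

Lemma ML_cv g F : ML F -> ML (cv g F).
Proof.
move=> FL u; elim: u g F FL => [|y u IH] g F FL v /=.
  apply: klin_sw => a b.
  by apply: (klin_left (f := fun z => cv z _ v)); exact/klin_cv/ML_cons.
by apply: klin_sw => a b; exact/IH/ML_cons.
Qed.

Lemma eq_cv_size g F G t :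
  (forall v, size v = (size t).+1 -> F v = G v) -> cv g F t = cv g G t.
Proof.
elim: t g F G => [|h t IH] g F G e /=; first exact: e.
by apply: eq_sw => a b; apply: IH => v ev; apply: e; rewrite /= ev.
Qed.

Lemma cv0 g t : cv g (fun=> 0) t = 0.
Proof. exact: (lfun0 (lfun_cv g t)). Qed.

Lemma on_length_cv n g F : on_length n.+1 F -> on_length n (cv g F).
Proof.
move=> Fh t tn; rewrite -(cv0 g t); apply: eq_cv_size => v ev.
by apply: Fh; rewrite ev eqSS.
Qed.

Lemma cv_act a g F t : ML F -> cv (a * g) F t = cv g (act a F) t.
Proof.
elim: t a g F => [|h t IH] a g F FL /=.
  rewrite -(swk_counitr HA a (f := fun z => F [:: z * g])) //.
  by apply: (klin_right (f := fun z => F [:: z])); exact: ML_head.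
rewrite swk_mul; last first.
  split=> y; first by apply: klin_cv_fun => v; exact: ML_head.
  by apply: (klin_right (f := fun z => cv z _ t)); exact/klin_cv/ML_cons.
rewrite sw_exchange; apply: eq_sw => c e; rewrite cv_sw; apply: eq_sw => x y.
by rewrite -mulrA IH //; exact: ML_cons.
Qed.

Lemma cv_inv g F t : ML F -> Hinv F -> cv g F t = eps g * conv F t.
Proof.
move=> FL Fi; rewrite -[g in LHS]mulr1 cv_act // -cv_mulc.
by apply: eq_cv => v; exact: Fi.
Qed.

(** * The bar differential *)

(** The value of f on the bar boundary of the word h :: t, without the face that
removes the first letter. *)
Fixpoint bd h (f : word -> k) t : k :=
  if t is h' :: t' then f (h * h' :: t') - bd h' (fun s => f (h :: s)) t'
  else eps h * f [::].

Lemma lfun_bd h t : lfun (fun f => bd h f t).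
Proof.
elim: t h => [|h' t IH] h c F G /=; first by ring.
by rewrite IH; ring.
Qed.

Lemma cv_dd g F h t : ML F ->
  cv g (dd F) (h :: t) = cv (g * h) F t - bd h (cv g F) t.
Proof.
elim: t g F h => [|h' t IH] g F h FL.
  rewrite /= -(swk_counitl HA g (f := fun b => F [:: b * h])).
    rewrite -(swk_counitr HA g (f := fun a => eps h * F [:: a])).
      rewrite -sw_opp -sw_add; apply: eq_sw => a b.
      by rewrite hEpsM; ring.
    by apply: klin_mul; exact: ML_head.
  by apply: (klin_right (f := fun z => F [:: z])); exact: ML_head.
rewrite cv_cons.
transitivity (sw g (fun a b => eps a * cv (b * h) F (h' :: t)
   - (cv (b * h * h') (fun w => F (a :: w)) t
      - bd h' (cv (b * h) (fun w => F (a :: w))) t))).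
  apply: eq_sw => a b; rewrite -IH; last exact: ML_cons.
  by rewrite -cv_mulc -cv_sub.
rewrite sw_add sw_opp sw_add sw_opp.
rewrite (swk_counitl HA g (f := fun b => cv (b * h) F (h' :: t))); last first.
  by apply: (klin_right (f := fun z => cv z _ _)); exact/klin_cv.
congr (_ - (_ - _)).
  by apply: eq_sw => a b; rewrite mulrA.
rewrite -(lfun_sw HA g (fun a b => cv (b * h) (fun w => F (a :: w))) (lfun_bd h' t)).
by [].
Qed.

Lemma conv_dd F h t : ML F -> Hinv F ->
  conv (dd F) (h :: t) = eps h * conv F t - bd h (conv F) t.
Proof. by move=> FL Fi; rewrite /conv cv_dd // mul1r cv_inv. Qed.

Lemma bd_sum h f t : bd h f t =
  \sum_(j < size t) (-1) ^+ j *
     f (take j (h :: t) ++ nth 0 (h :: t) j * nth 0 (h :: t) j.+1 :: drop j.+2 (h :: t))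
  + (-1) ^+ size t * (f (take (size t) (h :: t)) * eps (nth 0 (h :: t) (size t))).
Proof.
elim: t h f => [|h' t IH] h f /=; first by rewrite big_ord0; ring.
rewrite big_ord_recl /= drop0 IH exprS mulN1r opprD mulNr addrA expr0 mul1r.
congr (_ + _ - _).
rewrite -sumrN; apply: eq_bigr => j _.
by rewrite -mulNr -[- _]mulN1r -exprS.
Qed.

Lemma beta_bd n (f : seq H -> k^o) h t : size t = n ->
  beta HA n f (h :: t) = (-1) ^+ n.+1 * (eps h * f t - bd h f t).
Proof.
move=> tn; rewrite /beta /= tn eqxx bd_sum tn.
rewrite big_mkord big_ord_recr big_ord_recl /=.
rewrite {1}/delta /= {2}/delta /= eqxx drop0.
rewrite (reindex_inj rev_ord_inj) /= mulrDr.
have -> : \sum_(j < n) (-1) ^+ bump 0 (n - j.+1) * delta HA n (bump 0 (n - j.+1)) f (h :: t)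
  = (-1) ^+ n * \sum_(j < n) (-1) ^+ j *
     f (take j (h :: t) ++ nth 0 (h :: t) j * nth 0 (h :: t) j.+1 :: drop j.+2 (h :: t)).
  rewrite mulr_sumr; apply: eq_bigr => j _; have jn := ltn_ord j.
  rewrite /bump leq0n add1n /delta /= eqSS ltn_eqF; last by lia.
  have -> : (n - (n - j.+1).+1 = j)%N by lia.
  rewrite mulrA -exprD; congr (_ * _); rewrite !expr_parity.
  suff -> : odd (n - j.+1).+1 = odd (n + j) by [].
  have e : (n + j = (n - j.+1).+1 + j + j)%N by lia.
  by rewrite e -addnA addnn oddD odd_double addbF.
parity; ring.
Qed.

Lemma beta_size n (f : seq H -> k^o) s : size s != n.+1 -> beta HA n f s = 0.
Proof. by move=> /negPf sn; rewrite /beta sn. Qed.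

Lemma conv_dd_beta n F s : ML F -> Hinv F -> on_length n.+1 F ->
  conv (dd F) s = (-1) ^+ n.+1 * beta HA n (conv F) s.
Proof.
move=> FL Fi Fh; have [sn|sn] := eqVneq (size s) n.+1; last first.
  rewrite beta_size // mulr0; apply: (@on_length_cv n.+1) => // w wn.
  transitivity (dd (fun=> 0) w); last exact: (lfun0 (lfun_dd HA w)).
  apply: eq_dd => v ev; apply: Fh; apply: contraNneq wn => vn.
  by move: ev; rewrite vn; case: w => //= x w ->.
case: s sn => [|h t] //= [tn]; rewrite conv_dd // beta_bd // mulrA.
by rewrite -expr2 sqrr_sign mul1r.
Qed.

(** * Cuts in non-homogeneous coordinates *)

(** Like [cv], with the last letter of the homogeneous word split in two by the
coproduct, the second half being passed to [Phi] separately. *)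
Fixpoint ce g (Phi : word -> H -> k) t : k :=
  if t is h :: t' then sw g (fun a b => ce (b * h) (fun w e => Phi (a :: w) e) t')
  else sw g (fun a b => Phi [:: a] b).

Lemma lfun_ce_uncurried g t : lfun (fun F : word * H -> k => ce g (fun u e => F (u, e)) t).
Proof.
elim: t g => [|h t IH] g c F G /=; rewrite -sw_mulrl -sw_add; apply: eq_sw => a b //.
exact: (IH _ c (fun p => F (a :: p.1, p.2)) (fun p => G (a :: p.1, p.2))).
Qed.

Lemma ce_mulc g t c Phi : ce g (fun u e => c * Phi u e) t = c * ce g Phi t.
Proof. exact: (lfun_mul (lfun_ce_uncurried g t) c (fun p => Phi p.1 p.2)). Qed.

Lemma ce_mulcr g t c Phi : ce g (fun u e => Phi u e * c) t = ce g Phi t * c.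
Proof. exact: (lfun_mulr (lfun_ce_uncurried g t) c (fun p => Phi p.1 p.2)). Qed.

Lemma ce_sum g t I (r : seq I) (Phi : I -> word -> H -> k) :
  ce g (fun u e => \sum_(i <- r) Phi i u e) t = \sum_(i <- r) ce g (Phi i) t.
Proof. exact: (lfun_sum (lfun_ce_uncurried g t) r (fun i p => Phi i p.1 p.2)). Qed.

Lemma eq_ce_size g Phi Phi' t :
  (forall u e, size u = (size t).+1 -> Phi u e = Phi' u e) -> ce g Phi t = ce g Phi' t.
Proof.
elim: t g Phi Phi' => [|h t IH] g Phi Phi' E /=; apply: eq_sw => a b; first exact: E.
by apply: IH => u e ue; apply: E; rewrite /= ue.
Qed.

Lemma ce0 g t : ce g (fun _ _ => 0) t = 0.
Proof. exact: (lfun0 (lfun_ce_uncurried g t)). Qed.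

Lemma cv_cut g P t : ML2 P -> cv g (cut P) t =
  \sum_(i < (size t).+1) (-1) ^+ i *
     ce g (fun w e => cv e (P w) (drop i t)) (take i t).
Proof.
elim: t g P => [|h t IH] g P PL; have [P1 P2] := PL.
  rewrite big_ord_recl big_ord0 /= expr0 mul1r addr0.
  by rewrite -[RHS]subr0.
rewrite big_ord_recl /= expr0 mul1r.
transitivity (sw g (fun a b => sw a (fun c e => cv (b * h) (fun w => P [:: c] (e :: w)) t))
  - sw g (fun a b => cv (b * h) (cut (fun u v => P (a :: u) v)) t)).
  rewrite -sw_opp -sw_add; apply: eq_sw => a b.
  by rewrite -cv_sw -cv_sub; apply: eq_cv.
congr (_ + _).
  rewrite (@swk_coassoc _ _ _ (fun c e b => cv (b * h) (fun w => P [:: c] (e :: w)) t)) //.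
  - by move=> b c; apply: klin_cv_fun => v; exact: (P1 _ [::]).
  - by move=> b c; apply: klin_cv_fun => v; exact: (P2 _ [::]).
  - move=> a b; apply: (klin_right (f := fun z => cv z _ t)); apply: klin_cv.
    by apply: ML_cons; exact: P2.
rewrite -sw_opp; transitivity (sw g (fun a b => \sum_(i < (size t).+1) (-1) ^+ i.+1 *
    ce (b * h) (fun w e => cv e (P (a :: w)) (drop i t)) (take i t))).
  apply: eq_sw => a b; rewrite IH; last exact: ML2_cons.
  by rewrite -sumrN; apply: eq_bigr => i _; rewrite exprS; ring.
rewrite sw_sum; apply: eq_bigr => i _ /=.
by rewrite /bump add1n -sw_mulrl.
Qed.

(** Only one cut contributes when the first piece has a fixed length. *)
Lemma cv_cut_length p g P t : ML2 P ->
  (forall u v, size u != p.+1 -> P u v = 0) ->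
  cv g (cut P) t = if (p <= size t)%N then
     (-1) ^+ p * ce g (fun w e => cv e (P w) (drop p t)) (take p t) else 0.
Proof.
move=> PL Ph; rewrite cv_cut //.
have Z (i : 'I_(size t).+1) : i != p :> nat ->
    ce g (fun w e => cv e (P w) (drop i t)) (take i t) = 0.
  move=> ip; rewrite -(ce0 g (take i t)); apply: eq_ce_size => u e ue.
  rewrite -(cv0 e (drop i t)); apply: eq_cv => v; apply: Ph.
  by rewrite ue size_takel ?eqSS // -ltnS.
case: ifP => [pt|/negbT pt].
  rewrite (bigD1 (Ordinal (pt : p < (size t).+1)%N)) //= big1 ?addr0 // => i ip.
  by rewrite Z ?mulr0.
apply: big1 => i _; rewrite Z ?mulr0 //; apply: contraNneq pt => <-.
by rewrite -ltnS.
Qed.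

Lemma ce_counit g F t : ML F -> ce g (fun w e => F w * eps e) t = cv g F t.
Proof.
elim: t g F => [|h t IH] g F FL /=.
  rewrite -(swk_counitr HA g (f := fun a => F [:: a])); last exact: ML_head.
  by apply: eq_sw => a b; rewrite mulrC.
by apply: eq_sw => a b; apply: IH; exact: ML_cons.
Qed.

Lemma conv_dot p F G t : ML F -> ML G -> Hinv G -> on_length p.+1 F ->
  conv (dot F G) t = if (p <= size t)%N then
     (-1) ^+ p * (conv F (take p t) * conv G (drop p t)) else 0.
Proof.
move=> FL GL Gi Fh; rewrite /conv (@cv_cut_length p); first last.
- by move=> u v up; rewrite Fh ?mul0r.
- exact: ML2_tensor.
case: ifP => // _; congr (_ * _); rewrite -ce_counit // -ce_mulcr.
by apply: eq_ce_size => u e _; rewrite cv_mulc cv_inv // /conv; ring.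
Qed.

Lemma cv_insert g F t1 m t3 :
  cv g F (t1 ++ m :: t3) = ce g (fun u e => cv (e * m) (fun v => F (u ++ v)) t3) t1.
Proof.
elim: t1 g F => [|h t IH] g F //=.
by apply: eq_sw => a b; rewrite IH.
Qed.

(** In the coordinates of t, evaluation of G on all letters but the last half-letter uses
the first Sweedler factors of t; the product of the second ones multiplies the last
half-letter. This is the form of the operadic insertion. *)
Lemma ce_sweedler e G (phi : H -> k) t : ML G -> klin phi ->
  ce e (fun g e' => G g * phi e') t =
  \sum_(x <- sweedler_seq HA t)
    sw e (fun a b => cv a G x.1 * phi (b * \prod_(h <- x.2) h)).
Proof.
elim: t e G => [|h t IH] e G GL pl.
  rewrite big_seq1 /= big_nil.
  by apply: eq_sw => a b; rewrite mulr1.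
rewrite [LHS]/= [sweedler_seq HA (h :: t)]/= big_allpairs_dep.
transitivity (sw e (fun a b => \sum_(x <- sweedler_seq HA t)
   sw b (fun b1 b2 => sw h (fun h1 h2 => cv (b1 * h1) (fun w => G (a :: w)) x.1 *
     phi (b2 * h2 * \prod_(h <- x.2) h))))).
  apply: eq_sw => a b; rewrite IH //; last exact: ML_cons.
  apply: eq_bigr => x _; rewrite swk_mul //; split=> y.
    by apply: klin_mulr; apply: klin_cv; exact: ML_cons.
  by apply: klin_mul; apply: klin_right.
transitivity (sw h (fun h1 h2 => \sum_(x <- sweedler_seq HA t)
   sw e (fun a' b' => sw a' (fun a b1 => cv (b1 * h1) (fun w => G (a :: w)) x.1 *
     phi (b' * h2 * \prod_(h <- x.2) h))))).
  rewrite !sw_sum; apply: eq_bigr => x _.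
  transitivity (sw e (fun a b => sw h (fun h1 h2 => sw b (fun b1 b2 =>
     cv (b1 * h1) (fun w => G (a :: w)) x.1 * phi (b2 * h2 * \prod_(h <- x.2) h))))).
    by apply: eq_sw => a b; rewrite sw_exchange.
  rewrite [LHS]sw_exchange; apply: eq_sw => h1 h2.
  rewrite -(@swk_coassoc _ _ _ (fun a b1 b2 => cv (b1 * h1) (fun w => G (a :: w)) x.1 *
     phi (b2 * h2 * \prod_(h <- x.2) h))) //.
  - by move=> b c; apply: klin_mulr; apply: klin_cv_fun => v; exact: ML_head.
  - move=> a c; apply: klin_mulr; apply: (klin_right (f := fun z => cv z _ _)).
    by apply: klin_cv; exact: ML_cons.
  - move=> a b; apply: klin_mul; apply: (klin_right (f := fun z => phi (z * _))).
    exact: klin_right.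
apply: eq_bigr => y _; apply: eq_bigr => x _; apply: eq_sw => a b /=.
by rewrite big_cons mulrA sw_mulrr.
Qed.

Lemma ML_sum F I (r : seq I) (c : I -> k) (y : I -> H) u v : ML F ->
  F (u ++ (\sum_(i <- r) c i *: y i) :: v) = \sum_(i <- r) c i * F (u ++ y i :: v).
Proof.
move=> FL; have F0 : F (u ++ 0 :: v) = 0.
  by have := FL u v (-1) 0 0; rewrite scaler0 addr0 mulN1r addNr.
elim: r => [|i r IH]; first by rewrite !big_nil.
by rewrite !big_cons FL IH.
Qed.

(** The insertion [Br] is, up to sign, the sum of all operadic insertions. The Sweedler
factors h_(2) of the operad come from the letter at which the second cut is made. *)
Lemma conv_Br p q F G t : ML F -> ML G -> Hinv G ->
  on_length p.+1 F -> on_length q.+1 G ->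
  conv (Br F G) t = \sum_(i < (size t).+1 | (q + i <= size t)%N) (-1) ^+ (i * q.+1) *
    conv F (take i t ++ operad_insert HA (conv G) (take q (drop i t)) :: drop (i + q) t).
Proof.
move=> FL GL Gi Fh Gh; rewrite /Br /conv.
rewrite (@eq_cv _ _ (cut (fun u r => (-1) ^+ size u * cut (fun g v =>
   (-1) ^+ (size u * size g) * (F (u ++ v) * G g)) r))); last exact: cuts2E.
have ML2I u : ML2 (fun g v => (-1) ^+ (size u * size g) * (F (u ++ v) * G g)).
  split=> [v|g].
    by apply: (ML_sign_mul (fun n => size u * n)%N); exact: ML_mul.
  by apply: ML_mul; apply: ML_mulr; exact: ML_catl.
rewrite cv_cut; last first.
  split=> [r|u]; last by apply: ML_mul; exact: ML_cut.
  apply: (ML_sign_mul id); apply: ML_cut_param => g v.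
  apply: (ML_sign_mul (fun n => n * size g)%N); apply: ML_mulr; exact: ML_catr.
rewrite [RHS]big_mkcond /=; apply: eq_bigr => i _.
have it : (i <= size t)%N by rewrite -ltnS.
have -> : (q + i <= size t)%N = (q <= size (drop i t))%N by rewrite size_drop; lia.
transitivity (if (q <= size (drop i t))%N then (-1) ^+ (i * q.+1) *
   ce 1 (fun u e => ce e (fun g e' => G g *
      cv e' (fun v => F (u ++ v)) (drop q (drop i t))) (take q (drop i t))) (take i t) else 0).
  transitivity ((-1) ^+ i * ce 1 (fun u e => if (q <= size (drop i t))%N then
     (-1) ^+ (i.+1 + q + i.+1 * q.+1) * ce e (fun g e' => G g *
      cv e' (fun v => F (u ++ v)) (drop q (drop i t))) (take q (drop i t)) else 0) (take i t)).
    congr (_ * _); apply: eq_ce_size => u e; rewrite size_takel // => ui.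
    rewrite cv_mulc (@cv_cut_length q) //; last first.
      by move=> g v /Gh ->; rewrite !mulr0.
    case: ifP => _; rewrite ?mulr0 // ui.
    have -> : (-1) ^+ (i.+1 + q + i.+1 * q.+1) =
       (-1) ^+ i.+1 * ((-1) ^+ q * (-1) ^+ (i.+1 * q.+1)) :> k by rewrite !exprD mulrA.
    rewrite -!mulrA; congr (_ * (_ * _)).
    rewrite -ce_mulc; apply: eq_ce_size => g e' _; rewrite cv_mulc.
    have [->|/Gh Gg] := eqVneq (size g) q.+1; last first.
      rewrite Gg mul0r mulr0 -[RHS](mulr0 ((-1) ^+ (i.+1 * size g))); congr (_ * _).
      rewrite -[RHS](cv0 e' (drop q (drop i t))); apply: eq_cv => v; ring.
    congr (_ * _); rewrite -cv_mulc; apply: eq_cv => v; ring.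
  case: ifP => _; last by rewrite ce0 mulr0.
  by rewrite ce_mulc mulrA; congr (_ * _); parity; ring.
case: ifP => // qi; congr (_ * _).
transitivity (ce 1 (fun u e => \sum_(x <- sweedler_seq HA (take q (drop i t)))
   conv G x.1 * cv (e * \prod_(h <- x.2) h) (fun v => F (u ++ v)) (drop q (drop i t))) (take i t)).
  apply: eq_ce_size => u e _; rewrite ce_sweedler //; last by apply: klin_cv; exact: ML_catl.
  apply: eq_bigr => x _.
  rewrite -(swk_counitl HA e (f := fun z => conv G x.1 *
     cv (z * \prod_(h <- x.2) h) (fun v => F (u ++ v)) (drop q (drop i t)))).
    by apply: eq_sw => a b; rewrite cv_inv // mulrA.
  apply: klin_mul; apply: (klin_right (f := fun z => cv z _ _)).
  by apply: klin_cv; exact: ML_catl.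
rewrite ce_sum /operad_insert -/(conv F _) ML_sum; last exact: ML_cv.
apply: eq_bigr => x _; rewrite ce_mulc; congr (_ * _).
by rewrite /conv cv_insert drop_drop addnC.
Qed.

(** * From non-homogeneous to homogeneous coordinates *)

(** The functional [homog f] on the word x :: w. *)
Fixpoint ec x (f : word -> k) w : k :=
  if w is y :: w' then sw y (fun a b => ec b (fun t => f (S x * a :: t)) w')
  else eps x * f [::].

(** The homogeneous form of f: homog f (x0, ..., xn) is the sum of
f(S(x0) x1_(1), S(x1_(2)) x2_(1), ..., S(x_(n-1)_(2)) xn). Its value on the empty word,
which is of no degree, is 0. *)
Definition homog (f : word -> k) w := if w is x :: w' then ec x f w' else 0.

Lemma ec_cons x f y w :
  ec x f (y :: w) = sw y (fun a b => ec b (fun t => f (S x * a :: t)) w).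
Proof. by []. Qed.

Lemma lfun_ec x w : lfun (fun f => ec x f w).
Proof.
elim: w x => [|y w IH] x c F G /=; first by ring.
rewrite -sw_mulrl -sw_add; apply: eq_sw => a b; exact: IH.
Qed.

Lemma klin_ec_fun x w (f : H -> word -> k) :
  (forall v, klin (fun x => f x v)) -> klin (fun y => ec x (f y) w).
Proof. exact: (lfun_klin (lfun_ec x w)). Qed.

Lemma eq_ec_size x f g w : (forall t, size t = size w -> f t = g t) ->
  ec x f w = ec x g w.
Proof.
elim: w x f g => [|y w IH] x f g e /=; first by rewrite e.
by apply: eq_sw => a b; apply: IH => t et; apply: e; rewrite /= et.
Qed.

Lemma klin_SM (F : word -> k) a v : ML F -> klin (fun z => F (S z * a :: v)).
Proof.
move=> FL; apply: (klin_S HA (f := fun z => F (z * a :: v))).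
by apply: (klin_right (f := fun z => F (z :: v))); exact: ML_head.
Qed.

Lemma klin_MS (F : word -> k) a v : ML F -> klin (fun z => F (a * z :: v)).
Proof. by move=> FL; apply: (klin_left (f := fun z => F (z :: v))); exact: ML_head. Qed.

Lemma klin_ec f w : ML f -> klin (fun x => ec x f w).
Proof.
elim: w f => [|y w IH] f fL /=; first by apply: klin_mulr; exact: eps_klin.
apply: klin_sw => a b; apply: klin_ec_fun => t; exact: klin_SM.
Qed.

Lemma ML_ec x f : ML f -> ML (ec x f).
Proof.
move=> fL u; elim: u x f fL => [|z u IH] x f fL v /=.
  apply: klin_sw_arg; split=> y.
    by apply: klin_ec_fun => t; exact: klin_MS.
  exact/klin_ec/ML_cons.
by apply: klin_sw => a b; exact/IH/ML_cons.
Qed.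

Lemma ML_homog f : ML f -> ML (homog f).
Proof.
by move=> fL [|y u] v /=; [exact: klin_ec|exact: ML_ec].
Qed.

Lemma on_length_homog n f : on_length n f -> on_length n.+1 (homog f).
Proof.
move=> fh [|x w] //= wn; transitivity (ec x (fun=> 0) w).
  by apply: eq_ec_size => t et; apply: fh; rewrite et -eqSS.
exact: (lfun0 (lfun_ec x w)).
Qed.

Lemma cv_ec g x f t : ML f -> cv g (ec x f) t = f (S x * g :: t).
Proof.
elim: t g x f => [|h t IH] g x f fL.
  rewrite /= (swk_counitr HA g (f := fun a => f [:: S x * a])) //.
  exact: klin_MS.
rewrite cv_cons.
transitivity (sw g (fun a b => sw a (fun c e => f (S x * c :: S e * (b * h) :: t)))).
  apply: eq_sw => a b; rewrite cv_sw; apply: eq_sw => c e.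
  by rewrite IH //; exact: ML_cons.
rewrite (@swk_coassoc _ _ _ (fun c e b => f (S x * c :: S e * (b * h) :: t))).
- rewrite -(swk_counitr HA g (f := fun a => f (S x * a :: h :: t))); last exact: klin_MS.
  apply: eq_sw => a b; rewrite -[h in RHS]mul1r.
  rewrite -(swk_antipodel HA b (f := fun z => f (S x * a :: z * h :: t))).
    by apply: eq_sw => c e; rewrite mulrA.
  apply: (klin_right (f := fun z => f (S x * a :: z :: t)));
     exact: (ML_head t (ML_cons _ fL)).
- by move=> b c; exact: klin_MS.
- by move=> a c; apply: (klin_SM (F := fun w => f (S x * a :: w))); exact: ML_cons.
move=> a b; apply: (klin_right (f := fun z => f (S x * a :: S b * z :: t))).
by apply: (klin_MS (F := fun w => f (S x * a :: w))); exact: ML_cons.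
Qed.

Lemma conv_homog f t : ML f -> conv (homog f) t = f t.
Proof.
move=> fL; case: t => [|h t]; first by rewrite /conv /= hEps1 mul1r.
rewrite /conv cv_cons swk_1; last first.
  split=> y; first by apply: klin_cv_fun => v; exact: klin_ec.
  by apply: (klin_right (f := fun z => cv z _ t)); apply: klin_cv; exact: ML_ec.
by rewrite -[cv _ _ _]/(cv (1 * h) (ec 1 f) t) cv_ec // hS_1 !mul1r.
Qed.

Lemma act_ec a F y w : ML F ->
  act a F (y :: w) = sw y (fun p q => ec q (cv (a * p) F) w).
Proof.
elim: w a F y => [|z w IH] a F y FL.
  rewrite /= (swk_counitr HA a (f := fun z => F [:: z * y])).
    by rewrite (swk_counitr HA y (f := fun z => F [:: a * z])) //; exact: klin_MS.
  by apply: (klin_right (f := fun z => F [:: z])); exact: ML_head.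
have L1 (g : H -> H) a1 (gl : forall f, klin f -> klin (fun x => f (g x))) :
    klin (fun x => act (g x) (fun v => F (a1 :: v)) (z :: w)).
  by apply: (gl (fun x => act x (fun v => F (a1 :: v)) (z :: w))); exact/klin_act/ML_cons.
transitivity (sw a (fun a1 a2 => sw y (fun p1 r => sw r (fun p2 q =>
   act (a2 * (p2 * S q)) (fun v => F (a1 * p1 :: v)) (z :: w))))).
  rewrite -[LHS]/(sw a (fun a1 a2 => act a2 (fun v => F (a1 * y :: v)) (z :: w))).
  apply: eq_sw => a1 a2.
  rewrite -(swk_counitr HA y (f := fun p => act a2 (fun v => F (a1 * p :: v)) (z :: w))).
    apply: eq_sw => p1 r.
    rewrite (swk_antipoder HA r (f := fun x => act (a2 * x) (fun v => F (a1 * p1 :: v)) (z :: w))).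
      by rewrite mulr1.
    by apply: L1 => f fl; exact: klin_left.
  by apply: klin_act_fun => v; exact: klin_MS.
transitivity (sw a (fun a1 a2 => sw y (fun p q => sw p (fun p1 p2 =>
   act (a2 * (p2 * S q)) (fun v => F (a1 * p1 :: v)) (z :: w))))).
  apply: eq_sw => a1 a2.
  rewrite -(@swk_coassoc _ _ _ (fun p1 p2 q =>
     act (a2 * (p2 * S q)) (fun v => F (a1 * p1 :: v)) (z :: w))) //.
  - by move=> b c; apply: klin_act_fun => v; exact: klin_MS.
  - move=> b c; apply: L1 => f fl.
    by apply: (klin_right (f := fun x => f (a2 * x))); exact: klin_left.
  move=> b c; apply: L1 => f fl; apply: (klin_S HA (f := fun x => f (a2 * (c * x)))).
  by apply: (klin_left (f := fun x => f (a2 * x))); exact: klin_left.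
rewrite sw_exchange; apply: eq_sw => p q.
transitivity (sw a (fun a1 a2 => sw p (fun p1 p2 => sw z (fun c e =>
   ec e (cv (a2 * (p2 * S q) * c) (fun v => F (a1 * p1 :: v))) w)))).
  by apply: eq_sw => a1 a2; apply: eq_sw => p1 p2; rewrite IH //; exact: ML_cons.
rewrite ec_cons.
transitivity (sw a (fun a1 a2 => sw z (fun c e => sw p (fun p1 p2 =>
   ec e (cv (a2 * (p2 * S q) * c) (fun v => F (a1 * p1 :: v))) w)))).
  by apply: eq_sw => a1 a2; rewrite sw_exchange.
rewrite sw_exchange; apply: eq_sw => c e.
transitivity (ec e (fun t => sw a (fun a1 a2 => sw p (fun p1 p2 =>
   cv (a2 * (p2 * S q) * c) (fun v => F (a1 * p1 :: v)) t))) w).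
  rewrite (lfun_sw HA a _ (lfun_ec e w)); apply: eq_sw => a1 a2.
  by rewrite (lfun_sw HA p _ (lfun_ec e w)).
apply: eq_ec_size => t _; rewrite cv_cons swk_mul.
  by apply: eq_sw => a1 a2; apply: eq_sw => p1 p2; rewrite !mulrA.
split=> b; first by apply: klin_cv_fun => v; exact: ML_head.
by apply: (klin_right (f := fun z => cv z _ t)); exact/klin_cv/ML_cons.
Qed.

Lemma homog_conv F w : ML F -> Hinv F -> F [::] = 0 -> homog (conv F) w = F w.
Proof.
move=> FL Fi F0; case: w => [|x w] //=.
have E v : act x (fun u => F (u ++ v)) [:: 1] = F (x :: v).
  rewrite /= -(swk_counitr HA x (f := fun z => F (z :: v))); last exact: ML_head.
  by apply: eq_sw => a b; rewrite mulr1.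
case: w => [|y w].
  by rewrite /= /conv -(E [::]) -Fi; apply: eq_act => v; rewrite cats0.
rewrite -E (act_transfer _ _ _ FL Fi) act_ec; last exact: ML_cons.
rewrite ec_cons; apply: eq_sw => a b; apply: eq_ec_size => t _.
rewrite /conv cv_cons swk_1 ?mul1r //.
split=> c; first by apply: klin_cv_fun => v; exact: ML_head.
by apply: (klin_right (f := fun z => cv z _ t)); exact/klin_cv/ML_cons.
Qed.

Lemma act_ec_inv h x f w : ML f ->
  sw h (fun p q => act q (ec (p * x) f) w) = eps h * ec x f w.
Proof.
elim: w h x f => [|y w IH] h x f fL.
  rewrite /= (swk_counitr HA h (f := fun p => eps (p * x) * f [::])).
    by rewrite hEpsM mulrA.
  by apply: klin_mulr; apply: (klin_right (f := eps)); exact: eps_klin.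
have L1 p q c2 y1 y2 : klin (fun c1 => act q (ec (c2 * y2)
     (fun t => f (S (p * x) * (c1 * y1) :: t))) w).
  apply: klin_act_fun => v; apply: klin_ec_fun => t.
  by apply: (klin_right (f := fun z => f (_ * z :: t))); exact: klin_MS.
have L2 g : ML g -> klin (fun c2 => ec c2 g w) by exact: klin_ec.
transitivity (sw h (fun p q => sw y (fun y1 y2 => sw q (fun c e => sw c (fun c1 c2 =>
    act e (ec (c2 * y2) (fun t => f (S (p * x) * (c1 * y1) :: t))) w))))).
  apply: eq_sw => p q.
  transitivity (sw q (fun c e => sw c (fun c1 c2 => sw y (fun y1 y2 =>
    act e (ec (c2 * y2) (fun t => f (S (p * x) * (c1 * y1) :: t))) w)))).
    rewrite [LHS]/=; apply: eq_sw => c e.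
    rewrite (@eq_act _ _ HA e _ (fun v => sw c (fun c1 c2 => sw y (fun y1 y2 =>
       ec (c2 * y2) (fun t => f (S (p * x) * (c1 * y1) :: t)) v)))).
      by rewrite act_sw; apply: eq_sw => c1 c2; rewrite act_sw.
    move=> v; rewrite swk_mul //; split=> b.
      by apply: klin_ec_fun => t; exact: klin_MS.
    exact/klin_ec/ML_cons.
  transitivity (sw q (fun c e => sw y (fun y1 y2 => sw c (fun c1 c2 =>
    act e (ec (c2 * y2) (fun t => f (S (p * x) * (c1 * y1) :: t))) w)))).
    by apply: eq_sw => c e; rewrite sw_exchange.
  by rewrite sw_exchange.
transitivity (sw h (fun p q => sw y (fun y1 y2 =>
    ec y2 (fun t => f (S (p * x) * (q * y1) :: t)) w))).
  apply: eq_sw => p q; apply: eq_sw => y1 y2.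
  rewrite (@swk_coassoc _ _ _ (fun c1 c2 e =>
    act e (ec (c2 * y2) (fun t => f (S (p * x) * (c1 * y1) :: t))) w)).
  - rewrite -(swk_counitr HA q (f := fun c1 =>
       ec y2 (fun t => f (S (p * x) * (c1 * y1) :: t)) w)).
      by apply: eq_sw => c1 r; rewrite IH //; exact: ML_cons.
    apply: klin_ec_fun => t.
    by apply: (klin_right (f := fun z => f (_ * z :: t))); exact: klin_MS.
  - by move=> b c; exact: L1.
  - move=> a c; apply: klin_act_fun => v.
    by apply: (klin_right (f := fun z => ec z _ v)); apply: klin_ec; exact: ML_cons.
  by move=> a b; apply: klin_act; apply: ML_ec; exact: ML_cons.
rewrite sw_exchange ec_cons -sw_mulrl; apply: eq_sw => y1 y2.
transitivity (sw h (fun p q => ec y2 (fun t => f (S x * (S p * q) * y1 :: t)) w)).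
  apply: eq_sw => p q; apply: eq_ec_size => t _.
  by rewrite hS_mul !mulrA.
rewrite (swk_antipodel HA h (f := fun z => ec y2 (fun t => f (S x * z * y1 :: t)) w)).
  by rewrite mulr1.
apply: klin_ec_fun => t; apply: (klin_left (f := fun z => f (z * y1 :: t))).
by apply: (klin_right (f := fun z => f (z :: t))); exact: ML_head.
Qed.

Lemma Hinv_homog f : ML f -> Hinv (homog f).
Proof.
move=> fL h [|x w]; first by rewrite /= mulr0.
exact: act_ec_inv.
Qed.

End Homogeneous.

(** * Cochains in homogeneous coordinates *)

Section CupProduct.
Variables (k : comNzRingType) (H : algType k) (HA : hopf_algebra H).
Local Notation eps := (hEps HA).
Local Notation word := (seq H).
Local Notation dd := (dd HA).
Local Notation Hinv := (Hinv HA).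
Local Notation dot := (dot HA).
Local Notation Br := (Br HA).
Local Notation conv := (conv HA).
Local Notation homog := (homog HA).
Local Notation cochain := (@cochain k H).
Local Notation is_cocycle := (is_cocycle HA).
Local Notation is_coboundary := (is_coboundary HA).
Implicit Types (F G X : word -> k) (f g : word -> k^o) (w s t : word).

Lemma cochainP n f : cochain n f <-> ML f /\ on_length n f.
Proof.
split=> [[f1 f0]|[fL fh]]; last by split=> // s1 s2 _; exact: fL.
split=> // u v; have [e|ne] := eqVneq (size u + (size v).+1)%N n; first exact: f1.
by move=> a x y; rewrite !f0 ?mulr0 ?addr0 // size_cat.
Qed.

(** The homogeneous cochains of degree n. *)
Definition homogeneous n F := [/\ ML F, Hinv F & on_length n.+1 F].

Lemma homogeneous_homog n f : cochain n f -> homogeneous n (homog f).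
Proof.
move=> /cochainP [fL fh]; split; first exact: ML_homog.
  exact: Hinv_homog.
exact: on_length_homog.
Qed.

Lemma cochain_conv n F : ML F -> on_length n.+1 F -> cochain n (conv F).
Proof. by move=> FL Fh; apply/cochainP; split; [exact: ML_cv|exact: on_length_cv]. Qed.

Lemma lfun_conv t : lfun (fun F => conv F t).
Proof. exact: lfun_cv. Qed.

Lemma lfun_homog w : lfun (fun f => homog f w).
Proof. by case: w => [|x w] c F G /=; [ring|exact: (lfun_ec HA x w)]. Qed.

Lemma conv_homogE n f : cochain n f -> conv (homog f) = f.
Proof. by move=> /cochainP [fL _]; apply/funext => t; exact: conv_homog. Qed.

Lemma homog_convE n F : homogeneous n F -> homog (conv F) = F.
Proof.
move=> [FL Fi Fh]; apply/funext => w; apply: homog_conv => //.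
exact: on_length_nil Fh.
Qed.

Lemma dd_homog n f w : cochain n f ->
  dd (homog f) w = (-1) ^+ n.+1 * homog (beta HA n f) w.
Proof.
move=> fc; have [FL Fi Fh] := homogeneous_homog fc.
rewrite -[LHS](@homog_conv _ _ HA (dd (homog f)) w) //; last first.
- exact: Hinv_dd.
- exact: ML_dd.
have -> : conv (dd (homog f)) = fun t => (-1) ^+ n.+1 * beta HA n f t.
  by apply/funext => t; rewrite (conv_dd_beta _ FL Fi Fh) (conv_homogE fc).
exact: (lfun_mul (lfun_homog w)).
Qed.

Lemma dd_homog_cocycle n f w : is_cocycle n f -> dd (homog f) w = 0.
Proof.
move=> [fc fb]; rewrite (dd_homog _ fc) fb.
by rewrite (_ : homog 0 w = 0) ?mulr0 //; exact: (lfun0 (lfun_homog w)).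
Qed.

Lemma cocycle_conv n F : homogeneous n F -> (forall w, dd F w = 0) ->
  is_cocycle n (conv F).
Proof.
move=> [FL Fi Fh] F0; split; first exact: cochain_conv.
apply/funext => s; have := conv_dd_beta s FL Fi Fh.
rewrite (_ : conv (dd F) s = 0).
  by move=> /esym e; have := signrMK n.+1 (beta HA n (conv F) s : k); rewrite e mulr0 => <-.
have -> : dd F = fun=> 0 by apply/funext.
exact: (lfun0 (lfun_conv s)).
Qed.

(** An exact homogeneous cochain represents a coboundary. The hypothesis on the empty
word matters for n = 0 only, where there is no cochain of degree -1. *)
Lemma coboundary_conv n Z K : ML K -> Hinv K -> on_length n K -> K [::] = 0 ->
  (forall w, Z w = dd K w) -> is_coboundary n (conv Z).
Proof.
move=> KL Ki Kh K0 e; have -> : Z = dd K by apply/funext.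
case: n Kh => [|n] Kh /=.
  apply/funext => s; have -> : dd K = fun=> 0.
    apply/funext => w; transitivity (dd (fun=> 0) w); last exact: (lfun0 (lfun_dd HA w)).
    by apply: eq_dd => -[|x v] // _; exact: Kh.
  exact: (lfun0 (lfun_conv s)).
exists ((-1) ^+ n.+1 *: (conv K : word -> k^o)).
  have := cochain_lin ((-1) ^+ n.+1) (cochain_conv KL Kh) (cochain0 H n).
  by rewrite addr0.
apply/funext => s; rewrite (conv_dd_beta s KL Ki Kh).
by have := beta_lin HA n ((-1) ^+ n.+1) (conv K) 0; rewrite beta0 !addr0 => ->.
Qed.

(** * The cup product of cochains *)

(** The sum of f(t1) g(t2) over all decompositions t = t1 ++ t2. It does not depend on
degrees and is strictly associative, and it agrees with the operadic cup product on
cochains ([cochain_cupE]). *)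
Fixpoint cup f g t : k :=
  if t is x :: t' then f [::] * g t + cup (fun u => f (x :: u)) g t' else f [::] * g [::].

Lemma cupDl c f f' g t : cup (c *: f + f') g t = c * cup f g t + cup f' g t.
Proof.
elim: t f f' => [|x t IH] f f' /=.
  by rewrite -[(c *: f + f') [::]]/(c * f [::] + f' [::]); ring.
rewrite -[(c *: f + f') [::]]/(c * f [::] + f' [::]).
by rewrite (IH (fun u => f (x :: u)) (fun u => f' (x :: u))); ring.
Qed.

Lemma cupDr c f g g' t : cup f (c *: g + g') t = c * cup f g t + cup f g' t.
Proof.
elim: t f => [|x t IH] f /=.
  by rewrite -[(c *: g + g') [::]]/(c * g [::] + g' [::]); ring.
rewrite -[(c *: g + g') (x :: t)]/(c * g (x :: t) + g' (x :: t)).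
by rewrite IH; ring.
Qed.

Lemma cup_assoc f g h t : cup f (cup g h) t = cup (cup f g) h t.
Proof.
elim: t f g => [|x t IH] f g /=; first by ring.
rewrite IH.
have -> : cup (fun u => f [::] * g (x :: u) + cup (fun v => f (x :: v)) g u) h t =
   f [::] * cup (fun u => g (x :: u)) h t + cup (cup (fun v => f (x :: v)) g) h t.
  exact: (cupDl (f [::]) (fun u => g (x :: u)) (cup (fun v => f (x :: v)) g) h t).
ring.
Qed.

Lemma cup_length p f g t : on_length p f ->
  cup f g t = if (p <= size t)%N then f (take p t) * g (drop p t) else 0.
Proof.
elim: t p f => [|x t IH] [|p] f fh //=; first by rewrite fh // mul0r.
  rewrite [X in _ + X](_ : _ = 0) ?addr0 //.
  rewrite (IH 0%N) => [|u _]; last exact: fh.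
  by rewrite fh // mul0r.
by rewrite fh // mul0r add0r (IH p) // => u up; exact: fh.
Qed.

(** The counit removes the Sweedler factors that the insertion leaves behind. *)
Lemma eps_insert f s : ML f -> eps (operad_insert HA f s) = f s.
Proof.
have eps_sum I (r : seq I) (c : I -> k) (y : I -> H) :
    eps (\sum_(i <- r) c i *: y i) = \sum_(i <- r) c i * eps (y i).
  elim: r => [|i r IH].
    rewrite !big_nil; have := eps_klin HA (-1) 0 0.
    by rewrite scaler0 addr0 mulN1r addNr.
  by rewrite !big_cons (eps_klin HA) IH.
rewrite /operad_insert eps_sum.
elim: s f => [|h s IH] f fL /=.
  by rewrite big_seq1 big_nil hEps1 mulr1.
rewrite big_allpairs_dep -(swk_counitr HA h (f := fun z => f (z :: s))); last exact: ML_head.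
apply: eq_bigr => x _; rewrite -(IH (fun u => f (x.1 :: u))); last exact: ML_cons.
by rewrite mulr_sumr; apply: eq_bigr => y _ /=; rewrite big_cons hEpsM; ring.
Qed.

Lemma cochain_cupE p q f g : cochain p f -> cochain q g ->
  cochain_cup HA p q f g = cup f g.
Proof.
move=> /cochainP [fL fh] /cochainP [gL gh]; apply/funext => s.
rewrite (cup_length _ _ fh) /cochain_cup /operad_comp /= subn1 /=.
have [sn|sn] := eqVneq (size s) (p + q)%N; last first.
  case: ifP => // ps; rewrite gh ?mulr0 // size_drop.
  by apply: contraNneq sn => <-; rewrite subnKC.
have ps : (p <= size s)%N by rewrite sn leq_addr.
rewrite ps drop0 subnn take0 /= size_cat /= size_drop size_takel // sn subnn.
rewrite addn1 eqxx add0n.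
rewrite take_size_cat ?size_takel // drop_size_cat ?size_takel //.
rewrite drop_oversize ?sn // hEpsM !eps_insert //.
by rewrite -[q](addKn p) -sn -size_drop take_size.
Qed.

Lemma conv_dotE p F G : homogeneous p F -> ML G -> Hinv G ->
  conv (dot F G) = (-1) ^+ p *: (cup (conv F) (conv G) : word -> k^o).
Proof.
move=> [FL Fi Fh] GL Gi; apply/funext => t.
rewrite (conv_dot t FL GL Gi Fh) -[RHS]/((-1) ^+ p * cup (conv F) (conv G) t).
rewrite (cup_length _ _ (on_length_cv HA 1 Fh)).
by case: ifP => // _; rewrite mulr0.
Qed.

Lemma homogeneous_dot p q F G : homogeneous p F -> homogeneous q G ->
  homogeneous (p + q) (dot F G).
Proof.
move=> [FL Fi Fh] [GL Gi Gh]; split; [exact: ML_dot|exact: Hinv_dot|exact: on_length_dot].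
Qed.

Lemma cupE p q f g : cochain p f -> cochain q g ->
  cup f g = (-1) ^+ p *: (conv (dot (homog f) (homog g)) : word -> k^o).
Proof.
move=> fc gc; have F := homogeneous_homog fc; have [GL Gi _] := homogeneous_homog gc.
rewrite (conv_dotE F GL Gi) (conv_homogE fc) (conv_homogE gc).
by rewrite scalerA -expr2 sqrr_sign scale1r.
Qed.

Lemma cocycleZ n c f : is_cocycle n f -> is_cocycle n (c *: f).
Proof. by move=> fc; rewrite -[_ *: _]addr0; apply: is_cocycle_lin => //; exact: is_cocycle0. Qed.

Lemma cocycleD n f g : is_cocycle n f -> is_cocycle n g -> is_cocycle n (f + g).
Proof. by move=> fc gc; rewrite -[f]scale1r; exact: is_cocycle_lin. Qed.

Lemma coboundaryZ n c f : is_coboundary n f -> is_coboundary n (c *: f).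
Proof. by move=> fc; rewrite -[_ *: _]addr0; apply: is_coboundary_lin => //; exact: is_coboundary0. Qed.

Lemma coboundaryD n f g : is_coboundary n f -> is_coboundary n g -> is_coboundary n (f + g).
Proof. by move=> fc gc; rewrite -[f]scale1r; exact: is_coboundary_lin. Qed.

Lemma coboundaryN n f : is_coboundary n f -> is_coboundary n (- f).
Proof. by move=> fc; rewrite -scaleN1r; exact: coboundaryZ. Qed.

Lemma cocycle_cup p q f g : is_cocycle p f -> is_cocycle q g ->
  is_cocycle (p + q) (cup f g).
Proof.
move=> fc gc; have [FL Fi Fh] := homogeneous_homog fc.1.
have [GL Gi Gh] := homogeneous_homog gc.1.
rewrite (cupE fc.1 gc.1); apply: cocycleZ; apply: cocycle_conv.
  by apply: homogeneous_dot.
move=> w; rewrite (dd_dot HA w FL GL Fh (on_length_nil Gh)).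
rewrite {1}/dot (@eq_cut _ _ HA w _ (fun _ _ => 0)); last first.
  by move=> u v; rewrite (dd_homog_cocycle u fc) mul0r.
rewrite cut0 /dot (@eq_cut _ _ HA w _ (fun _ _ => 0)); last first.
  by move=> u v; rewrite (dd_homog_cocycle v gc) mulr0.
by rewrite cut0; ring.
Qed.

Lemma cup0l g : cup 0 g = 0.
Proof.
apply/funext => t; have := cupDl (-1) 0 0 g t.
by rewrite scaler0 addr0 mulN1r addNr.
Qed.

Lemma cup0r f : cup f 0 = 0.
Proof.
apply/funext => t; have := cupDr (-1) f 0 0 t.
by rewrite scaler0 addr0 mulN1r addNr.
Qed.

Lemma Hinv_mul c F : Hinv F -> Hinv (fun w => c * F w).
Proof. by move=> Fi h w; rewrite act_mulc Fi mulrCA. Qed.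

Lemma on_length_mul c n F : on_length n F -> on_length n (fun w => c * F w).
Proof. by move=> Fh w /Fh ->; rewrite mulr0. Qed.

Lemma on_length_add n F G : on_length n F -> on_length n G ->
  on_length n (fun w => F w + G w).
Proof. by move=> Fh Gh w wn; rewrite Fh // Gh // addr0. Qed.

Lemma conv_mul c F : conv (fun w => c * F w) = c *: (conv F : word -> k^o).
Proof. by apply/funext => t; exact: (lfun_mul (lfun_conv t)). Qed.

Lemma conv_add F G : conv (fun w => F w + G w) = (conv F : word -> k^o) + (conv G : word -> k^o).
Proof. by apply/funext => t; exact: (lfun_add (lfun_conv t)). Qed.

Lemma dot_mull c F G w : dot (fun u => c * F u) G w = c * dot F G w.
Proof. by rewrite /dot -cut_mulc; apply: eq_cut => u v; rewrite mulrA. Qed.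

Lemma dot_mulr c F G w : dot F (fun u => c * G u) w = c * dot F G w.
Proof. by rewrite /dot -cut_mulc; apply: eq_cut => u v; rewrite mulrCA. Qed.

Lemma dot0l F G w : (forall u, F u = 0) -> dot F G w = 0.
Proof.
by move=> F0; rewrite -(cut0 HA w); apply: eq_cut => u v; rewrite F0 mul0r.
Qed.

Lemma dot0r F G w : (forall u, G u = 0) -> dot F G w = 0.
Proof.
by move=> G0; rewrite -(cut0 HA w); apply: eq_cut => u v; rewrite G0 mulr0.
Qed.

Lemma homog_beta n f w : cochain n f ->
  homog (beta HA n f) w = (-1) ^+ n.+1 * dd (homog f) w.
Proof. by move=> fc; rewrite (dd_homog w fc) signrMK. Qed.

Lemma cochain_beta n f : cochain n f -> cochain n.+1 (beta HA n f).
Proof.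
move=> fc; have [FL Fi Fh] := homogeneous_homog fc.
suff -> : beta HA n f = (-1) ^+ n.+1 *: (conv (dd (homog f)) : word -> k^o).
  rewrite -conv_mul; apply: cochain_conv; first by apply: ML_mul; exact: ML_dd.
  apply: on_length_mul => w wn; transitivity (dd (fun=> 0) w).
    apply: eq_dd => v ev; apply: Fh; rewrite ev.
    by case: w wn {ev}.
  exact: (lfun0 (lfun_dd HA w)).
apply/funext => s; rewrite -[RHS]/((-1) ^+ n.+1 * conv (dd (homog f)) s).
by rewrite (conv_dd_beta s FL Fi Fh) (conv_homogE fc) signrMK.
Qed.

Lemma coboundary_cochain n f : is_coboundary n f -> cochain n f.
Proof.
case: n => [->|n [g gc ->]]; [exact: cochain0|exact: cochain_beta].
Qed.

Lemma coboundary_cupr p q f g : is_cocycle p f -> is_coboundary q g ->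
  is_coboundary (p + q) (cup f g).
Proof.
move=> fc gb; rewrite (cupE fc.1 (coboundary_cochain gb)); apply: coboundaryZ.
case: q gb => [->|q [g' gc ->]].
  rewrite addn0 (_ : dot (homog f) (homog 0) = fun=> 0); last first.
    apply/funext => w; apply: dot0r => u; exact: (lfun0 (lfun_homog u)).
  rewrite (_ : conv _ = 0); first exact: is_coboundary0.
  by apply/funext => t; exact: (lfun0 (lfun_conv t)).
have [FL Fi Fh] := homogeneous_homog fc.1.
have [GL Gi Gh] := homogeneous_homog gc.
apply: (@coboundary_conv _ _ (fun w => (-1) ^+ (p + q.+1) * dot (homog f) (homog g') w)).
- by apply: ML_mul; exact: ML_dot.
- by apply: Hinv_mul; exact: Hinv_dot.
- by apply: on_length_mul; rewrite addnS; exact: on_length_dot.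
- by rewrite /= mulr0.
move=> w; rewrite dd_mulc (dd_dot HA w FL GL Fh (on_length_nil Gh)).
rewrite (dot0l _ _ (F := dd (homog f))); last by move=> u; exact: (dd_homog_cocycle u fc).
transitivity (dot (homog f) (fun u => (-1) ^+ q.+1 * dd (homog g') u) w).
  by apply: eq_cut => u v; rewrite homog_beta.
rewrite dot_mulr; parity; ring.
Qed.

Lemma coboundary_cupl p q f g : is_coboundary p f -> is_cocycle q g ->
  is_coboundary (p + q) (cup f g).
Proof.
move=> fb gc; rewrite (cupE (coboundary_cochain fb) gc.1); apply: coboundaryZ.
case: p fb => [->|p [f' fc ->]].
  rewrite (_ : dot (homog 0) (homog g) = fun=> 0); last first.
    apply/funext => w; apply: dot0l => u; exact: (lfun0 (lfun_homog u)).
  rewrite (_ : conv _ = 0); first exact: is_coboundary0.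
  by apply/funext => t; exact: (lfun0 (lfun_conv t)).
have [FL Fi Fh] := homogeneous_homog fc.
have [GL Gi Gh] := homogeneous_homog gc.1.
apply: (@coboundary_conv _ _ (fun w => (-1) ^+ p * dot (homog f') (homog g) w)).
- by apply: ML_mul; exact: ML_dot.
- by apply: Hinv_mul; exact: Hinv_dot.
- by apply: on_length_mul; rewrite addSn; exact: on_length_dot.
- by rewrite /= mulr0.
move=> w; rewrite dd_mulc (dd_dot HA w FL GL Fh (on_length_nil Gh)).
rewrite (dot0r _ _ (G := dd (homog g))); last by move=> u; exact: (dd_homog_cocycle u gc).
transitivity (dot (fun u => (-1) ^+ p.+1 * dd (homog f') u) (homog g) w).
  by apply: eq_cut => u v; rewrite homog_beta.
rewrite dot_mull; parity; ring.
Qed.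

Lemma cup_commutative p q f g : is_cocycle p f -> is_cocycle q g ->
  is_coboundary (p + q) (cup f g - (-1) ^+ (p * q) *: (cup g f : word -> k^o)).
Proof.
move=> fc gc; have [FL Fi Fh] := homogeneous_homog fc.1.
have [GL Gi Gh] := homogeneous_homog gc.1.
rewrite (cupE fc.1 gc.1) (cupE gc.1 fc.1).
set Z := (X in is_coboundary _ X).
have -> : Z = (-1) ^+ (p + p.+1 * q.+1) *: (conv (fun w => dot (homog g) (homog f) w
    + (-1) ^+ (p.+1 * q.+1) * dot (homog f) (homog g) w) : word -> k^o).
  rewrite conv_add conv_mul /Z; apply/funext => t.
  set A := conv (dot (homog f) (homog g)); set B := conv (dot (homog g) (homog f)).
  rewrite -[LHS]/((-1) ^+ p * A t - (-1) ^+ (p * q) * ((-1) ^+ q * B t)).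
  rewrite -[RHS]/((-1) ^+ (p + p.+1 * q.+1) * (B t + (-1) ^+ (p.+1 * q.+1) * A t)).
  parity; ring.
apply: coboundaryZ; apply: (@coboundary_conv _ _ (Br (homog f) (homog g))).
- exact: ML_Br.
- exact: Hinv_Br.
- exact: on_length_Br.
- by [].
move=> w; rewrite (dd_Br w FL GL Fh Gh) // => v; [exact: (dd_homog_cocycle v fc)|exact: (dd_homog_cocycle v gc)].
Qed.

End CupProduct.

(** * The operator B and the bracket on cochains *)

Section BVOperator.
Variables (k : comNzRingType) (H : algType k) (HA : hopf_algebra H).
Variables (sigma sigma_inv : H).
Hypothesis sigma_grouplike : grouplike HA sigma.
Hypothesis sigma_invl : sigma_inv * sigma = 1.
Hypothesis twisted_involution :
  forall h : H, hS HA (hS HA h) = sigma * h * sigma_inv.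
Local Notation word := (seq H).
Local Notation dd := (dd HA).
Local Notation dot := (dot HA).
Local Notation BD := (BD HA sigma).
Local Notation Br := (Br HA).
Local Notation Kp := (Kp HA sigma).
Local Notation BB := (BB HA sigma).
Local Notation Br2 := (Br2 HA).
Local Notation conv := (conv HA).
Local Notation homog := (homog HA).
Local Notation cochain := (@cochain k H).
Local Notation is_cocycle := (is_cocycle HA).
Local Notation is_coboundary := (is_coboundary HA).
Implicit Types (F G X : word -> k) (f g : word -> k^o) (w s t : word).

Local Notation homogeneous := (homogeneous HA).
Local Notation homogeneous_homog := (homogeneous_homog HA).

Lemma cuts_length N r (Psi : seq word -> k) w :
  (forall l, size l = r.+1 -> sumn (map size l) != N -> Psi l = 0) ->
  (size w + r)%N != N -> cuts HA r Psi w = 0.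
Proof.
move=> e wN; rewrite -(cuts0 HA r w); apply: eq_cuts_size => l ls ln.
by apply: e => //; rewrite ln.
Qed.

(** The operator B on cochains. The sign is the one required by the BV identity. *)
Definition bop f : word -> k^o := - (conv (BD (homog f)) : word -> k^o).

Lemma lfun_BD w : lfun (fun F => BD F w).
Proof.
move=> c F G; rewrite /BD -cut_mulc -cut_add; apply: eq_cut => u v.
by rewrite /turn; ring.
Qed.

Lemma bop_lin c f g : bop (c *: f + g) = c *: bop f + bop g.
Proof.
apply/funext => t; rewrite /bop.
rewrite -[LHS]/(- conv (BD (homog (fun w => c * f w + g w))) t).
rewrite -[RHS]/(c * - conv (BD (homog f)) t + - conv (BD (homog g)) t).
have -> : homog (fun w => c * f w + g w) = fun w => c * homog f w + homog g w.
  by apply/funext => w; exact: lfun_homog.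
have -> : BD (fun w => c * homog f w + homog g w) =
   fun w => c * BD (homog f) w + BD (homog g) w.
  by apply/funext => w; exact: lfun_BD.
by rewrite (lfun_conv HA t); ring.
Qed.

Lemma bop0 : bop 0 = 0.
Proof.
have := bop_lin (-1) 0 0; rewrite scaler0 addr0 scaleN1r => ->.
by rewrite addNr.
Qed.

Lemma bopN f : bop (- f) = - bop f.
Proof. by have := bop_lin (-1) f 0; rewrite bop0 !addr0 !scaleN1r. Qed.

Lemma bopD f g : bop (f + g) = bop f + bop g.
Proof. by have := bop_lin 1 f g; rewrite !scale1r. Qed.

Lemma bopZ c f : bop (c *: f) = c *: bop f.
Proof. by have := bop_lin c f 0; rewrite bop0 !addr0. Qed.

Lemma homogeneous_BD n F : homogeneous n F -> homogeneous n.-1 (BD F).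
Proof.
move=> [FL Fi Fh]; split; first exact: ML_BD.
  exact: (Hinv_BD sigma_grouplike sigma_invl twisted_involution FL Fi).
case: n Fh => [|n] Fh; last exact: on_length_BD.
by move=> w _; exact: BD_deg0.
Qed.

Lemma bop_deg0 f : cochain 0 f -> bop f = 0.
Proof.
move=> fc; have [_ _ Fh] := homogeneous_homog fc.
apply/funext => t; rewrite /bop -[LHS]/(- conv (BD (homog f)) t).
have -> : BD (homog f) = fun=> 0 by apply/funext => w; exact: BD_deg0.
by rewrite (lfun0 (lfun_conv HA t)) oppr0.
Qed.

Lemma homog_bop n f : cochain n f -> homog (bop f) = fun w => - BD (homog f) w.
Proof.
move=> fc; have Fb := homogeneous_BD (homogeneous_homog fc).
apply/funext => w; transitivity (- homog (conv (BD (homog f))) w).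
  exact: (lfun_opp (lfun_homog HA w) (conv (BD (homog f)))).
by rewrite (homog_convE Fb).
Qed.

Lemma cochain_bop n f : cochain n f -> cochain n.-1 (bop f).
Proof.
move=> fc; have [BL _ Bh] := homogeneous_BD (homogeneous_homog fc).
have := cochain_lin (-1) (cochain_conv HA BL Bh) (cochain0 H n.-1).
by rewrite addr0 scaleN1r.
Qed.

Lemma BD_closed n f w : is_cocycle n f -> dd (BD (homog f)) w = 0.
Proof.
move=> fc; have [FL Fi Fh] := homogeneous_homog fc.1.
rewrite (dd_BD sigma_grouplike) // (_ : dd (homog f) = fun=> 0).
  by rewrite (lfun0 (lfun_BD w)) oppr0.
by apply/funext => u; exact: (dd_homog_cocycle u fc).
Qed.

Lemma cocycle_bop n f : is_cocycle n f -> is_cocycle n.-1 (bop f).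
Proof.
move=> fc; rewrite /bop -scaleN1r; apply: cocycleZ; apply: cocycle_conv.
  exact/homogeneous_BD/homogeneous_homog/fc.1.
by move=> w; exact: BD_closed fc.
Qed.

Lemma coboundary_bop n f : is_coboundary n f -> is_coboundary n.-1 (bop f).
Proof.
case: n => [->|n [g gc ->]]; first by rewrite bop0; exact: is_coboundary0.
have [GL Gi Gh] := homogeneous_homog gc.
rewrite /bop -scaleN1r -conv_mul.
apply: (@coboundary_conv _ _ _ _ _ (fun w => (-1) ^+ n.+1 * BD (homog g) w)).
- by apply: ML_mul; exact: ML_BD.
- apply: Hinv_mul; exact: (Hinv_BD sigma_grouplike sigma_invl twisted_involution GL Gi).
- by apply: on_length_mul; exact: on_length_BD.
- by rewrite /= mulr0.
move=> w; rewrite dd_mulc (dd_BD sigma_grouplike) //.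
have -> : homog (beta HA n g) = fun u => (-1) ^+ n.+1 * dd (homog g) u.
  by apply/funext => u; exact: homog_beta.
by rewrite (lfun_mul (lfun_BD w)); ring.
Qed.

Lemma coboundary_bop_bop n f : is_cocycle n f -> is_coboundary n.-1.-1 (bop (bop f)).
Proof.
move=> fc; have [FL Fi Fh] := homogeneous_homog fc.1.
rewrite {1}/bop (homog_bop fc.1) -scaleN1r -conv_mul.
apply: (@coboundary_conv _ _ _ _ _ (BB (homog f))).
- exact: ML_BB.
- exact: (Hinv_BB sigma_grouplike sigma_invl twisted_involution FL Fi).
- move=> w wn; rewrite /BB /rotl4 /rotr4.
  have wN : (size w + 3 != n.+1)%N by move: wn; lia.
  rewrite (cuts_length (N := n.+1)) ?(cuts_length (N := n.+1)) ?addr0 //;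
    case=> [|a [|b [|c [|e [|? ?]]]]] //= _ N;
    by rewrite /signed /= Fh ?mulr0 // !size_cat !size_sh; move: N; lia.
- by rewrite /BB /= addr0.
move=> w; rewrite (dd_BB sigma_grouplike w FL Fi); last by move=> v; exact: (dd_homog_cocycle v fc).
have := lfun_opp (lfun_BD w) (BD (homog f)) => /= ->; ring.
Qed.

Lemma sum_apply I (r : seq I) (P : pred I) (F : I -> word -> k^o) s :
  (\sum_(i <- r | P i) F i) s = \sum_(i <- r | P i) F i s.
Proof. exact: (big_morph (fun f : word -> k^o => f s : k^o)). Qed.

Lemma cochain_braceE p q f g : cochain p f -> cochain q g ->
  cochain_brace HA p q f g =
  (-1) ^+ (p.+1 * q.+1) *: (conv (Br (homog f) (homog g)) : word -> k^o).
Proof.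
move=> fc gc; have [FL Fi Fh] := homogeneous_homog fc.
have [GL Gi Gh] := homogeneous_homog gc.
have [_ f0] := (cochainP _ _).1 fc.
apply/funext => s; rewrite /cochain_brace sum_apply.
rewrite -[RHS]/((-1) ^+ (p.+1 * q.+1) * conv (Br (homog f) (homog g)) s).
have L (c : k) (X : word -> k^o) : (c *: X) s = c * X s by [].
have [sn|sn] := eqVneq (size s).+1 (p + q)%N; last first.
  rewrite [X in _ = _ * X](_ : _ = 0); last first.
    rewrite -(cv0 HA 1 s); apply: eq_cv_size => v vs.
    by apply: (on_length_Br HA Fh Gh); rewrite vs.
  rewrite mulr0 big_nat big1 // => i /andP [i1 ip]; rewrite L /operad_comp.
  case: eqP => [e|_]; last by rewrite andbF mulr0.
  by move: sn; rewrite e; move: i1 ip; case: (p + q)%N (leq_addr q p) => [|n] //; lia.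
case: p fc FL Fi Fh f0 sn => [|p] fc FL Fi Fh f0 sn.
  rewrite big_geq // (conv_Br s FL GL Gi Fh Gh) big1 ?mulr0 // => i _.
  rewrite (conv_homogE HA fc) f0 ?mulr0 // size_cat /=; lia.
rewrite big_add1 /= big_mkord (conv_Br s FL GL Gi Fh Gh).
have sz : size s = (p + q)%N by move: sn; rewrite addSn => -[].
rewrite sz (conv_homogE HA fc) (conv_homogE HA gc).
rewrite (eq_bigl (fun i : 'I_(p + q).+1 => i < p.+1)%N); last by move=> i; rewrite addnC; lia.
have pq : (p.+1 <= (p + q).+1)%N by lia.
rewrite -(big_ord_widen _ (fun i => (-1) ^+ (i * q.+1) * f (take i s ++
   operad_insert HA g (take q (drop i s)) :: drop (i + q) s)) pq).
rewrite (reindex_inj rev_ord_inj) mulr_sumr; apply: eq_bigr => i _ /=.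
have ip := ltn_ord i; rewrite L /operad_comp sz /=.
have -> : ((0 < (p.+1 - i.+1).+1 <= p.+1) && (p + q == (p.+1 + q).-1))%N by lia.
rewrite subSS.
have -> : (p.+1 - (p - i).+1 = i)%N by lia.
rewrite mulrA; congr (_ * _).
have e : odd (p - i) = odd p (+) odd i by rewrite oddB.
rewrite !expr_parity !oddM e /=; case: (odd p); case: (odd i); case: (odd q) => /=; ring.
Qed.

(** The homogeneous form of the operadic bracket of two cochains of degrees p and q. *)
Definition bracket_form F G p q w : k :=
  (-1) ^+ (p.+1 * q.+1) * Br F G w - Br G F w.

Lemma cochain_bracketE p q f g : cochain p f -> cochain q g ->
  cochain_bracket HA p q f g =
  (conv (bracket_form (homog f) (homog g) p q) : word -> k^o).
Proof.
move=> fc gc; rewrite /cochain_bracket !cochain_braceE //.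
apply/funext => t.
transitivity ((-1) ^+ (p.+1 * q.+1) * conv (Br (homog f) (homog g)) t -
  (-1) ^+ (p.+1 * q.+1) * ((-1) ^+ (q.+1 * p.+1) * conv (Br (homog g) (homog f)) t)) => //.
rewrite [(q.+1 * p.+1)%N]mulnC signrMK -(lfun_mul (lfun_conv HA t)).
by rewrite -(lfun_sub (lfun_conv HA t)).
Qed.

Lemma cochain_bracket_anti p q f g :
  cochain_bracket HA p q f g = - ((-1) ^+ (p.+1 * q.+1) *: cochain_bracket HA q p g f).
Proof.
rewrite /cochain_bracket scalerBr scalerA opprB [(q.+1 * p.+1)%N]mulnC.
by rewrite -expr2 sqrr_sign scale1r.
Qed.

(** The bracket derived from the operator B and the cup product. *)
Definition bracket_BV p f g : word -> k^o :=
  (-1) ^+ p *: (bop (cup f g) - (cup (bop f) g : word -> k^o)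
     - (-1) ^+ p *: (cup f (bop g) : word -> k^o)).

Lemma on_length_Kp p q F G : on_length p.+1 F -> on_length q.+1 G ->
  on_length (p + q).-1 (Kp F G).
Proof.
move=> Fh Gh w wn; apply: (cuts_length (N := (p + q).+2)); last by move: wn; lia.
case=> [|a [|b [|c [|e [|? ?]]]]] //= _ N; rewrite /signed /=.
have [eb|/Gh ->] := eqVneq (size b) q.+1; last by rewrite !mulr0.
by rewrite Fh ?mul0r ?mulr0 // !size_cat !size_sh; move: N; rewrite eb; lia.
Qed.

(** The BV identity: the two brackets agree on cohomology. *)
Lemma bracket_BV_coboundary p q f g : is_cocycle p f -> is_cocycle q g ->
  is_coboundary (p + q).-1 (cochain_bracket HA p q f g - bracket_BV p f g).
Proof.
move=> fc gc; have Fh := homogeneous_homog fc.1; have Gh := homogeneous_homog gc.1.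
set F := homog f in Fh *; set G := homog g in Gh *.
have [FL Fi Fl] := Fh; have [GL Gi Gl] := Gh.
have [BFL BFi BFl] := homogeneous_BD Fh; have [BGL BGi BGl] := homogeneous_BD Gh.
have F0 w : dd F w = 0 by exact: (dd_homog_cocycle w fc).
have G0 w : dd G w = 0 by exact: (dd_homog_cocycle w gc).
pose Z w := bracket_form F G p q w + BD (dot F G) w + dot (BD F) G w
   + (-1) ^+ p.+1 * dot F (BD G) w.
pose K w := (-1) ^+ (p.+1 * q.+1) * Kp G F w
   + ((-1) * Kp F G w + (-1) ^+ (p * q.+1) * Br (BD F) G w).
have ZK w : Z w = dd K w.
  rewrite /K !dd_add !dd_mulc (dd_Kp sigma_grouplike w FL GL Fi Fl Gl F0 G0).
  rewrite (dd_Kp sigma_grouplike w GL FL Gi Gl Fl G0 F0).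
  rewrite (dd_Br w BFL GL BFl Gl (fun v => BD_closed v fc) G0).
  rewrite /Z /bracket_form (BD_dot sigma_grouplike w FL GL Gi Fl Gl).
  (* For p = 0 the sign of degree p - 1 is lost by truncation, but BD F vanishes. *)
  case: (p) Fl fc => [|p'] Fl fc /=; last by parity; ring.
  have BF0 u : BD F u = 0 by apply: BD_deg0.
  rewrite !(dot0l HA _ _ BF0) !(dot0r HA _ _ BF0); parity; ring.
have -> : cochain_bracket HA p q f g - bracket_BV p f g = (conv Z : word -> k^o).
  apply/funext => t; rewrite (cochain_bracketE fc.1 gc.1) -/F -/G.
  pose Y : word -> k := fun t => conv (bracket_form F G p q) t
     - (-1) ^+ p * (bop (cup f g) t - cup (bop f) g t - (-1) ^+ p * cup f (bop g) t).
  transitivity (Y t); first by [].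
  rewrite {}/Y.
  have -> : conv Z t = conv (bracket_form F G p q) t + conv (BD (dot F G)) t
      + conv (dot (BD F) G) t + (-1) ^+ p.+1 * conv (dot F (BD G)) t.
    by rewrite -(lfun_mul (lfun_conv HA t)) -!(lfun_add (lfun_conv HA t)).
  have e1 : bop (cup f g) t = - ((-1) ^+ p * conv (BD (dot F G)) t).
    rewrite (cupE HA fc.1 gc.1) bopZ.
    rewrite -[LHS]/((-1) ^+ p * (- conv (BD (homog (conv (dot F G)))) t)).
    by rewrite (homog_convE (homogeneous_dot Fh Gh)); ring.
  have e2 : cup (bop f) g t = (-1) ^+ p * conv (dot (BD F) G) t.
    rewrite (cupE HA (cochain_bop fc.1) gc.1) (homog_bop fc.1) -/F -/G.
    rewrite -[LHS]/((-1) ^+ p.-1 * conv (dot (fun w => - BD F w) G) t).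
    have -> : dot (fun w => - BD F w) G = fun w => -1 * dot (BD F) G w.
      apply/funext => w; rewrite -dot_mull; apply: eq_cut => u v; ring.
    rewrite (lfun_mul (lfun_conv HA t)).
    case: (p) Fl => [|p'] Fl /=; last by rewrite exprS; ring.
    have -> : dot (BD F) G = fun=> 0.
      by apply/funext => w; apply: dot0l => u; exact: BD_deg0.
    by rewrite (lfun0 (lfun_conv HA t)) !mulr0.
  have e3 : cup f (bop g) t = - ((-1) ^+ p * conv (dot F (BD G)) t).
    rewrite (cupE HA fc.1 (cochain_bop gc.1)) (homog_bop gc.1) -/F -/G.
    rewrite -[LHS]/((-1) ^+ p * conv (dot F (fun w => - BD G w)) t).
    have -> : dot F (fun w => - BD G w) = fun w => -1 * dot F (BD G) w.
      apply/funext => w; rewrite -dot_mulr; apply: eq_cut => u v; ring.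
    rewrite (lfun_mul (lfun_conv HA t)); ring.
  by rewrite e1 e2 e3; parity; ring.
apply: (@coboundary_conv _ _ _ _ _ K) => //.
- by apply: ML_add; [apply: ML_mul; exact: ML_Kp|apply: ML_add; apply: ML_mul;
    [exact: ML_Kp|exact: ML_Br]].
- have HK := Hinv_Kp sigma_grouplike sigma_invl twisted_involution.
  by apply: Hinv_add; [apply: Hinv_mul; exact: HK|apply: Hinv_add; apply: Hinv_mul;
    [exact: HK|exact: Hinv_Br]].
- apply: on_length_add; first by apply: on_length_mul; rewrite addnC; exact: on_length_Kp.
  apply: on_length_add; apply: on_length_mul; first exact: on_length_Kp.
  case: (p) Fl BFl => [|p'] Fl BFl; last exact: on_length_Br.
  move=> w _; transitivity (cuts HA 2 (fun=> 0) w); last exact: cuts0.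
  apply: eq_cuts => -[|a [|b [|c [|? ?]]]] //= _.
  by rewrite /signed /= BD_deg0 // mul0r mulr0.
by rewrite /K /Kp /Br /=; ring.
Qed.

Lemma cocycle_bracket_BV p q f g : is_cocycle p f -> is_cocycle q g ->
  is_cocycle (p + q).-1 (bracket_BV p f g).
Proof.
move=> fc gc; rewrite /bracket_BV; apply: cocycleZ.
rewrite -addrA -opprD -scaleN1r; apply: cocycleD.
  exact/cocycle_bop/cocycle_cup.
apply: cocycleZ; apply: cocycleD.
  case: p fc => [|p] fc; last exact: (cocycle_cup (cocycle_bop fc) gc).
  by rewrite (bop_deg0 fc.1) cup0l; exact: is_cocycle0.
apply: cocycleZ; case: q gc => [|q] gc; last first.
  by rewrite addnS; exact: (cocycle_cup fc (cocycle_bop gc)).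
by rewrite (bop_deg0 gc.1) cup0r; exact: is_cocycle0.
Qed.

Lemma coboundary_cocycle n f : is_coboundary n f -> is_cocycle n f.
Proof.
move=> fb; split; first exact: coboundary_cochain fb.
case: n fb => [->|n [g gc ->]]; first exact: beta0.
have gc' := cochain_beta HA gc.
have [FL Fi Fh] := homogeneous_homog gc'.
apply/funext => s; have := conv_dd_beta s FL Fi Fh.
rewrite (conv_homogE HA gc') => e.
have e0 : conv (dd (homog (beta HA n g))) s = 0.
  have -> : dd (homog (beta HA n g)) = fun=> 0.
    apply/funext => w; have -> : homog (beta HA n g) = fun w => (-1) ^+ n.+1 * dd (homog g) w.
      by apply/funext => u; exact: homog_beta.
    by rewrite dd_mulc dd_dd mulr0.
  exact: (lfun0 (lfun_conv HA s)).
by have := signrMK n.+2 (beta HA n.+1 (beta HA n g) s : k); rewrite -e e0 mulr0 => <-.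
Qed.

Lemma cocycle_cochain_bracket p q f g : is_cocycle p f -> is_cocycle q g ->
  is_cocycle (p + q).-1 (cochain_bracket HA p q f g).
Proof.
move=> fc gc; rewrite -[cochain_bracket _ _ _ _ _](subrK (bracket_BV p f g)).
apply: cocycleD; last exact: cocycle_bracket_BV.
exact/coboundary_cocycle/bracket_BV_coboundary.
Qed.

(** * The Leibniz rule *)

Lemma Br_mull c F G w : Br (fun u => c * F u) G w = c * Br F G w.
Proof.
rewrite -cuts_mulc; apply: eq_cuts => -[|a [|b [|e [|? ?]]]] //= _.
by rewrite /signed /=; ring.
Qed.

Lemma Br_mulr c F G w : Br F (fun u => c * G u) w = c * Br F G w.
Proof.
rewrite -cuts_mulc; apply: eq_cuts => -[|a [|b [|e [|? ?]]]] //= _.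
by rewrite /signed /=; ring.
Qed.

Lemma cochain_bracket00 f g : cochain_bracket HA 0 0 f g = 0.
Proof. by rewrite /cochain_bracket /cochain_brace !big_geq // scaler0 subr0. Qed.

Lemma Br_zero p q F G w : on_length p.+1 F -> on_length q.+1 G ->
  (size w != p + q)%N || (p + q == 0)%N -> Br F G w = 0.
Proof.
move=> Fl Gl; have BG := on_length_Br HA Fl Gl.
have [wn|//] := eqVneq (size w) (p + q)%N; last by move=> *; exact: BG.
by move=> /= /eqP pq; case: w wn => //; rewrite pq.
Qed.

Lemma homog_bracket p q f g : is_cocycle p f -> is_cocycle q g ->
  homog (cochain_bracket HA p q f g) = bracket_form (homog f) (homog g) p q.
Proof.
move=> fc gc; rewrite (cochain_bracketE fc.1 gc.1).
have [FL Fi Fl] := homogeneous_homog fc.1; have [GL Gi Gl] := homogeneous_homog gc.1.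
apply: (homog_convE (n := (p + q).-1)); split.
- by apply: ML_add; [apply: ML_mul|apply: ML_opp]; exact: ML_Br.
- move=> h w; rewrite /bracket_form act_sub act_mulc.
  rewrite (Hinv_Br FL GL Fi Gi) (Hinv_Br GL FL Gi Fi); ring.
move=> w wn; rewrite /bracket_form (Br_zero Fl Gl) ?(Br_zero Gl Fl).
- by ring.
- by rewrite addnC; move: wn; case: (p + q)%N => [|n] /=; rewrite ?orbT ?orbF.
by move: wn; case: (p + q)%N => [|n] /=; rewrite ?orbT ?orbF.
Qed.

(** The Leibniz rule holds for the operadic bracket up to the coboundary given by
the simultaneous insertion [Br2]. *)
Lemma Leibniz_coboundary p q r f g h :
  is_cocycle p f -> is_cocycle q g -> is_cocycle r h ->
  is_coboundary (p + (q + r)).-1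
    (cochain_bracket HA p (q + r) f (cup g h)
     - (cup (cochain_bracket HA p q f g) h : word -> k^o)
     - (-1) ^+ (p.+1 * q) *: (cup g (cochain_bracket HA p r f h) : word -> k^o)).
Proof.
move=> fc gc hc.
have Fh := homogeneous_homog fc.1; have Gh := homogeneous_homog gc.1.
have Xh := homogeneous_homog hc.1.
set F := homog f in Fh *; set G := homog g in Gh *; set X := homog h in Xh *.
have [FL Fi Fl] := Fh; have [GL Gi Gl] := Gh; have [XL Xi Xl] := Xh.
have F0 w : dd F w = 0 by exact: (dd_homog_cocycle w fc).
have G0 w : dd G w = 0 by exact: (dd_homog_cocycle w gc).
have X0 w : dd X w = 0 by exact: (dd_homog_cocycle w hc).
pose K w := (-1) ^+ (q + p.+1 * (q + r).+1).+1 * Br2 F G X w.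
pose Z w := (-1) ^+ q * bracket_form F (dot G X) p (q + r) w
  - (-1) ^+ (p + q).+1 * dot (bracket_form F G p q) X w
  - (-1) ^+ (p.+1 * q + q) * dot G (bracket_form F X p r) w.
have ZK w : Z w = dd K w.
  rewrite /K dd_mulc (dd_Br2 w FL GL XL Fl Gl Xl F0 G0 X0) /Z /bracket_form.
  rewrite (Br_dot HA w FL GL XL Fl Gl).
  have -> : dot (fun w => (-1) ^+ (p.+1 * q.+1) * Br F G w - Br G F w) X w =
     (-1) ^+ (p.+1 * q.+1) * dot (Br F G) X w - dot (Br G F) X w.
    by rewrite -dot_mull -cut_sub; apply: eq_cut => u v; ring.
  have -> : dot G (fun w => (-1) ^+ (p.+1 * r.+1) * Br F X w - Br X F w) w =
     (-1) ^+ (p.+1 * r.+1) * dot G (Br F X) w - dot G (Br X F) w.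
    by rewrite -dot_mulr -cut_sub; apply: eq_cut => u v; ring.
  by parity; ring.
have e1 : cochain_bracket HA p (q + r) f (cup g h) =
   (-1) ^+ q *: (conv (bracket_form F (dot G X) p (q + r)) : word -> k^o).
  have gh := cocycle_cup gc hc.
  rewrite (cochain_bracketE fc.1 gh.1) -conv_mul; congr (conv _).
  have -> : homog (cup g h) = fun w => (-1) ^+ q * dot G X w.
    rewrite (cupE HA gc.1 hc.1) -/G -/X -conv_mul.
    apply: (homog_convE (n := (q + r)%N)).
    have [DL Di Dl] := homogeneous_dot Gh Xh.
    by split; [exact: ML_mul|exact: Hinv_mul|exact: on_length_mul].
  by apply/funext => w; rewrite /bracket_form Br_mulr Br_mull; ring.
have e2 : cup (cochain_bracket HA p q f g) h =
   (-1) ^+ (p + q).+1 *: (conv (dot (bracket_form F G p q) X) : word -> k^o).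
  have [pq|pq] := posnP (p + q)%N.
    have [p0 q0] : p = 0%N /\ q = 0%N by lia.
    rewrite [cochain_bracket _ _ _ _ _](_ : _ = 0); last by rewrite p0 q0 cochain_bracket00.
    rewrite cup0l (_ : dot _ X = fun=> 0).
      by rewrite (_ : conv _ = 0) ?scaler0 //; apply/funext => t; exact: (lfun0 (lfun_conv HA t)).
    apply/funext => w; apply: dot0l => u.
    by rewrite /bracket_form (Br_zero Fl Gl) ?(Br_zero Gl Fl) ?pq ?[(q + p)%N]addnC ?pq ?orbT //; ring.
  rewrite (cupE HA (cocycle_cochain_bracket fc gc).1 hc.1) (homog_bracket fc gc) -/F -/G -/X.
  have -> // : (-1) ^+ (p + q).-1 = (-1) ^+ (p + q).+1 :> k.
  by move: pq; case: (p + q)%N => // n _; rewrite !exprS; ring.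
have e3 : cup g (cochain_bracket HA p r f h) =
   (-1) ^+ q *: (conv (dot G (bracket_form F X p r)) : word -> k^o).
  by rewrite (cupE HA gc.1 (cocycle_cochain_bracket fc hc).1) (homog_bracket fc hc).
rewrite e1 e2 e3.
set W := (X in is_coboundary _ X); have -> : W = (conv Z : word -> k^o).
  rewrite /W; apply/funext => t.
  have -> : conv Z t = (-1) ^+ q * conv (bracket_form F (dot G X) p (q + r)) t
     - (-1) ^+ (p + q).+1 * conv (dot (bracket_form F G p q) X) t
     - (-1) ^+ (p.+1 * q + q) * conv (dot G (bracket_form F X p r)) t.
    by rewrite -!(lfun_mul (lfun_conv HA t)) -!(lfun_sub (lfun_conv HA t)).
  rewrite exprD -[in RHS]mulrA; by [].
apply: (@coboundary_conv _ _ _ _ _ K) => //.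
- by apply: ML_mul; exact: ML_Br2.
- by apply: Hinv_mul; exact: Hinv_Br2.
- apply: on_length_mul => w wn.
  apply: (cuts_length (N := (p + q + r).+3)); last by move: wn; lia.
  case=> [|a [|b [|c [|e [|x [|? ?]]]]]] //= _ N; rewrite /signed /=.
  have [eb|/Gl ->] := eqVneq (size b) q.+1; last by rewrite !(mulr0, mul0r).
  have [ee|/Xl ->] := eqVneq (size e) r.+1; last by rewrite !(mulr0, mul0r).
  by rewrite Fl ?mul0r ?mulr0 // !size_cat; move: N; rewrite eb ee; lia.
by rewrite /K /Br2 /=; ring.
Qed.

End BVOperator.

(** * The Jacobi identity from the Leibniz rule *)

Section JacobiFromLeibniz.
Variables (k : comNzRingType) (T : Type).
Local Notation W := (T -> k^o).
Variables (B : W -> W) (C : W -> W -> W).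
Hypothesis B_lin : forall c f g, B (c *: f + g) = c *: B f + B g.
Hypothesis C_linl : forall c f g h, C (c *: f + g) h = c *: C f h + C g h.
Hypothesis C_linr : forall c f g h, C h (c *: f + g) = c *: C h f + C h g.
Hypothesis CA : forall f g h, C f (C g h) = C (C f g) h.

(** The bracket derived from an operator B and a product C, for a of degree p. *)
Definition bv_bracket p (a x : W) : W :=
  (-1) ^+ p *: (B (C a x) - C (B a) x - (-1) ^+ p *: C a (B x)).

(** The defect of the Leibniz rule. *)
Definition bv_leibniz p q (a b c : W) : W :=
  bv_bracket p a (C b c) - C (bv_bracket p a b) c
  - (-1) ^+ (p.+1 * q) *: C b (bv_bracket p a c).

(** The defect of the derivation rule for the square of B. *)
Definition bv_square p (a x : W) : W :=
  (-1) ^+ p *: (B (B (C a x)) - C (B (B a)) x - C a (B (B x))).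

(** The defect of the Jacobi identity. The bracket of a and b has degree p + q - 1,
which has the parity of p + q + 1. *)
Definition bv_jacobi p q (a b c : W) : W :=
  bv_bracket p a (bv_bracket q b c) - bv_bracket (p + q).+1 (bv_bracket p a b) c
  - (-1) ^+ (p.+1 * q.+1) *: bv_bracket q b (bv_bracket p a c).

(** The defect of the Jacobi identity is a combination of defects of the Leibniz rule
and of B^2 = 0, as an identity of functions. *)
Lemma bv_jacobiE p q a b c : bv_jacobi p q a b c =
  (-1) ^+ (p + q) *: (bv_leibniz p.+1 q (B a) b c - B (bv_leibniz p q a b c)
    + (bv_square p a (C b c) - C (bv_square p a b) c
       - (-1) ^+ (p * q) *: C b (bv_square p a c)))
  - ((-1) ^+ q *: bv_leibniz p q.+1 a (B b) c + bv_leibniz p q a b (B c)).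
Proof.
have BD f g : B (f + g) = B f + B g by rewrite -[f]scale1r B_lin !scale1r.
have B0 : B 0 = 0 by have := B_lin (-1) 0 0; rewrite scaler0 addr0 scaleN1r addNr.
have BZ x f : B (x *: f) = x *: B f by rewrite -[x *: f]addr0 B_lin B0 addr0.
have BN f : B (- f) = - B f by rewrite -scaleN1r BZ scaleN1r.
have CDl f g h : C (f + g) h = C f h + C g h by rewrite -[f]scale1r C_linl !scale1r.
have C0l h : C 0 h = 0 by have := C_linl (-1) 0 0 h; rewrite scaler0 addr0 scaleN1r addNr.
have CZl x f h : C (x *: f) h = x *: C f h by rewrite -[x *: f]addr0 C_linl C0l addr0.
have CNl f h : C (- f) h = - C f h by rewrite -scaleN1r CZl scaleN1r.
have CDr f g h : C h (f + g) = C h f + C h g by rewrite -[f]scale1r C_linr !scale1r.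
have C0r h : C h 0 = 0 by have := C_linr (-1) 0 0 h; rewrite scaler0 addr0 scaleN1r addNr.
have CZr x f h : C h (x *: f) = x *: C h f by rewrite -[x *: f]addr0 C_linr C0r addr0.
have CNr f h : C h (- f) = - C h f by rewrite -scaleN1r CZr scaleN1r.
have pD (f g : W) t : (f + g) t = f t + g t by [].
have pN (f : W) t : (- f) t = - f t by [].
have pZ x (f : W) t : (x *: f) t = x * f t by [].
apply/funext => t; rewrite /bv_jacobi /bv_leibniz /bv_square /bv_bracket.
rewrite !(BD, BZ, BN, CDl, CDr, CZl, CZr, CNl, CNr, CA).
rewrite !(pD, pN, pZ); parity; ring.
Qed.
End JacobiFromLeibniz.

Section Classes.
Variables (k : comNzRingType) (H : algType k) (HA : hopf_algebra H).
Variables (sigma sigma_inv : H).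
Hypothesis sigma_grouplike : grouplike HA sigma.
Hypothesis sigma_invl : sigma_inv * sigma = 1.
Hypothesis twisted_involution :
  forall h : H, hS HA (hS HA h) = sigma * h * sigma_inv.
Local Notation word := (seq H).
Local Notation is_cocycle := (is_cocycle HA).
Local Notation is_coboundary := (is_coboundary HA).
Local Notation V := (cohomology HA).
Local Notation cls := (coh_class HA).
Local Notation bop := (bop HA sigma).
Local Notation bracket_BV := (bracket_BV HA sigma).
Local Notation cup := (@cup k H).
Implicit Types (f g h : word -> k^o) (s t : word).

(** * Transport along equalities of degrees *)

Lemma recast_id (W : nat -> lmodType k) n (x : W n) : recast W n x = x.
Proof. by rewrite /recast; case: eqP => // e; rewrite (eq_axiomK e). Qed.

Lemma recast_neq (W : nat -> lmodType k) m n (x : W m) : m != n -> recast W n x = 0.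
Proof. by rewrite /recast; case: eqP. Qed.

Lemma recast_lin (W : nat -> lmodType k) m n : linear (@recast k W n m).
Proof.
move=> c x y; have [e|ne] := eqVneq m n; last by rewrite !recast_neq // scaler0 addr0.
by subst n; rewrite !recast_id.
Qed.

Lemma recast0 (W : nat -> lmodType k) m n : recast W n (0 : W m) = 0.
Proof. by have := @recast_lin W m n (-1) 0 0; rewrite scaler0 addr0 scaleN1r addNr. Qed.

Lemma cls_lin n c f g : is_cocycle n f -> is_cocycle n g ->
  cls n (c *: f + g) = c *: cls n f + cls n g.
Proof. by move=> fc gc; apply: sq_class_lin. Qed.

Lemma cocycleN n f : is_cocycle n f -> is_cocycle n (- f).
Proof. by move=> fc; have := cocycleZ (-1) fc; rewrite scaleN1r. Qed.

Lemma cls0 n : cls n 0 = 0.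
Proof.
have := @cls_lin n (-1) 0 0 (is_cocycle0 HA n) (is_cocycle0 HA n).
by rewrite scaler0 addr0 scaleN1r addNr.
Qed.

Lemma clsZ n c f : is_cocycle n f -> cls n (c *: f) = c *: cls n f.
Proof. by move=> fc; rewrite -[c *: f]addr0 cls_lin ?cls0 ?addr0 //; exact: is_cocycle0. Qed.

Lemma clsD n f g : is_cocycle n f -> is_cocycle n g -> cls n (f + g) = cls n f + cls n g.
Proof. by move=> fc gc; have := cls_lin 1 fc gc; rewrite !scale1r. Qed.

Lemma clsN n f : is_cocycle n f -> cls n (- f) = - cls n f.
Proof. by move=> fc; have := clsZ (-1) fc; rewrite !scaleN1r. Qed.

Lemma cls_eq n f g : is_cocycle n f -> is_cocycle n g ->
  cls n f = cls n g <-> is_coboundary n (f - g).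
Proof.
move=> fc gc; have fg : is_cocycle n (f - g) by apply: cocycleD => //; exact: cocycleN.
rewrite -[is_coboundary n _]/(coboundaries HA n (f - g)) -(@sq_class_eq0 _ _ (cocycles HA n) (coboundaries HA n) _ fg) -/(cls n (f - g)).
have -> : cls n (f - g) = cls n f - cls n g.
  by rewrite clsD ?clsN //; exact: cocycleN.
by split=> [->|/subr0_eq]; rewrite ?subrr.
Qed.

Lemma cls_surj n (x : V n) : exists f, is_cocycle n f /\ x = cls n f.
Proof. by move: x; apply: sq_class_ind => f fc; exists f. Qed.

(** A chosen cocycle in a cohomology class. *)
Definition rep n (x : V n) : word -> k^o := projT1 (cid (cls_surj x)).

Lemma rep_cocycle n (x : V n) : is_cocycle n (rep x).
Proof. exact: (projT2 (cid (cls_surj x))).1. Qed.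

Lemma repK n (x : V n) : cls n (rep x) = x.
Proof. exact/esym/(projT2 (cid (cls_surj x))).2. Qed.

Lemma rep_cls n f : is_cocycle n f -> is_coboundary n (rep (cls n f) - f).
Proof. by move=> fc; apply/(cls_eq (rep_cocycle _) fc); exact: repK. Qed.

(** A class whose degree is distorted by truncated subtraction is the class of 0. *)
Lemma recast_cls m n f : m = n \/ f = 0 -> recast V n (cls m f) = cls n f.
Proof. by case=> [->|->]; rewrite ?recast_id // !cls0 recast0. Qed.

(** * The operations on cohomology *)

(** The operator B on cohomology. *)
Definition B_class n (x : V n) : V n.-1 := cls n.-1 (bop (rep x)).

Lemma B_classE n f : is_cocycle n f -> B_class (cls n f) = cls n.-1 (bop f).
Proof.
move=> fc; have hb := cocycle_bop sigma_grouplike sigma_invl twisted_involution.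
apply/(cls_eq (hb _ _ (rep_cocycle _)) (hb _ _ fc)).
rewrite -bopN -bopD.
by apply: (coboundary_bop sigma_grouplike sigma_invl twisted_involution); exact: rep_cls.
Qed.

Lemma B_class_lin n : linear (@B_class n).
Proof.
move=> c x y; have hb := cocycle_bop sigma_grouplike sigma_invl twisted_involution.
have [f [fc ->]] := cls_surj x; have [g [gc ->]] := cls_surj y.
rewrite -cls_lin // !B_classE //; last exact: is_cocycle_lin.
by rewrite bop_lin cls_lin //; exact: hb.
Qed.

HB.instance Definition _ n :=
  GRing.isLinear.Build k (V n) (V n.-1) _ (@B_class n) (@B_class_lin n).

(** The operator B on cohomology as a linear map. *)
Definition B_lin n : {linear V n -> V n.-1} := @B_class n.

(** The cup product on cohomology. *)
Definition cup_class p q (x : V p) (y : V q) : V (p + q)%N := cls (p + q) (cup (rep x) (rep y)).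

Lemma cup_linearl c f f' g : cup (c *: f + f') g = c *: (cup f g : word -> k^o) + cup f' g.
Proof. by apply/funext => t; exact: cupDl. Qed.

Lemma cup_linearr c f g g' : cup f (c *: g + g') = c *: (cup f g : word -> k^o) + cup f g'.
Proof. by apply/funext => t; exact: cupDr. Qed.

Lemma cup_classE p q f g : is_cocycle p f -> is_cocycle q g ->
  cup_class (cls p f) (cls q g) = cls (p + q) (cup f g).
Proof.
move=> fc gc; have hc := cocycle_cup.
apply/(cls_eq (hc _ _ _ _ _ _ _ (rep_cocycle _) (rep_cocycle _)) (hc _ _ _ _ _ _ _ fc gc)).
set f' := rep _; set g' := rep _.
have -> : cup f' g' - cup f g = (cup (f' - f) g' : word -> k^o) + cup f (g' - g).
  have -> : f' - f = (-1 : k) *: f + f' by rewrite scaleN1r addrC.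
  have -> : g' - g = (-1 : k) *: g + g' by rewrite scaleN1r addrC.
  rewrite cup_linearl cup_linearr !scaleN1r.
  by rewrite [RHS]addrC addrA addrK addrC.
apply: coboundaryD.
  by apply: (coboundary_cupl (rep_cls fc)); exact: rep_cocycle.
exact: (coboundary_cupr fc (rep_cls gc)).
Qed.

(** The bracket on cohomology is defined by the BV formula, which then holds by
definition; [induced_by_operad_G] identifies it with the operadic bracket. *)
Definition bracket_class p q (x : V p) (y : V q) : V (p + q).-1 :=
  (-1) ^+ p *: (B_lin (p + q) (cup_class x y)
     - recast V (p + q).-1 (cup_class (B_lin p x) y)
     - (-1) ^+ p *: recast V (p + q).-1 (cup_class x (B_lin q y))).

(** The class of the unit of the operad. *)
Definition unit_class : V 0%N := cls 0 (@operad_unit k H).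

(** The Gerstenhaber structure on cohomology. *)
Definition G_class : gerstenhaber_data V :=
  GerstenhaberData unit_class cup_class bracket_class.

Let cbop := cocycle_bop sigma_grouplike sigma_invl twisted_involution.
Let cbr := cocycle_bracket_BV sigma_grouplike sigma_invl twisted_involution.

Lemma bracket_classE p q f g : is_cocycle p f -> is_cocycle q g ->
  bracket_class (cls p f) (cls q g) = cls (p + q).-1 (bracket_BV p f g).
Proof.
move=> fc gc; rewrite /bracket_class /B_lin /=.
rewrite cup_classE // !B_classE //; last exact: cocycle_cup.
rewrite !cup_classE //; [|exact: cbop|exact: cbop].
have e1 : recast V (p + q).-1 (cls (p.-1 + q) (cup (bop f) g)) = cls (p + q).-1 (cup (bop f) g).
  apply: recast_cls; case: p fc => [|p] fc; [right|by left].
  by rewrite (bop_deg0 HA sigma) ?cup0l //; exact: fc.1.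
have e2 : recast V (p + q).-1 (cls (p + q.-1) (cup f (bop g))) = cls (p + q).-1 (cup f (bop g)).
  apply: recast_cls; case: q gc {e1} => [|q] gc; [right|by left; rewrite addnS].
  by rewrite (bop_deg0 HA sigma) ?cup0r //; exact: gc.1.
rewrite e1 e2.
have z1 : is_cocycle (p + q).-1 (bop (cup f g)) by apply: cbop; exact: cocycle_cup.
have z2 : is_cocycle (p + q).-1 (cup (bop f) g).
  case: p fc {e1 e2 z1} => [|p] fc; last by apply: (cocycle_cup _ gc); exact: (cbop fc).
  by rewrite (bop_deg0 HA sigma) ?cup0l //; [exact: is_cocycle0|exact: fc.1].
have z3 : is_cocycle (p + q).-1 (cup f (bop g)).
  case: q gc {e1 e2 z1 z2} => [|q] gc; last by rewrite addnS; apply: (cocycle_cup fc); exact: (cbop gc).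
  by rewrite (bop_deg0 HA sigma) ?cup0r //; [exact: is_cocycle0|exact: gc.1].
rewrite /bracket_BV -!clsZ // -!clsN //.
rewrite -!clsD // ?clsZ //.
all: by do ?[done|apply: cocycleZ|apply: cocycleN|apply: cocycleD].
Qed.

Local Notation bvL := (bv_leibniz bop cup).

Lemma coboundary_recast m n f : is_coboundary m f -> m = n \/ f = 0 ->
  is_coboundary n f.
Proof. by move=> fb [<-//|->]; exact: is_coboundary0. Qed.

(** In degree 0 the operator B vanishes, and so does the bracket of two elements. *)
Lemma bracket_BV00 f g : is_cocycle 0 f -> is_cocycle 0 g -> bracket_BV 0 f g = 0.
Proof.
move=> fc gc; rewrite /bracket_BV.
rewrite (bop_deg0 HA sigma (cocycle_cup fc gc).1) (bop_deg0 HA sigma fc.1).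
by rewrite (bop_deg0 HA sigma gc.1) cup0l cup0r !(scaler0, subr0).
Qed.

Lemma leibniz_BV_coboundary p q r f g h :
  is_cocycle p f -> is_cocycle q g -> is_cocycle r h ->
  is_coboundary (p + (q + r)).-1 (bvL p q f g h).
Proof.
move=> fc gc hc.
have L := Leibniz_coboundary sigma_grouplike sigma_invl twisted_involution fc gc hc.
have D := bracket_BV_coboundary sigma_grouplike sigma_invl twisted_involution.
have D1 := D _ _ _ _ fc (cocycle_cup gc hc).
have D2 : is_coboundary (p + (q + r)).-1
    (cup (cochain_bracket HA p q f g - bracket_BV p f g) h).
  apply: (coboundary_recast (coboundary_cupl (D _ _ _ _ fc gc) hc)).
  case: p q fc gc {L D1} => [|p] [|q] fc gc; rewrite ?addnA //=; [|by left..].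
  by right; rewrite cochain_bracket00 bracket_BV00 // subrr cup0l.
have D3 : is_coboundary (p + (q + r)).-1
    (cup g (cochain_bracket HA p r f h - bracket_BV p f h)).
  apply: (coboundary_recast (coboundary_cupr gc (D _ _ _ _ fc hc))).
  case: p r fc hc {L D1 D2} => [|p] [|r] fc hc; [|left; lia..].
  by right; rewrite cochain_bracket00 bracket_BV00 // subrr cup0r.
have := coboundaryD L (coboundaryN D1).
move/coboundaryD => /(_ _ D2) /coboundaryD => /(_ _ (coboundaryZ ((-1) ^+ (p.+1 * q)) D3)).
rewrite /bv_leibniz -/(bracket_BV p f _) -/(bracket_BV p f g) -/(bracket_BV p f h).
set X := (_ + _ : word -> k^o); set Y := (_ + _ : word -> k^o).
suff -> : X = Y by [].
rewrite /X /Y.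
set a := cochain_bracket HA _ (q + r) _ _; set b := cochain_bracket HA _ q _ _.
set c := cochain_bracket HA _ r _ _.
have -> : b - bracket_BV p f g = (-1) *: bracket_BV p f g + b by rewrite scaleN1r addrC.
have -> : c - bracket_BV p f h = (-1) *: bracket_BV p f h + c by rewrite scaleN1r addrC.
rewrite cup_linearl cup_linearr.
apply/funext => t.
have pD (u v : word -> k^o) : (u + v) t = u t + v t by [].
have pN (u : word -> k^o) : (- u) t = - u t by [].
have pZ x (u : word -> k^o) : (x *: u) t = x * u t by [].
rewrite !(pD, pN, pZ); ring.
Qed.

Lemma cocycle_unit : is_cocycle 0 (@operad_unit k H).
Proof.
split; first by split=> [[|x s1] s2|[|x s]].
apply/funext => s; rewrite /beta; case: ifP => // /eqP; case: s => [|x [|y s]] // _.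
rewrite !big_nat_recr ?big_geq //= /delta /= -[RHS]/(0 : k); ring.
Qed.

Lemma cup_unitl f : cup (@operad_unit k H) f = f.
Proof.
apply/funext => -[|x t] /=; rewrite mul1r // -[RHS]addr0; congr (_ + _).
have -> : (fun u => @operad_unit k H (x :: u)) = 0 by [].
by rewrite cup0l.
Qed.

Lemma cup_unitr f : cup f (@operad_unit k H) = f.
Proof.
apply/funext => t; elim: t f => [|x t IH] f /=; first by rewrite mulr1.
by rewrite mulr0 add0r IH.
Qed.

Lemma cup_assocE f g h : cup f (cup g h) = cup (cup f g) h.
Proof. by apply/funext => t; exact: cup_assoc. Qed.

Lemma bracket_BV_linl p c f f' g :
  bracket_BV p (c *: f + f') g = c *: bracket_BV p f g + bracket_BV p f' g.
Proof.
rewrite /bracket_BV bop_lin !cup_linearl bop_lin; apply/funext => t.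
have pD (u v : word -> k^o) : (u + v) t = u t + v t by [].
have pN (u : word -> k^o) : (- u) t = - u t by [].
have pZ x (u : word -> k^o) : (x *: u) t = x * u t by [].
rewrite !(pD, pN, pZ); ring.
Qed.

Lemma bracket_BV_linr p c f g g' :
  bracket_BV p f (c *: g + g') = c *: bracket_BV p f g + bracket_BV p f g'.
Proof.
rewrite /bracket_BV bop_lin !cup_linearr bop_lin; apply/funext => t.
have pD (u v : word -> k^o) : (u + v) t = u t + v t by [].
have pN (u : word -> k^o) : (- u) t = - u t by [].
have pZ x (u : word -> k^o) : (x *: u) t = x * u t by [].
rewrite !(pD, pN, pZ); ring.
Qed.

Lemma recast_bracket p q n f g : is_cocycle p f -> is_cocycle q g ->
  (p + q).-1 = n \/ p = 0%N /\ q = 0%N ->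
  recast V n (cls (p + q).-1 (bracket_BV p f g)) = cls n (bracket_BV p f g).
Proof.
move=> fc gc h; apply: recast_cls; case: h => [|[p0 q0]]; [by left|right].
by move: fc gc; rewrite p0 q0; exact: bracket_BV00.
Qed.

Lemma bracket_BV_anti p q f g : is_cocycle p f -> is_cocycle q g ->
  is_coboundary (p + q).-1 (bracket_BV p f g + (-1) ^+ (p.+1 * q.+1) *: bracket_BV q g f).
Proof.
move=> fc gc.
have D := bracket_BV_coboundary sigma_grouplike sigma_invl twisted_involution.
have D1 := D _ _ _ _ fc gc.
have := D _ _ _ _ gc fc; rewrite addnC => D2.
have := coboundaryN (coboundaryD D1 (coboundaryZ ((-1) ^+ (p.+1 * q.+1)) D2)).
rewrite (cochain_bracket_anti HA p q f g); congr is_coboundary.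
apply/funext => t.
have pD (u v : word -> k^o) : (u + v) t = u t + v t by [].
have pN (u : word -> k^o) : (- u) t = - u t by [].
have pZ x (u : word -> k^o) : (x *: u) t = x * u t by [].
rewrite !(pD, pN, pZ); ring.
Qed.

Lemma square_BV_coboundary p q f g : is_cocycle p f -> is_cocycle q g ->
  is_coboundary (p + q).-2 (bv_square bop cup p f g).
Proof.
move=> fc gc; rewrite /bv_square; apply: coboundaryZ.
have D := coboundary_bop_bop sigma_grouplike sigma_invl twisted_involution.
apply: coboundaryD; first apply: coboundaryD; first exact: (D _ _ (cocycle_cup fc gc)).
  apply: coboundaryN; apply: (coboundary_recast (coboundary_cupl (D _ _ fc) gc)).
  case: p fc => [|[|p]] fc; [right|right|by left].
    by rewrite (bop_deg0 HA sigma fc.1) (bop_deg0 HA sigma (cochain0 _ 0)) cup0l.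
  by rewrite (bop_deg0 HA sigma (cbop fc).1) cup0l.
apply: coboundaryN; apply: (coboundary_recast (coboundary_cupr fc (D _ _ gc))).
case: q gc => [|[|q]] gc; [right|right|left; lia].
  by rewrite (bop_deg0 HA sigma gc.1) (bop_deg0 HA sigma (cochain0 _ 0)) cup0r.
by rewrite (bop_deg0 HA sigma (cbop gc).1) cup0r.
Qed.

(** A coboundary of degree 0 is zero, hence a coboundary in every degree. *)
Lemma coboundary_degree m n f : is_coboundary m f -> (m == 0%N) || (m == n) ->
  is_coboundary n f.
Proof. by move=> fb /orP[] /eqP e; move: fb; rewrite e // => ->; exact: is_coboundary0. Qed.

Lemma bv_bracket0l p g : bv_bracket bop cup p 0 g = 0.
Proof. by rewrite /bv_bracket cup0l bop0 !cup0l !(scaler0, subr0). Qed.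

Lemma bv_bracket0r p f : bv_bracket bop cup p f 0 = 0.
Proof. by rewrite /bv_bracket cup0r bop0 !cup0r !(scaler0, subr0). Qed.

Lemma bv_leibnizSSl p q f g h : bvL p.+2 q f g h = bvL p q f g h.
Proof. by rewrite /bv_leibniz /bv_bracket !expr_parity !oddM /= !negbK. Qed.

Lemma bv_leibnizSSr p q f g h : bvL p q.+2 f g h = bvL p q f g h.
Proof. by rewrite /bv_leibniz /bv_bracket !expr_parity !oddM /= !negbK. Qed.

Lemma cup_squarel_coboundary p q r f g h :
  is_cocycle p f -> is_cocycle q g -> is_cocycle r h ->
  is_coboundary (p + q + r).-2 (cup (bv_square bop cup p f g) h).
Proof.
move=> fc gc hc; have S := square_BV_coboundary fc gc.
case e : (p + q).-2 S => [|n] S; first by rewrite S cup0l; exact: is_coboundary0.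
by apply: (coboundary_degree (coboundary_cupl S hc)); lia.
Qed.

Lemma cup_squarer_coboundary p q r f g h :
  is_cocycle p f -> is_cocycle q g -> is_cocycle r h ->
  is_coboundary (p + q + r).-2 (cup g (bv_square bop cup p f h)).
Proof.
move=> fc gc hc; have S := square_BV_coboundary fc hc.
case e : (p + r).-2 S => [|n] S; first by rewrite S cup0r; exact: is_coboundary0.
by apply: (coboundary_degree (coboundary_cupr gc S)); lia.
Qed.

Lemma jacobi_BV_coboundary p q r f g h :
  is_cocycle p f -> is_cocycle q g -> is_cocycle r h ->
  is_coboundary (p + q + r).-2 (bv_jacobi bop cup p q f g h).
Proof.
move=> fc gc hc.
rewrite (bv_jacobiE (bop_lin HA sigma) cup_linearl
  (fun c u v w => cup_linearr c w u v) cup_assocE p q f g h).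
have L := leibniz_BV_coboundary.
apply: coboundaryD; first apply: coboundaryZ.
  apply: coboundaryD; first apply: coboundaryD.
  - case: p fc => [|p] fc; last first.
      by rewrite bv_leibnizSSl -addnA; exact: (L _ _ _ _ _ _ (cbop fc) gc hc).
    rewrite (bop_deg0 HA sigma fc.1) /bv_leibniz !bv_bracket0l cup0l cup0r.
    by rewrite !(scaler0, subr0); exact: is_coboundary0.
  - rewrite -addnA; apply: coboundaryN.
    by apply: (coboundary_bop sigma_grouplike sigma_invl twisted_involution); exact: L.
  apply: coboundaryD; first apply: coboundaryD.
  - by rewrite -addnA; apply: (square_BV_coboundary fc); exact: cocycle_cup.
  - by apply: coboundaryN; exact: cup_squarel_coboundary.
  by apply: coboundaryN; apply: coboundaryZ; exact: cup_squarer_coboundary.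
apply: coboundaryN; apply: coboundaryD; first apply: coboundaryZ.
  case: q gc => [|q] gc.
    rewrite (bop_deg0 HA sigma gc.1) /bv_leibniz !cup0l !bv_bracket0r cup0l.
    by rewrite !(scaler0, subr0); exact: is_coboundary0.
  rewrite bv_leibnizSSr; apply: (coboundary_degree (L _ _ _ _ _ _ fc (cbop gc) hc)).
  by rewrite /=; lia.
case: r hc => [|r] hc.
  rewrite (bop_deg0 HA sigma hc.1) /bv_leibniz !cup0r !bv_bracket0r cup0r.
  by rewrite !(scaler0, subr0); exact: is_coboundary0.
by apply: (coboundary_degree (L _ _ _ _ _ _ fc gc (cbop hc))); rewrite /=; lia.
Qed.

Lemma recast_cocycle m n X : is_cocycle m X -> m = n \/ X = 0 ->
  is_cocycle n X /\ recast V n (cls m X) = cls n X.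
Proof.
move=> Xc e; split; last exact: recast_cls.
by case: e => [<-//|->]; exact: is_cocycle0.
Qed.

Lemma bracket_BV_degree p q f g : is_cocycle p f -> is_cocycle q g ->
  bracket_BV p f g = 0 \/ (0 < p + q)%N.
Proof.
move=> fc gc; case: (posnP (p + q)) => [/eqP|]; last by right.
rewrite addn_eq0 => /andP[/eqP p0 /eqP q0]; left.
by move: fc gc; rewrite p0 q0; exact: bracket_BV00.
Qed.

Lemma jacobi_class p q r f g h :
  is_cocycle p f -> is_cocycle q g -> is_cocycle r h ->
  recast V (p + q + r).-2 (cls (p + (q + r).-1).-1 (bracket_BV p f (bracket_BV q g h))) =
  recast V (p + q + r).-2 (cls ((p + q).-1 + r).-1 (bracket_BV (p + q).-1 (bracket_BV p f g) h)) +
  (-1) ^+ (p.+1 * q.+1) *: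
    recast V (p + q + r).-2 (cls (q + (p + r).-1).-1 (bracket_BV q g (bracket_BV p f h))).
Proof.
move=> fc gc hc.
have [c1 ->] : is_cocycle (p + q + r).-2 (bracket_BV p f (bracket_BV q g h)) /\
    recast V (p + q + r).-2 (cls (p + (q + r).-1).-1 (bracket_BV p f (bracket_BV q g h))) =
    cls (p + q + r).-2 (bracket_BV p f (bracket_BV q g h)).
  apply: recast_cocycle; first exact: (cbr fc (cbr gc hc)).
  case: (bracket_BV_degree gc hc) => [->|?]; last by left; lia.
  by right; exact: bv_bracket0r.
have [c3 ->] : is_cocycle (p + q + r).-2 (bracket_BV q g (bracket_BV p f h)) /\
    recast V (p + q + r).-2 (cls (q + (p + r).-1).-1 (bracket_BV q g (bracket_BV p f h))) =
    cls (p + q + r).-2 (bracket_BV q g (bracket_BV p f h)).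
  apply: recast_cocycle; first exact: (cbr gc (cbr fc hc)).
  case: (bracket_BV_degree fc hc) => [->|?]; last by left; lia.
  by right; exact: bv_bracket0r.
have e2 : bracket_BV (p + q).-1 (bracket_BV p f g) h = bracket_BV (p + q).+1 (bracket_BV p f g) h.
  case: (bracket_BV_degree fc gc) => [->|]; first by rewrite [LHS]bv_bracket0l [RHS]bv_bracket0l.
  by case: (p + q)%N => [//|n _]; rewrite /= /bracket_BV !expr_parity /= negbK.
have [c2 ->] : is_cocycle (p + q + r).-2 (bracket_BV (p + q).-1 (bracket_BV p f g) h) /\
    recast V (p + q + r).-2 (cls ((p + q).-1 + r).-1 (bracket_BV (p + q).-1 (bracket_BV p f g) h)) =
    cls (p + q + r).-2 (bracket_BV (p + q).-1 (bracket_BV p f g) h).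
  apply: recast_cocycle; first exact: (cbr (cbr fc gc) hc).
  case: (bracket_BV_degree fc gc) => [->|?]; last by left; lia.
  by right; exact: bv_bracket0l.
rewrite -clsZ // -clsD //; last exact: cocycleZ.
apply/cls_eq => //; first by apply: cocycleD => //; exact: cocycleZ.
by rewrite opprD addrA e2; exact: jacobi_BV_coboundary.
Qed.

Lemma is_gerstenhaber_G : is_gerstenhaber G_class.
Proof.
split.
- move=> p q b c x y; have [f [fc ->]] := cls_surj x; have [f' [fc' ->]] := cls_surj y.
  have [g [gc ->]] := cls_surj b.
  rewrite -cls_lin // [LHS]cup_classE //; last exact: is_cocycle_lin.
  by rewrite cup_linearl cls_lin /= ?cup_classE //; exact: cocycle_cup.
- move=> p q b c x y; have [f [fc ->]] := cls_surj x; have [f' [fc' ->]] := cls_surj y.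
  have [g [gc ->]] := cls_surj b.
  rewrite -cls_lin // [LHS]cup_classE //; last exact: is_cocycle_lin.
  by rewrite cup_linearr cls_lin /= ?cup_classE //; exact: cocycle_cup.
- move=> p q r a b c; have [f [fc ->]] := cls_surj a; have [g [gc ->]] := cls_surj b.
  have [h [hc ->]] := cls_surj c.
  have fg := cocycle_cup fc gc; have gh := cocycle_cup gc hc.
  rewrite /= (cup_classE gc hc) (cup_classE fc gc) (cup_classE fc gh) (cup_classE fg hc).
  by rewrite recast_cls ?cup_assocE // addnA; left.
- move=> p a; have [f [fc ->]] := cls_surj a.
  by rewrite [LHS](cup_classE cocycle_unit fc) cup_unitl.
- move=> p a; have [f [fc ->]] := cls_surj a.
  by rewrite [LHS](cup_classE fc cocycle_unit) cup_unitr recast_cls // addn0; left.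
- move=> p q a b; have [f [fc ->]] := cls_surj a; have [g [gc ->]] := cls_surj b.
  have gf : is_cocycle (p + q) (cup g f) by rewrite addnC; exact: cocycle_cup.
  rewrite /= !cup_classE // recast_cls; last by left; rewrite addnC.
  rewrite -clsZ //; apply/cls_eq; [exact: cocycle_cup|exact: cocycleZ|].
  exact: cup_commutative.
- move=> a b; have [f [fc ->]] := cls_surj a; have [g [gc ->]] := cls_surj b.
  by rewrite [LHS](bracket_classE fc gc) (bracket_BV00 fc gc) cls0.
- move=> p q b c x y; have [f [fc ->]] := cls_surj x; have [f' [fc' ->]] := cls_surj y.
  have [g [gc ->]] := cls_surj b.
  rewrite -cls_lin // [LHS]bracket_classE //; last exact: is_cocycle_lin.
  by rewrite bracket_BV_linl cls_lin /= ?bracket_classE //; exact: cbr.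
- move=> p q b c x y; have [f [fc ->]] := cls_surj x; have [f' [fc' ->]] := cls_surj y.
  have [g [gc ->]] := cls_surj b.
  rewrite -cls_lin // [LHS]bracket_classE //; last exact: is_cocycle_lin.
  by rewrite bracket_BV_linr cls_lin /= ?bracket_classE //; exact: cbr.
- move=> p q a b; have [f [fc ->]] := cls_surj a; have [g [gc ->]] := cls_surj b.
  have gf : is_cocycle (p + q).-1 (bracket_BV q g f) by rewrite addnC; exact: cbr.
  rewrite /= !bracket_classE // (recast_bracket gc fc); last by left; rewrite addnC.
  rewrite -clsZ // -clsN; last exact: cocycleZ.
  apply/cls_eq; [exact: cbr|by apply: cocycleN; exact: cocycleZ|].
  by rewrite opprK; exact: bracket_BV_anti.
- move=> p q r a b c; have [f [fc ->]] := cls_surj a; have [g [gc ->]] := cls_surj b.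
  have [h [hc ->]] := cls_surj c.
  rewrite /= (bracket_classE gc hc) (bracket_classE fc gc) (bracket_classE fc hc).
  rewrite (bracket_classE fc (cbr gc hc)) (bracket_classE (cbr fc gc) hc).
  rewrite (bracket_classE gc (cbr fc hc)).
  exact: jacobi_class.
move=> p q r c a b; have [f [fc ->]] := cls_surj c; have [g [gc ->]] := cls_surj a.
have [h [hc ->]] := cls_surj b.
have gh := cocycle_cup gc hc; have fg := cbr fc gc; have fh := cbr fc hc.
rewrite /= (cup_classE gc hc) (bracket_classE fc gh) (bracket_classE fc gc) (bracket_classE fc hc).
rewrite (cup_classE fg hc) (cup_classE gc fh).
have zf : is_cocycle (p + (q + r)).-1 (cup (bracket_BV p f g) h).
  case: (posnP (p + q)) => [/eqP|pq]; last first.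
    by have := cocycle_cup fg hc; congr (is_cocycle _ _); lia.
  rewrite addn_eq0 => /andP[/eqP p0 /eqP q0]; move: fc gc; rewrite p0 q0 => fc gc.
  by rewrite bracket_BV00 // cup0l; exact: is_cocycle0.
have zg : is_cocycle (p + (q + r)).-1 (cup g (bracket_BV p f h)).
  case: (posnP (p + r)) => [/eqP|pr]; last first.
    by have := cocycle_cup gc fh; congr (is_cocycle _ _); lia.
  rewrite addn_eq0 => /andP[/eqP p0 /eqP r0]; move: fc hc; rewrite p0 r0 => fc hc.
  by rewrite bracket_BV00 // cup0r; exact: is_cocycle0.
rewrite !recast_cls.
- rewrite -clsZ // -clsD //; last exact: cocycleZ.
  apply/cls_eq; [exact: cbr|by apply: cocycleD => //; exact: cocycleZ|].
  rewrite opprD addrA; exact: leibniz_BV_coboundary.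
- case: (posnP (p + r)) => [/eqP|pr]; last by left; lia.
  rewrite addn_eq0 => /andP[/eqP p0 /eqP r0]; move: fc hc; rewrite p0 r0 => fc hc.
  by right; rewrite bracket_BV00 // cup0r.
case: (posnP (p + q)) => [/eqP|pq]; last by left; lia.
rewrite addn_eq0 => /andP[/eqP p0 /eqP q0]; move: fc gc; rewrite p0 q0 => fc gc.
by right; rewrite bracket_BV00 // cup0l.
Qed.

Lemma is_BV_G : is_BV G_class.
Proof.
split; first exact: is_gerstenhaber_G.
exists B_lin; split=> [a|n a|p q a b]; last by [].
  have [f [fc ->]] := cls_surj a.
  by rewrite [LHS]B_classE // (bop_deg0 HA sigma) ?cls0 //; exact: fc.1.
have [f [fc ->]] := cls_surj a.
rewrite /B_lin /= !B_classE //; last exact: cbop.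
rewrite -(cls0 n.-1.-1); apply/cls_eq; first by do 2!apply: cbop.
  exact: is_cocycle0.
rewrite subr0.
exact: (coboundary_bop_bop sigma_grouplike sigma_invl twisted_involution).
Qed.

Lemma induced_by_operad_G : induced_by_operad G_class.
Proof.
split.
- by split; [exact: cocycle_unit|].
- move=> p q f g fc gc; rewrite (cochain_cupE HA fc.1 gc.1); split.
    exact: cocycle_cup.
  exact: cup_classE.
move=> p q f g fc gc.
have cb := cocycle_cochain_bracket sigma_grouplike sigma_invl twisted_involution fc gc.
split=> //; rewrite [LHS]bracket_classE //; apply/esym/cls_eq => //; first exact: cbr.
exact: (bracket_BV_coboundary sigma_grouplike sigma_invl twisted_involution).
Qed.

End Classes.

(** * Maps between subquotients, transport of structure *)

Section Subquotients.
Variables (k : comNzRingType).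

Lemma sq_class_eq (M : lmodType k) (Z B : submodule M) (x y : M) : Z x -> Z y ->
  B (x - y) -> sq_class Z B x = sq_class Z B y.
Proof.
move=> Zx Zy Bxy; apply/subr0_eq; rewrite -(addrC (- _)) -scaleN1r -sq_class_lin //.
by apply/sq_class_eq0; [exact: submodule_lin|rewrite scaleN1r addrC].
Qed.

(** The linear map between subquotients induced by a linear map that preserves
numerators and denominators. *)
Lemma subquotient_map (M N : lmodType k) (Z B : submodule M) (Z' B' : submodule N)
    (T : M -> N) : linear T -> (forall x, Z x -> Z' (T x)) -> (forall x, B x -> B' (T x)) ->
  {phi : {linear subquotient Z B -> subquotient Z' B'} |
    forall x, Z x -> phi (sq_class Z B x) = sq_class Z' B' (T x)}.
Proof.
move=> Tl TZ TB.
have surj (c : subquotient Z B) : exists x, Z x /\ c = sq_class Z B x.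
  by move: c; apply: sq_class_ind => x Zx; exists x.
pose r c := projT1 (cid (surj c)).
have rZ c : Z (r c) by exact: (projT2 (cid (surj c))).1.
have rK c : sq_class Z B (r c) = c by exact/esym/(projT2 (cid (surj c))).2.
pose phi c := sq_class Z' B' (T (r c)).
have TN x y : T (x - y) = T x - T y.
  by rewrite -[x - y]addrC -scaleN1r Tl scaleN1r addrC.
have phiE x : Z x -> phi (sq_class Z B x) = sq_class Z' B' (T x).
  move=> Zx; apply: sq_class_eq; [exact: TZ|exact: TZ|].
  rewrite -TN; apply: TB; have Zr := rZ (sq_class Z B x).
  have Zd : Z (r (sq_class Z B x) - x).
    by rewrite addrC -scaleN1r; exact: submodule_lin.
  apply/(@sq_class_eq0 _ _ Z B _ Zd).
  by rewrite addrC -scaleN1r sq_class_lin // rK scaleN1r addNr.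
have phil : linear phi.
  move=> a c d; rewrite -(rK c) -(rK d) -sq_class_lin // !phiE //; last exact: submodule_lin.
  by rewrite Tl sq_class_lin //; exact: TZ.
pose L := GRing.isLinear.Build k _ _ _ phi phil.
pose phi' : {linear subquotient Z B -> subquotient Z' B'} := HB.pack phi L.
by exists phi'.
Qed.

End Subquotients.

Section Transport.
Variables (k : comNzRingType) (V W : nat -> lmodType k).
Variables (Phi : forall n, {linear W n -> V n}) (G : gerstenhaber_data V).

(** Transport of a BV structure along a family of linear bijections. *)
Lemma transport_BV : (forall n, bijective (Phi n)) -> is_BV G ->
  exists G' : gerstenhaber_data W, transports Phi G' G /\ is_BV G'.
Proof.
move=> bij [gG [B [B0 BB BV]]].
have inv n : {psi : {linear V n -> W n} | cancel psi (Phi n)}.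
  have /cid[g [gK Kg]] : exists g, cancel (Phi n) g /\ cancel g (Phi n).
    by case: (bij n) => g; exists g.
  have gl : linear g.
    by move=> a x y; apply: (bij_inj (bij n)); rewrite linearP !Kg.
  pose L := GRing.isLinear.Build k _ _ _ g gl.
  by exists (HB.pack g L : {linear V n -> W n}).
pose Psi n := projT1 (inv n); have PhiK n : cancel (Psi n) (Phi n) by exact: projT2 (inv n).
have PhiI n : injective (Phi n) by exact: bij_inj.
have Phi_recast n m (x : W m) : Phi n (recast W n x) = recast V n (Phi m x).
  by rewrite /recast; case: eqP => [e|_]; [subst n|rewrite linear0].
pose G' := GerstenhaberData (Psi 0%N (gone G))
  (fun p q a b => Psi (p + q)%N (gcup G (Phi p a) (Phi q b)))
  (fun p q a b => Psi (p + q).-1 (gbracket G (Phi p a) (Phi q b))).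
exists G'; split; first by split=> *; exact: PhiK.
split.
  split.
  - move=> p q b c x y; apply: PhiI; rewrite linearP /= !PhiK linearP; exact: (cup_linl gG).
  - move=> p q b c x y; apply: PhiI; rewrite linearP /= !PhiK linearP; exact: (cup_linr gG).
  - by move=> p q r a b c; apply: PhiI; rewrite Phi_recast /= !PhiK; exact: (cupA gG).
  - by move=> p a; apply: PhiI; rewrite /= !PhiK; exact: (cup1l gG).
  - by move=> p a; apply: PhiI; rewrite Phi_recast /= !PhiK; exact: (cup1r gG).
  - move=> p q a b; apply: PhiI; rewrite linearZ Phi_recast /= !PhiK; exact: (cupC gG).
  - by move=> a b; apply: PhiI; rewrite /= linear0 PhiK; exact: (bracket00 gG).
  - move=> p q b c x y; apply: PhiI; rewrite linearP /= !PhiK linearP; exact: (bracket_linl gG).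
  - move=> p q b c x y; apply: PhiI; rewrite linearP /= !PhiK linearP; exact: (bracket_linr gG).
  - move=> p q a b; apply: PhiI; rewrite linearN linearZ Phi_recast /= !PhiK.
    exact: (bracketC gG).
  - move=> p q r a b c; apply: PhiI.
    rewrite linearD linearZ !Phi_recast /= !PhiK; exact: (bracket_jacobi gG).
  - move=> p q r c a b; apply: PhiI.
    rewrite linearD linearZ !Phi_recast /= !PhiK; exact: (bracket_leibniz gG).
pose B' n : W n -> W n.-1 := fun x => Psi n.-1 (B n (Phi n x)).
have B'l n : linear (B' n) by move=> a x y; rewrite /B' !linearP.
have BL n : {phi : {linear W n -> W n.-1} | forall x, phi x = B' n x}.
  pose L := GRing.isLinear.Build k _ _ _ (B' n) (B'l n).
  by exists (HB.pack (B' n) L : {linear W n -> W n.-1}).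
exists (fun n => projT1 (BL n)).
have BLE n x : projT1 (BL n) x = B' n x by exact: projT2 (BL n) x.
split=> /= [a|n a|p q a b].
- by rewrite BLE /B' B0 linear0.
- by rewrite !BLE /B' PhiK BB linear0.
apply: PhiI; rewrite [LHS]PhiK BV [RHS]linearZ; congr (_ *: _).
rewrite [RHS]linearB; congr (_ - _); last first.
  by rewrite [RHS]linearZ Phi_recast !PhiK BLE PhiK.
by rewrite [RHS]linearB Phi_recast !PhiK !BLE /B' !PhiK.
Qed.

End Transport.

(** * Dual bases of projective modules *)

Section FreeModule.
Variables (R : nzRingType) (M : lmodType R).

(** Functions of finite support on M with values in R. *)
Definition fin_fun : {pred M -> R^o} :=
  fun f => `[< exists s : seq M, forall y, y \notin s -> f y = 0 >].

Lemma fin_fun_closed : submod_closed fin_fun.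
Proof.
split; first by apply/asboolP; exists [::].
move=> a f g /asboolP[s sf] /asboolP[t tg]; apply/asboolP; exists (s ++ t) => y.
rewrite mem_cat negb_or => /andP[/sf fy /tg gy].
by rewrite -[LHS]/(a * f y + g y) fy gy mulr0 addr0.
Qed.

HB.instance Definition _ :=
  GRing.isSubmodClosed.Build R (M -> R^o) fin_fun fin_fun_closed.

(** The free R-module on the set underlying M. *)
Record free_mod := FreeMod { free_val : M -> R^o; _ : free_val \in fin_fun }.

HB.instance Definition _ := [isSub for free_val].
HB.instance Definition _ := [Choice of free_mod by <:].
HB.instance Definition _ := [SubChoice_isSubLmodule of free_mod by <:].

Lemma free_support (f : free_mod) :
  exists s : seq M, uniq s /\ forall y, y \notin s -> free_val f y = 0.
Proof.
case: f => f /= /asboolP[s sf]; exists (undup s); split; first exact: undup_uniq.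
by move=> y; rewrite mem_undup; exact: sf.
Qed.

(** A duplicate-free list containing the support of f. *)
Definition free_supp f := projT1 (cid (free_support f)).
(** The canonical surjection from the free module on M to M. *)
Definition free_eval (f : free_mod) : M := \sum_(y <- free_supp f) free_val f y *: y.

Lemma free_evalE (f : free_mod) s : uniq s -> (forall y, y \notin s -> free_val f y = 0) ->
  free_eval f = \sum_(y <- s) free_val f y *: y.
Proof.
move=> us sf; have [u h] := projT2 (cid (free_support f)).
apply: big_support => // y hy; first by rewrite h ?scale0r.
by rewrite sf ?scale0r.
Qed.

Lemma free_eval_lin : linear free_eval.
Proof.
move=> a f g.
have [uf hf] := projT2 (cid (free_support f)); have [ug hg] := projT2 (cid (free_support g)).
set s := undup (free_supp f ++ free_supp g).
have us : uniq s by exact: undup_uniq.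
have sf y : y \notin s -> free_val f y = 0.
  by rewrite mem_undup mem_cat negb_or => /andP[/hf].
have sg y : y \notin s -> free_val g y = 0.
  by rewrite mem_undup mem_cat negb_or => /andP[_ /hg].
have E y : free_val (a *: f + g) y = a * free_val f y + free_val g y.
  by rewrite -[free_val _]/(val (a *: f + g)) linearP.
rewrite (free_evalE us sf) (free_evalE us sg) (free_evalE us); last first.
  by move=> y hy; rewrite E sf // sg // mulr0 addr0.
rewrite scaler_sumr -big_split; apply: eq_bigr => y _.
by rewrite E scalerDl scalerA.
Qed.

Lemma free_eval_surj y : exists f, free_eval f = y.
Proof.
pose g : M -> R^o := fun z => (z == y)%:R.
have gs z : z \notin [:: y] -> g z = 0 by rewrite inE /g => /negPf ->.
have gf : g \in fin_fun by apply/asboolP; exists [:: y].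
exists (FreeMod gf); rewrite (@free_evalE _ [:: y]) // big_seq1 /= /g eqxx.
by rewrite scale1r.
Qed.

(** A projective module has a dual basis indexed by its own elements, with coordinates
rho and finite supports S: a section of [free_eval]. *)
Lemma dual_basis : projective M -> exists (rho : M -> M -> R) (S : M -> seq M),
  [/\ forall x, uniq (S x), forall x y, y \notin S x -> rho x y = 0,
      forall a x x' y, rho (a *: x + x') y = a * rho x y + rho x' y &
      forall x, x = \sum_(y <- S x) rho x y *: y].
Proof.
move=> pM.
pose L := GRing.isLinear.Build R _ _ _ free_eval free_eval_lin.
pose ev : {linear free_mod -> M} := HB.pack free_eval L.
have [h hK] := pM _ _ ev idfun free_eval_surj.
exists (fun x => free_val (h x)), (fun x => free_supp (h x)); split.
- by move=> x; exact: (projT2 (cid (free_support (h x)))).1.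
- by move=> x; exact: (projT2 (cid (free_support (h x)))).2.
- move=> a x x' y; rewrite linearP.
  by rewrite -[free_val _]/(val (a *: h x + h x')) linearP.
by move=> x; rewrite -[LHS](hK x).
Qed.

End FreeModule.

Section DualSum.
Variables (R : nzRingType) (M : lmodType R).
Hypothesis pM : projective M.

(** The coordinates of the chosen dual basis. *)
Definition coord : M -> M -> R := projT1 (cid (dual_basis pM)).
(** A duplicate-free list containing the support of the coordinates of x. *)
Definition coord_supp : M -> seq M := projT1 (cid (projT2 (cid (dual_basis pM)))).

Let spec : [/\ forall x, uniq (coord_supp x),
  forall x y, y \notin coord_supp x -> coord x y = 0,
  forall a x x' y, coord (a *: x + x') y = a * coord x y + coord x' y &
  forall x, x = \sum_(y <- coord_supp x) coord x y *: y] :=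
  projT2 (cid (projT2 (cid (dual_basis pM)))).

Variables (V : zmodType).
Implicit Types (F : M -> R -> V) (G : M -> V).

(** The sum over y of F y applied to the coordinate of x at y. It is linear in x when F
is additive in the coordinate. *)
Definition dual_sum F x : V := \sum_(y <- coord_supp x) F y (coord x y).

Lemma dual_sum_lin F a x x' : (forall y r r', F y (r + r') = F y r + F y r') ->
  dual_sum F (a *: x + x') = dual_sum (fun y r => F y (a * r)) x + dual_sum F x'.
Proof.
move=> FD; have F0 y : F y 0 = 0 by apply: (addrI (F y 0)); rewrite -FD !addr0.
have [us hs hl _] := spec.
set s := undup (coord_supp x ++ coord_supp x' ++ coord_supp (a *: x + x')).
have sus : uniq s by exact: undup_uniq.
have sub z : z \in [:: x; x'; a *: x + x'] -> forall y, y \notin s -> coord z y = 0.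
  move=> zz y; rewrite mem_undup !mem_cat !negb_or => /and3P[h1 h2 h3].
  by apply: hs; move: zz; rewrite !inE => /or3P[] /eqP ->.
have E F' z : (forall y, F' y 0 = 0) -> z \in [:: x; x'; a *: x + x'] ->
    \sum_(y <- coord_supp z) F' y (coord z y) = \sum_(y <- s) F' y (coord z y).
  move=> F'0 zz; by apply: (big_support (us z) sus) => y hy; [rewrite hs|rewrite (sub z)].
have m1 : x \in [:: x; x'; a *: x + x'] by rewrite !inE eqxx.
have m2 : x' \in [:: x; x'; a *: x + x'] by rewrite !inE eqxx orbT.
have m3 : a *: x + x' \in [:: x; x'; a *: x + x'] by rewrite !inE eqxx !orbT.
rewrite /dual_sum (E F _ F0 m3) (E F _ F0 m2) (E (fun y r => F y (a * r)) x) //; last first.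
  by move=> y; rewrite mulr0.
by rewrite -big_split; apply: eq_bigr => y _; rewrite hl FD.
Qed.

Lemma dual_sum0 F : (forall y r r', F y (r + r') = F y r + F y r') ->
  dual_sum F 0 = 0.
Proof.
move=> FD; have := dual_sum_lin 1 0 0 FD; rewrite scaler0 addr0 => h.
apply: (addrI (dual_sum F 0)); rewrite addr0 {3}h; congr (_ + _).
by apply: eq_bigr => y _; rewrite mul1r.
Qed.

Lemma dual_sumD F x x' : (forall y r r', F y (r + r') = F y r + F y r') ->
  dual_sum F (x + x') = dual_sum F x + dual_sum F x'.
Proof.
move=> FD; have := dual_sum_lin 1 x x' FD; rewrite scale1r => ->; congr (_ + _).
by apply: eq_bigr => y _; rewrite mul1r.
Qed.

Lemma dual_sumZ F a x : (forall y r r', F y (r + r') = F y r + F y r') ->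
  dual_sum F (a *: x) = dual_sum (fun y r => F y (a * r)) x.
Proof.
by move=> FD; have := dual_sum_lin a x 0 FD; rewrite addr0 dual_sum0 // addr0.
Qed.

Lemma eq_dual_sum F F' x : (forall y r, F y r = F' y r) -> dual_sum F x = dual_sum F' x.
Proof. by move=> FF; apply: eq_bigr => y _. Qed.

Lemma dual_sum_addf F F' x :
  dual_sum (fun y r => F y r + F' y r) x = dual_sum F x + dual_sum F' x.
Proof. exact: big_split. Qed.

Lemma dual_sumE G x : (forall y y', G (y + y') = G y + G y') ->
  dual_sum (fun y r => G (r *: y)) x = G x.
Proof.
move=> GD; have G0 : G 0 = 0 by apply: (addrI (G 0)); rewrite -GD !addr0.
by have [_ _ _ e] := spec; rewrite [in RHS](e x) (big_morph G GD G0).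
Qed.

End DualSum.

Lemma dual_sum_morph (R : nzRingType) (M : lmodType R) (pM : projective M)
    (V W : zmodType) (g : V -> W) (F : M -> R -> V) x :
  (forall u v, g (u + v) = g u + g v) ->
  g (dual_sum pM F x) = dual_sum pM (fun y r => g (F y r)) x.
Proof.
move=> gD; have g0 : g 0 = 0 by apply: (addrI (g 0)); rewrite -gD !addr0.
exact: (big_morph g gD g0).
Qed.

(** * The bar differential with values in a module *)

Section BarBoundary.
Variables (k : comNzRingType) (H : algType k) (HA : hopf_algebra H).
Variable V : lmodType k.
Local Notation eps := (hEps HA).
Local Notation word := (seq H).
Implicit Types (F G : word -> V) (s t w : word) (h r x : H).

(** Functions on words with values in a k-module that are linear in every letter. *)
Definition mlin F : Prop := forall s1 s2 a x y,
  F (s1 ++ (a *: x + y) :: s2) = a *: F (s1 ++ x :: s2) + F (s1 ++ y :: s2).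

Lemma mlin_cons F h : mlin F -> mlin (fun w => F (h :: w)).
Proof. by move=> Fl s1; exact: (Fl (h :: s1)). Qed.

Lemma mlinD F w r r' : mlin F -> F (r + r' :: w) = F (r :: w) + F (r' :: w).
Proof. by move=> Fl; have := Fl [::] w 1 r r'; rewrite !scale1r. Qed.

(** F after multiplication of the first letter by h, which acts by eps h on the empty
word. *)
Definition lact h F w : V := if w is x :: t then F (h * x :: t) else eps h *: F [::].

(** The value of F, extended linearly, on the boundary of a word of the bar resolution,
where the word h0 :: t stands for h0 tensor t. On words of one letter the boundary is
the augmentation. *)
Fixpoint bdr F w : V :=
  if w is r :: t then lact r F t - bdr (fun v => F (r :: v)) t else 0.

Lemma lact_lact x r F : lact x (lact r F) = lact (r * x) F.
Proof.
by apply/funext => -[|y t] /=; rewrite ?mulrA // scalerA mulrC -hEpsM.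
Qed.

Lemma lact1 F : lact 1 F = F.
Proof. by apply/funext => -[|y t] /=; rewrite ?mul1r // hEps1 scale1r. Qed.

Lemma mlin_lact h F : mlin F -> mlin (lact h F).
Proof.
move=> Fl [|z s1] s2 a x y /=; last exact: (Fl (h * z :: s1)).
by rewrite mulrDr -scalerAr; exact: (Fl [::]).
Qed.

Lemma bdr_ext F G t : (forall w, (size w).+1 = size t -> F w = G w) -> bdr F t = bdr G t.
Proof.
elim: t F G => [//|r t IH] F G FG /=; congr (_ - _).
  by case: t FG {IH} => [|x t] FG /=; rewrite FG.
by apply: IH => w wt; rewrite FG //= wt.
Qed.

Lemma bdr_lin a F G t : bdr (fun w => a *: F w + G w) t = a *: bdr F t + bdr G t.
Proof.
elim: t F G => [|r t IH] F G /=; first by rewrite scaler0 addr0.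
have -> : lact r (fun w => a *: F w + G w) t = a *: lact r F t + lact r G t.
  by case: t {IH} => //=; rewrite scalerDr !scalerA mulrC.
by rewrite IH scalerBr opprD addrACA.
Qed.

Lemma bdr0 t : bdr (fun=> 0) t = 0.
Proof.
elim: t => [//|r t IH] /=; rewrite IH subr0.
by case: t {IH} => //=; rewrite scaler0.
Qed.

Lemma bdrB F G t : bdr (fun w => F w - G w) t = bdr F t - bdr G t.
Proof.
have <- : (fun w => (-1) *: G w + F w) = (fun w => F w - G w).
  by apply/funext => w; rewrite scaleN1r addrC.
by rewrite bdr_lin scaleN1r addrC.
Qed.

Lemma bdr_lact h F w : bdr (lact h F) w = lact h (bdr F) w.
Proof.
case: w => [|x t] /=; first by rewrite scaler0.
by rewrite lact_lact.
Qed.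

Lemma bdr_bdr F w : bdr (bdr F) w = 0.
Proof.
elim: w F => [//|r w IH] F /=.
rewrite -[X in _ - X]/(bdr (fun v => lact r F v - bdr (fun u => F (r :: u)) v) w).
by rewrite bdrB IH subr0 bdr_lact subrr.
Qed.

Lemma mlin_bdr F : mlin F -> mlin (bdr F).
Proof.
move=> Fl s1; elim: s1 F Fl => [|r s1 IH] F Fl s2 a x y /=.
  have -> : (fun v => F (a *: x + y :: v)) = (fun v => a *: F (x :: v) + F (y :: v)).
    by apply/funext => v; exact: (Fl [::]).
  rewrite bdr_lin scalerBr opprD addrACA; congr (_ + _).
  case: s2 => [|z s2] /=; last by rewrite mulrDl -scalerAl; exact: (Fl [::]).
  by rewrite hEps_lin scalerDl scalerA.
rewrite (IH _ (mlin_cons r Fl)) scalerBr opprD addrACA; congr (_ + _).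
exact: mlin_lact.
Qed.

Lemma bdr_sum F h t : bdr F (h :: t) =
  \sum_(0 <= i < size t) (-1) ^+ i *: F (take i (h :: t) ++
     nth 0 (h :: t) i * nth 0 (h :: t) i.+1 :: drop i.+2 (h :: t))
  + (-1) ^+ size t *: (eps (nth 0 (h :: t) (size t)) *: F (take (size t) (h :: t))).
Proof.
elim: t h F => [|x t IH] h F; first by rewrite big_geq //= add0r subr0 scale1r.
rewrite -[LHS]/(F (h * x :: t) - bdr (fun v => F (h :: v)) (x :: t)) IH.
rewrite big_nat_recl //= expr0 scale1r ?take0 ?drop0 -addrA; congr (_ + _).
rewrite opprD -sumrN; congr (_ + _); last by rewrite exprS mulN1r scaleNr.
by apply: eq_bigr => i _; rewrite exprS mulN1r scaleNr.
Qed.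

End BarBoundary.

Section BarBoundaryMorphism.
Variables (k : comNzRingType) (H : algType k) (HA : hopf_algebra H).
Variables (V W : lmodType k) (g : V -> W).
Hypothesis gl : linear g.

Lemma bdr_morph (F : seq H -> V) t : g (bdr HA F t) = bdr HA (fun w => g (F w)) t.
Proof.
have g0 : g 0 = 0 by have := gl (-1) 0 0; rewrite !scaleN1r !addNr.
have gZ a v : g (a *: v) = a *: g v by have := gl a v 0; rewrite g0 !addr0.
have gB u v : g (u - v) = g u - g v by rewrite addrC -scaleN1r gl scaleN1r addrC.
elim: t F => [//|r t IH] F /=; rewrite gB IH; congr (_ - _).
by case: t {IH} => //=; rewrite gZ.
Qed.

End BarBoundaryMorphism.

(** An H-module regarded as a k-module. *)
Definition restr (k : comNzRingType) (H : algType k) (M : lmodType H) : Type := M.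

Section Restriction.
Variables (k : comNzRingType) (H : algType k) (M : lmodType H).
HB.instance Definition _ := GRing.Zmodule.on (restr M).

(** Scalars act through the unit map of H. *)
Definition restr_scale (a : k) (x : restr M) : restr M := (a%:A : H) *: (x : M).

Fact restr_scaleA a b v : restr_scale a (restr_scale b v) = restr_scale (a * b) v.
Proof. by rewrite /restr_scale scalerA mulr_algl scalerA. Qed.
Fact restr_scale1 : left_id 1 restr_scale.
Proof. by move=> v; rewrite /restr_scale !scale1r. Qed.
Fact restr_scaleDr : right_distributive restr_scale +%R.
Proof. by move=> a u v; exact: scalerDr. Qed.
Fact restr_scaleDl v : {morph restr_scale^~ v : a b / a + b}.
Proof. by move=> a b; rewrite /restr_scale scalerDl; exact: scalerDl. Qed.

HB.instance Definition _ := GRing.Zmodule_isLmodule.Build k (restr M)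
  restr_scaleA restr_scale1 restr_scaleDr restr_scaleDl.

Lemma restrZ (a : k) (x : restr M) : a *: x = ((a%:A : H) *: (x : M)) :> restr M.
Proof. by []. Qed.

Lemma restr_act (a : k) (h : H) (x : M) :
  (h *: (a *: (x : restr M) : M) : M) = (a *: (h *: x : restr M) : restr M) :> M.
Proof. by rewrite !restrZ !scalerA mulr_algl mulr_algr. Qed.

Lemma restr_actl (a : k) (h : H) (x : M) :
  ((a *: h) *: x : M) = (a *: (h *: x : restr M) : restr M) :> M.
Proof. by rewrite !restrZ scalerA mulr_algl. Qed.

End Restriction.

(** * From the resolution to the bar resolution *)

Section Evaluation.
Variables (k : comNzRingType) (H : algType k) (HA : hopf_algebra H).
Variable P : projective_resolution HA.
Local Notation eps := (hEps HA).
Local Notation word := (seq H).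
Local Notation PM := (res_mod P).
Local Notation d := (res_d P).
Local Notation aug := (@res_aug _ _ _ P).
Local Notation dsum n := (dual_sum (@res_proj _ _ _ P n)).

Section Values.
Variable V : lmodType k.
Implicit Types (F G : word -> V) (t w : word) (h r : H).
Local Notation lact := (lact HA).
Local Notation bdr := (bdr HA).

(** The value of F on the image of x under a chain map from P to the bar resolution. In
degree n + 1 this chain map sends x to the sum over y of c_y(x) tensor the image of d y,
where the c_y(x) are the coordinates of x; in degree 0 it sends x to the sum of
aug(y) c_y(x). *)
Fixpoint bar_eval n F : PM n -> V :=
  match n return PM n -> V with
  | 0 => dsum 0 (fun y r => aug y *: F [:: r])
  | m.+1 => dsum m.+1 (fun y r => bar_eval (fun w => F (r :: w)) (d m y))
  end.

Lemma augD x y : aug (x + y) = aug x + aug y.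
Proof. by have := res_aug_lin 1 x y; rewrite scale1r hEps1 mul1r. Qed.

Lemma aug0 : aug 0 = 0.
Proof. by apply: (addrI (aug 0)); rewrite -augD !addr0. Qed.

Lemma augB x y : aug (x - y) = aug x - aug y.
Proof. by apply: (addIr (aug y)); rewrite -augD !subrK. Qed.

Lemma augZ h x : aug (h *: x) = eps h * aug x.
Proof. by have := res_aug_lin h x 0; rewrite !addr0 aug0 addr0. Qed.

Lemma aug_d y : aug (d 0 y) = 0.
Proof. by apply/res_exact0; exists y. Qed.

Lemma d_d n y : d n (d n.+1 y) = 0.
Proof. by apply/res_exactS; exists y. Qed.

Lemma eq_bar_eval n F G x : (forall w, size w = n.+1 -> F w = G w) ->
  bar_eval F x = bar_eval (n := n) G x.
Proof.
elim: n F G x => [|n IH] F G x FG /=; apply: eq_dual_sum => y r; first by rewrite FG.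
by apply: IH => w wn; rewrite FG //= wn.
Qed.

Lemma bar_eval_lin n a F G (x : PM n) :
  bar_eval (fun w => a *: F w + G w) x = a *: bar_eval F x + bar_eval G x.
Proof.
have aD (u v : V) : a *: (u + v) = a *: u + a *: v by exact: scalerDr.
elim: n F G x => [|n IH] F G x /=; rewrite (dual_sum_morph _ _ _ aD) -dual_sum_addf;
  apply: eq_dual_sum => y r //.
by rewrite scalerDr !scalerA mulrC.
Qed.

Lemma bar_evalB n F G (x : PM n) :
  bar_eval (fun w => F w - G w) x = bar_eval F x - bar_eval G x.
Proof.
have <- : (fun w => (-1) *: G w + F w) = (fun w => F w - G w).
  by apply/funext => w; rewrite scaleN1r addrC.
by rewrite bar_eval_lin scaleN1r addrC.
Qed.

Lemma bar_evalZ n a F (x : PM n) : bar_eval (fun w => a *: F w) x = a *: bar_eval F x.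
Proof.
have B0 : bar_eval (fun=> 0) x = 0 :> V.
  rewrite -[RHS](subrr (bar_eval F x)) -bar_evalB; apply: eq_bar_eval => w _.
  by rewrite subrr.
have := bar_eval_lin a F (fun=> 0) x; rewrite B0 addr0 => <-.
by apply: eq_bar_eval => w _; rewrite addr0.
Qed.

Lemma bar_eval_cons n F r r' (x : PM n) : mlin F ->
  bar_eval (fun w => F (r + r' :: w)) x =
  bar_eval (fun w => F (r :: w)) x + bar_eval (fun w => F (r' :: w)) x.
Proof.
move=> Fl; have := bar_eval_lin 1 (fun w => F (r :: w)) (fun w => F (r' :: w)) x.
rewrite scale1r => <-; congr bar_eval; apply/funext => w.
by rewrite mlinD // scale1r.
Qed.

Lemma bar_evalD n F (x y : PM n) : mlin F ->
  bar_eval F (x + y) = bar_eval F x + bar_eval F y.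
Proof.
case: n x y => [|n] x y Fl /=; apply: dual_sumD => z r r'.
  by rewrite mlinD // scalerDr.
exact: bar_eval_cons.
Qed.

Lemma bar_eval0 n F : mlin F -> bar_eval F (0 : PM n) = 0.
Proof.
by move=> Fl; apply: (addrI (bar_eval F (0 : PM n))); rewrite -bar_evalD // !addr0.
Qed.

Lemma bar_evalHZ n F h (x : PM n) : mlin F ->
  bar_eval F (h *: x) = bar_eval (lact h F) x.
Proof.
case: n x => [|n] x Fl /=; apply: dual_sumZ => z r r'.
  by rewrite mlinD // scalerDr.
exact: bar_eval_cons.
Qed.

Lemma bar_eval_bdr0 F x : bar_eval (n := 0) (bdr F) x = aug x *: F [::].
Proof.
rewrite /= -(@dual_sumE _ _ (@res_proj _ _ _ P 0) V (fun y => aug y *: F [::]) x).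
  by apply: eq_dual_sum => y r; rewrite subr0 augZ scalerA mulrC.
by move=> y y'; rewrite augD scalerDl.
Qed.

(** The map underlying [bar_eval] is a chain map. *)
Lemma bar_eval_bdrS n F x : mlin F ->
  bar_eval (n := n.+1) (bdr F) x = bar_eval F (d n x).
Proof.
elim: n F x => [|n IH] F x Fl.
  rewrite -[LHS]/(dsum 1 (fun y r => bar_eval (fun w => lact r F w - bdr (fun v => F (r :: v)) w) (d 0 y)) x).
  rewrite -(@dual_sumE _ _ (@res_proj _ _ _ P 1) V (fun y => bar_eval F (d 0 y)) x).
    apply: eq_dual_sum => y r; rewrite bar_evalB bar_eval_bdr0 aug_d scale0r subr0.
    by rewrite linearZ bar_evalHZ.
  by move=> y y'; rewrite linearD bar_evalD.
rewrite -[LHS]/(dsum n.+2 (fun y r => bar_eval (fun w => lact r F w - bdr (fun v => F (r :: v)) w) (d n.+1 y)) x).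
rewrite -(@dual_sumE _ _ (@res_proj _ _ _ P n.+2) V (fun y => bar_eval F (d n.+1 y)) x).
  apply: eq_dual_sum => y r; rewrite bar_evalB IH; last exact: mlin_cons.
  by rewrite d_d bar_eval0 ?subr0 ?linearZ ?bar_evalHZ //; exact: mlin_cons.
by move=> y y'; rewrite linearD bar_evalD.
Qed.

End Values.

Lemma bar_eval_morph (V W : lmodType k) (g : V -> W) n F (x : PM n) : linear g ->
  g (bar_eval F x) = bar_eval (fun w => g (F w)) x.
Proof.
move=> gl; have gD u v : g (u + v) = g u + g v by have := gl 1 u v; rewrite !scale1r.
have g0 : g 0 = 0 by apply: (addrI (g 0)); rewrite -gD !addr0.
elim: n F x => [|n IH] F x /=; rewrite (dual_sum_morph _ _ _ gD); apply: eq_dual_sum => y r.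
  by have := gl (aug y) (F [:: r]) 0; rewrite g0 !addr0.
exact: IH.
Qed.

(** * A k-linear contraction of the resolution *)

Hypothesis pH : projective (H : lmodType k).

(** If H is k-projective, then so is P_n: a k-linear map z lifts through every k-linear
map g whose image contains the values of z. *)
Lemma restr_lift n (N M : lmodType H) (g : M -> N) (z : PM n -> N) :
  (forall (a : k) x y, g (a *: (x : restr M) + y : restr M) =
     (a *: (g x : restr N) + (g y : restr N) : restr N)) ->
  (forall (a : k) x y, z (a *: (x : restr (PM n)) + y : restr (PM n)) =
     (a *: (z x : restr N) + (z y : restr N) : restr N)) ->
  (forall x, exists m, g m = z x) ->
  exists s : restr (PM n) -> restr M, linear s /\ forall x, g (s x) = z x.
Proof.
move=> gl zl /choice[c cE].
have gD u v : g (u + v) = g u + g v.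
  by have := gl 1 u v; rewrite !scale1r.
have zD u v : z (u + v) = z u + z v.
  by have := zl 1 u v; rewrite !scale1r.
have z0 : z 0 = 0 by apply: (addrI (z 0)); rewrite -zD !addr0.
have g0 : g 0 = 0 by apply: (addrI (g 0)); rewrite -gD !addr0.
have gZ a u : g (a *: (u : restr M) : restr M) = (a *: (g u : restr N) : restr N).
  by have := gl a u 0; rewrite g0 !addr0.
have zZ a u : z (a *: (u : restr (PM n)) : restr (PM n)) = (a *: (z u : restr N) : restr N).
  by have := zl a u 0; rewrite z0 !addr0.
pose f (y : PM n) (r : H) : restr M :=
  dual_sum pH (fun (h : H) (a : k) => a *: (c (h *: y) : restr M)) r.
have fD y r r' : f y (r + r') = f y r + f y r'.
  by apply: dual_sumD => h a b; rewrite scalerDl.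
have fZ (a : k) y r : f y (a *: r) = a *: f y r.
  rewrite /f dual_sumZ; last by move=> h b b'; rewrite scalerDl.
  rewrite (@dual_sum_morph _ _ _ _ _ (fun u : restr M => a *: u)); last by move=> u v; rewrite scalerDr.
  by apply: eq_dual_sum => h b; rewrite scalerA.
exists (dsum n f); split.
  move=> a x y; rewrite dual_sumD // restrZ dual_sumZ //; congr (_ + _).
  rewrite (@dual_sum_morph _ _ _ _ _ (fun u : restr M => a *: u)); last by move=> u v; rewrite scalerDr.
  by apply: eq_dual_sum => y' r; rewrite mulr_algl fZ.
move=> x; rewrite (dual_sum_morph _ _ _ gD) -[RHS](@dual_sumE _ _ (@res_proj _ _ _ P n) N z x) //.
apply: eq_dual_sum => y r; rewrite /f (dual_sum_morph _ _ _ gD).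
rewrite -[RHS](@dual_sumE _ _ pH N (fun r => z (r *: y)) r); last first.
  by move=> u v; rewrite scalerDl zD.
apply: eq_dual_sum => h a; rewrite gZ cE -zZ; congr z.
by rewrite restr_actl.
Qed.

(** Cycles of the augmented resolution. *)
Definition res_cycle n : PM n -> Prop :=
  match n with 0 => fun x => aug x = 0 | m.+1 => fun x => d m x = 0 end.

Lemma cycle_d n y : res_cycle (d n y).
Proof. by case: n y => [|n] y; [exact: aug_d|exact: d_d]. Qed.

Lemma d_restr n (a : k) (x y : PM n.+1) : d n (a *: (x : restr (PM n.+1)) + y : restr (PM n.+1)) =
  (a *: (d n x : restr (PM n)) + (d n y : restr (PM n)) : restr (PM n)).
Proof. by rewrite restrZ [LHS]linearP. Qed.

(** A k-linear choice of preimages of cycles. *)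
Definition is_contraction n (s : restr (PM n) -> restr (PM n.+1)) : Prop :=
  linear s /\ forall x, res_cycle (x : PM n) -> d n (s x) = x.

(** An element of P_0 of augmentation 1. *)
Definition aug_section : PM 0 := projT1 (cid (@res_aug_surj _ _ _ P 1)).

Lemma aug_sectionE : aug aug_section = 1.
Proof. exact: projT2 (cid (@res_aug_surj _ _ _ P 1)). Qed.

Lemma aug_restr (a : k) (x : PM 0) : aug (a *: (x : restr (PM 0)) : restr (PM 0)) = a * aug x.
Proof.
have e0 : eps 0 = 0 by have := hEps_lin HA (-1) 0 0; rewrite scaler0 addr0 mulN1r addNr.
by rewrite restrZ augZ; have := hEps_lin HA a 1 0; rewrite e0 !addr0 hEps1 mulr1 => ->.
Qed.

Lemma contraction0 : exists s : restr (PM 0) -> restr (PM 1),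
  is_contraction s /\
  forall x, d 0 (s x) = x - (aug (x : PM 0) *: (aug_section : restr (PM 0)) : restr (PM 0)).
Proof.
have [||x|s [sl sE]] := @restr_lift 0 (PM 0) (PM 1) (d 0)
  (fun x => x - (aug (x : PM 0) *: (aug_section : restr (PM 0)) : restr (PM 0))).
- exact: d_restr.
- move=> a x y; rewrite augD aug_restr scalerDl opprD addrACA scalerBr scalerA.
  by [].
- by apply/res_exact0; rewrite augB aug_restr aug_sectionE mulr1 subrr.
exists s; split=> //; split=> // x xc; rewrite sE xc scale0r; exact: subr0.
Qed.

Lemma contractionS n (s : restr (PM n) -> restr (PM n.+1)) : is_contraction s ->
  exists s' : restr (PM n.+1) -> restr (PM n.+2), is_contraction s' /\
  forall x, d n.+1 (s' x) = x - s (d n x).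
Proof.
move=> [sl sc].
have [||x|s' [s'l s'E]] := @restr_lift n.+1 (PM n.+1) (PM n.+2) (d n.+1)
  (fun x => x - s (d n x)).
- exact: d_restr.
- by move=> a x y; rewrite d_restr sl opprD addrACA scalerBr.
- by apply/res_exactS; rewrite linearB sc ?subrr //; exact: cycle_d.
have s0 : s 0 = 0 by have := sl (-1) 0 0; rewrite !scaleN1r !addNr.
exists s'; split=> //; split=> // x xc; rewrite s'E xc s0; exact: subr0.
Qed.

(** A k-linear contraction of the resolution, constructed degree by degree: s_(n+1)
lifts the map x - s_n(d x), whose values are cycles. *)
Fixpoint contraction_spec n : {s : restr (PM n) -> restr (PM n.+1) | is_contraction s} :=
  match n with
  | 0 => exist _ (projT1 (cid contraction0)) (projT2 (cid contraction0)).1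
  | m.+1 => let c := cid (contractionS (proj2_sig (contraction_spec m))) in
            exist _ (projT1 c) (projT2 c).1
  end.

(** The k-linear contraction of the resolution. *)
Definition contraction n := proj1_sig (contraction_spec n).

Lemma contraction_lin n : linear (@contraction n).
Proof. exact: (proj2_sig (contraction_spec n)).1. Qed.

Lemma contraction_cycle n x : res_cycle (x : PM n) -> d n (contraction x) = x.
Proof. exact: (proj2_sig (contraction_spec n)).2. Qed.

Lemma d_contraction0 x :
  d 0 (contraction x) = x - (aug (x : PM 0) *: (aug_section : restr (PM 0)) : restr (PM 0)).
Proof. exact: (projT2 (cid contraction0)).2. Qed.

Lemma d_contractionS n x : d n.+1 (contraction x) = x - contraction (d n x).
Proof. exact: (projT2 (cid (contractionS (proj2_sig (contraction_spec n))))).2. Qed.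

(** * The comparison map from the bar resolution *)

(** The comparison map from the bar resolution on the elements 1 tensor t, extended by 0
to the words t of length other than n. *)
Fixpoint theta n : word -> restr (PM n) :=
  match n with
  | 0 => fun w => if w is [::] then (aug_section : restr (PM 0)) else 0
  | m.+1 => fun w => if w is h :: t then contraction (h *: (theta m t : PM m) : PM m) else 0
  end.

Lemma mlin_theta n : mlin (theta n).
Proof.
elim: n => [|n IH] s1 s2 a x y; first by case: s1 => [|z s1] /=; rewrite scaler0 addr0.
case: s1 => [|z s1] /=; rewrite -contraction_lin; congr contraction.
  by rewrite scalerDl restr_actl.
by rewrite IH [LHS]scalerDr restr_act.
Qed.

Lemma d_theta n h t : size t = n ->
  d n (theta n.+1 (h :: t)) = (h *: (theta n t : PM n) : restr (PM n)) - bdr HA (theta n) (h :: t).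
Proof.
elim: n h t => [|n IH] h [|h' t] //.
  by move=> _; rewrite [LHS]d_contraction0 augZ aug_sectionE mulr1 /= subr0.
move=> [tn]; rewrite [LHS]d_contractionS; congr (_ - _).
have -> : d n (h *: (theta n.+1 (h' :: t) : PM n.+1)) =
    h *: (d n (theta n.+1 (h' :: t)) : PM n) by exact: linearZ.
rewrite IH // scalerBr scalerA.
have cB u v : contraction (u - v) = contraction u - contraction v :> restr (PM n.+1).
  have := @contraction_lin n (-1) v u; rewrite !scaleN1r ![- _ + _]addrC.
  by [].
rewrite [LHS]cB -[RHS]/(contraction ((h * h') *: (theta n t : PM n)) -
  bdr HA (fun w => contraction (h *: (theta n w : PM n))) (h' :: t)); congr (_ - _).
apply: (bdr_morph HA (g := fun v : restr (PM n) => contraction (h *: (v : PM n)))).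
move=> a u v; rewrite -contraction_lin; congr contraction.
by rewrite [LHS]scalerDr restr_act.
Qed.

Lemma theta_bar_comparison : bar_comparison theta.
Proof.
split.
- by move=> n s1 s2 _ a x y; exact: mlin_theta.
- exact: aug_sectionE.
move=> n [//|h t] [tn]; rewrite d_theta // bdr_sum tn /= drop0 opprD addrA -sumrN.
have sgn m (v : PM n) : - ((-1 : k) ^+ m *: (v : restr (PM n))) = (-1 : H) ^+ m.+1 *: v.
  by rewrite exprS mulN1r scaleNr !expr_parity; case: odd; rewrite ?scaleN1r ?scale1r.
congr (_ + _ + _); last exact: sgn.
by apply: eq_bigr => i _; exact: sgn.
Qed.

End Evaluation.

Section BackOnResolution.
Variables (k : comNzRingType) (H : algType k) (HA : hopf_algebra H).
Variable P : projective_resolution HA.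
Hypothesis pH : projective (H : lmodType k).
Local Notation word := (seq H).
Local Notation PM := (res_mod P).
Local Notation d := (res_d P).
Local Notation aug := (@res_aug _ _ _ P).
Local Notation dsum n := (dual_sum (@res_proj _ _ _ P n)).
Local Notation theta := (theta P pH).
Local Notation contraction := (contraction pH).
Local Notation bdr := (bdr HA).
Implicit Types (f g : word -> k^o) (s t u w : word) (h r : H).

(** * The composite of the two comparison maps on the resolution *)

Lemma d_scale n h (x : PM n.+1) : d n (h *: x) = h *: d n x.
Proof. exact: linearZ. Qed.

Lemma d_add n (x y : PM n.+1) : d n (x + y) = d n x + d n y.
Proof. exact: linearD. Qed.

(** The H-linear extension of [theta] to the words h :: t, which stand for h tensor t. *)
Definition act_theta n w : restr (PM n) :=
  if w is h :: t then h *: (theta n t : PM n) else 0.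

Lemma mlin_act_theta n : mlin (act_theta n).
Proof.
case=> [|z s1] s2 a x y /=; first by rewrite scalerDl restr_actl.
by rewrite mlin_theta [LHS]scalerDr restr_act.
Qed.

Lemma bdr_act_theta n w : size w = n.+2 -> bdr (act_theta n) w = d n (act_theta n.+1 w).
Proof.
case: w => [//|h [//|h' t]] [tn].
have -> : d n (act_theta n.+1 (h :: h' :: t)) =
   h *: (d n (theta n.+1 (h' :: t)) : PM n) by exact: linearZ.
rewrite d_theta // scalerBr scalerA.
rewrite -[LHS]/(act_theta n ((h * h') :: t) - bdr (fun w => act_theta n (h :: w)) (h' :: t)).
congr (_ - _); apply/esym.
apply: (bdr_morph HA (g := fun v : restr (PM n) => (h *: (v : PM n) : restr (PM n)))).
by move=> a u v; rewrite [LHS]scalerDr restr_act.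
Qed.

(** The composite of the chain maps from P to the bar resolution and back. *)
Definition ptheta n (x : PM n) : restr (PM n) := bar_eval (act_theta n) x.

Lemma pthetaD n (x y : PM n) : ptheta (x + y) = ptheta x + ptheta y.
Proof. exact: (bar_evalD _ _ (@mlin_act_theta n)). Qed.

Lemma pthetaZ n h (x : PM n) : ptheta (h *: x) = h *: (ptheta x : PM n).
Proof.
rewrite /ptheta bar_evalHZ; last exact: mlin_act_theta.
pose g (v : restr (PM n)) : restr (PM n) := h *: (v : PM n).
have gl : linear g by move=> a u v; rewrite /g [LHS]scalerDr restr_act.
rewrite [RHS](bar_eval_morph _ _ gl).
apply: eq_bar_eval; case=> [//|x' t] _.
by rewrite /g /= scalerA.
Qed.

Lemma d_ptheta n (x : PM n.+1) : d n (ptheta x) = ptheta (d n x).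
Proof.
rewrite /ptheta -(bar_eval_bdrS _ (@mlin_act_theta n)).
have dl : linear (d n : restr (PM n.+1) -> restr (PM n)) by exact: d_restr.
rewrite [LHS](bar_eval_morph _ _ dl).
apply: (@eq_bar_eval _ _ _ P (restr (PM n)) n.+1) => w wn.
by rewrite bdr_act_theta.
Qed.

Lemma aug_ptheta (x : PM 0) : aug (ptheta x) = aug x.
Proof.
have al : linear (aug : restr (PM 0) -> k^o) by move=> a u v; rewrite augD aug_restr.
rewrite [LHS](bar_eval_morph _ _ al).
rewrite -[RHS]mulr1 -[RHS](bar_eval_bdr0 (fun _ => 1 : k^o)).
apply: (@eq_bar_eval _ _ _ P k^o 0) => -[//|r [|//]] _ /=.
by rewrite subr0 augZ aug_sectionE.
Qed.

(** An H-linear homotopy from the identity of P to [ptheta]. It is H-linear because it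
is defined by applying the contraction to the elements of a dual basis only. *)
Fixpoint res_homotopy n : PM n -> PM n.+1 :=
  match n return PM n -> PM n.+1 with
  | 0 => dsum 0 (fun y r => r *: (contraction (ptheta y - y) : PM 1))
  | m.+1 => dsum m.+1 (fun y r =>
      r *: (contraction (ptheta y - y - res_homotopy (d m y)) : PM m.+2))
  end.

Lemma res_homotopyD n (x y : PM n) :
  res_homotopy (x + y) = res_homotopy x + res_homotopy y.
Proof. by case: n x y => [|n] x y; apply: dual_sumD => z r r'; rewrite scalerDl. Qed.

Lemma res_homotopyZ n h (x : PM n) : res_homotopy (h *: x) = h *: res_homotopy x.
Proof.
have aD m (u v : PM m) : h *: (u + v) = h *: u + h *: v by exact: scalerDr.
by case: n x => [|n] x /=; rewrite dual_sumZ => [|y r r']; rewrite ?scalerDl //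
  (dual_sum_morph _ _ _ (aD _)); apply: eq_dual_sum => y r; rewrite scalerA.
Qed.

Lemma d_res_homotopy0 x : d 0 (res_homotopy x) = ptheta x - x.
Proof.
rewrite (dual_sum_morph _ _ _ (linearD (d 0))) -[RHS](dual_sumE (@res_proj _ _ _ P 0) (G := fun x => ptheta x - x)).
  apply: eq_dual_sum => y r; rewrite d_scale contraction_cycle.
    by rewrite scalerBr pthetaZ.
  by rewrite /= augB aug_ptheta subrr.
by move=> y y'; rewrite pthetaD opprD addrACA.
Qed.

Lemma d_res_homotopyS n x :
  d n.+1 (res_homotopy x) = ptheta x - x - res_homotopy (d n x).
Proof.
elim: n x => [|n IH] x;
rewrite (dual_sum_morph _ _ _ (linearD (d _))) -[RHS](dual_sumE (@res_proj _ _ _ P _) (G := fun x => ptheta x - x - res_homotopy (d _ x))).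
- apply: eq_dual_sum => y r; rewrite d_scale contraction_cycle.
    by rewrite !scalerBr pthetaZ d_scale res_homotopyZ.
  by rewrite -[res_cycle _]/(_ = 0) !linearB d_ptheta d_res_homotopy0 subrr.
- by move=> y y'; rewrite pthetaD d_add res_homotopyD !opprD (addrACA (ptheta y)) [LHS]addrACA.
- apply: eq_dual_sum => y r; rewrite d_scale contraction_cycle.
    by rewrite !scalerBr pthetaZ d_scale res_homotopyZ.
  rewrite -[res_cycle _]/(_ = 0) !linearB d_ptheta IH d_d opprB addrC subrK.
  by have := res_homotopyD (0 : PM n) 0; rewrite addr0 -{1}[res_homotopy 0]addr0 => /addrI.
by move=> y y'; rewrite pthetaD d_add res_homotopyD !opprD (addrACA (ptheta y)) [LHS]addrACA.
Qed.
End BackOnResolution.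

Section Maps.
Variables (k : comNzRingType) (H : algType k) (HA : hopf_algebra H).
Variable P : projective_resolution HA.
Hypothesis pH : projective (H : lmodType k).
Local Notation eps := (hEps HA).
Local Notation word := (seq H).
Local Notation PM := (res_mod P).
Local Notation d := (res_d P).
Local Notation theta := (theta P pH).
Local Notation ptheta := (@ptheta _ _ _ P pH _).
Local Notation res_homotopy := (@res_homotopy _ _ _ P pH _).
Local Notation bdr := (bdr HA).
Local Notation cochain := (@cochain k H).
Local Notation is_cocycle := (is_cocycle HA).
Local Notation is_coboundary := (is_coboundary HA).
Local Notation beta := (beta HA).
Implicit Types (f g F G : word -> k^o) (s t u w : word) (h r : H).

Lemma bdr_bd f h t : bdr f (h :: t) = bd HA h f t.
Proof.
elim: t h f => [|x t IH] h f; first by rewrite /= subr0.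
by rewrite -[LHS]/(f (h * x :: t) - bdr (fun v => f (h :: v)) (x :: t)) IH.
Qed.

Lemma beta_bdr n f h t : size t = n ->
  beta n f (h :: t) = (-1) ^+ n.+1 * (eps h * f t - bdr f (h :: t)).
Proof. by move=> tn; rewrite beta_bd // bdr_bd. Qed.

Lemma mlin_cochain n f : cochain n f -> mlin f.
Proof. by case/cochainP=> fl _ s1 s2 a x y; exact: fl. Qed.

Lemma cochain_mlin n f : mlin f -> cochain n (fun s => if size s == n then f s else 0).
Proof.
move=> fl; split=> [s1 s2 sn a x y|s /negPf -> //].
have sn' : (size s1 + (size s2).+1)%N = n := sn.
have e z : size (s1 ++ z :: s2) == n by rewrite size_cat [X in (_ + X)%N]/= sn'.
by rewrite /= !e fl.
Qed.

(** The functional on the bar resolution that corresponds to the cochain f. *)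
Definition left_eps f : word -> k^o := fun w => if w is h :: t then eps h * f t else 0.

Lemma left_eps_lin a f g : left_eps (a *: f + g) = (a *: left_eps f + left_eps g).
Proof.
apply/funext => -[|h t] /=; first by rewrite -[RHS]/(a * 0 + 0) mulr0 addr0.
rewrite -[RHS]/(a * (eps h * f t) + eps h * g t) -[(a *: f + g) t]/(a * f t + g t).
ring.
Qed.

Lemma mlin_left_eps f : mlin f -> mlin (left_eps f).
Proof.
move=> fl [|z s1] s2 a x y /=.
  by rewrite hEps_lin mulrDl; congr (_ + _); exact: (esym (mulrA _ _ _)).
by rewrite fl mulrDr; congr (_ + _); exact: mulrCA.
Qed.

Lemma sqr_sign n : (-1) ^+ n * (-1) ^+ n = 1 :> k.
Proof. by rewrite -exprD addnn -signr_odd odd_double. Qed.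

Lemma bdr_left_eps n f w : size w = n.+2 ->
  bdr (left_eps f) w = (-1) ^+ n.+1 * left_eps (beta n f) w.
Proof.
case: w => [//|h [//|h' t]] [tn].
rewrite [left_eps (beta n f) _]/= beta_bdr //.
rewrite [RHS]mulrCA [(-1) ^+ n.+1 * (_ * _)]mulrA sqr_sign mul1r.
rewrite -[LHS]/(eps (h * h') * f t - bdr (fun v => eps h * f v : k^o) (h' :: t)).
rewrite hEpsM mulrBr mulrA; congr (_ - _).
by apply/esym; apply: (bdr_morph HA (g := fun v : k^o => (eps h * v : k^o))) => a u v; rewrite mulrDr mulrCA.
Qed.

Lemma trivial_linear0E (M : lmodType H) (f : M -> k^o) : trivial_linear HA f -> f 0 = 0.
Proof.
by move=> fl; have := fl 0 0 0; rewrite scaler0 addr0 => e; apply: (addrI (f 0));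
   rewrite addr0; have := fl 1 0 0; rewrite scaler0 addr0 hEps1 mul1r.
Qed.

Lemma trivial_linearD (M : lmodType H) (f : M -> k^o) x y : trivial_linear HA f ->
  f (x + y) = f x + f y.
Proof. by move=> fl; have := fl 1 x y; rewrite scale1r hEps1 mul1r. Qed.

Lemma trivial_linearB (M : lmodType H) (f : M -> k^o) x y : trivial_linear HA f ->
  f (x - y) = f x - f y.
Proof. by move=> fl; apply: (addIr (f y)); rewrite -trivial_linearD // !subrK. Qed.

Lemma trivial_linearZ (M : lmodType H) (f : M -> k^o) h x : trivial_linear HA f ->
  f (h *: x) = eps h * f x.
Proof. by move=> fl; have := fl h x 0; rewrite !addr0 trivial_linear0E // addr0. Qed.

Lemma trivial_linear_restr (M : lmodType H) (f : M -> k^o) : trivial_linear HA f ->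
  linear (f : restr M -> k^o).
Proof.
move=> fl a x y; rewrite restrZ [LHS]fl; congr (_ + _).
rewrite -[RHS]/(a * f x); congr (_ * _).
have e0 : eps 0 = 0 by have := hEps_lin HA (-1) 0 0; rewrite scaler0 addr0 mulN1r addNr.
by have := hEps_lin HA a 1 0; rewrite e0 !addr0 hEps1 mulr1.
Qed.

(** * From cochains to the resolution *)

(** The cochain of the resolution obtained by restricting f along the chain map from P
to the bar resolution. *)
Definition of_cochain n f : PM n -> k^o := fun x => bar_eval (left_eps f) x.

Lemma of_cochain_lin n : linear (@of_cochain n).
Proof.
move=> a f g; apply/funext => x.
rewrite /of_cochain left_eps_lin -[RHS]/(a *: bar_eval (left_eps f) x + bar_eval (left_eps g) x).
by rewrite -bar_eval_lin.
Qed.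

Lemma of_cochain_trivial n f : mlin f -> trivial_linear HA (@of_cochain n f).
Proof.
move=> fl h x y; have Fl := mlin_left_eps fl.
rewrite /of_cochain bar_evalD // bar_evalHZ //; congr (_ + _).
transitivity (bar_eval (fun w => eps h *: (left_eps f w : k^o)) x);
  last exact: (bar_evalZ (V := k^o) (eps h)).
apply: (@eq_bar_eval _ _ _ P k^o n) => -[//|x' t] _ /=.
by rewrite hEpsM -mulrA.
Qed.

Lemma of_cochain_d n f x : mlin f ->
  of_cochain f (d n x) = (-1) ^+ n.+1 * of_cochain (beta n f) x.
Proof.
move=> fl; rewrite /of_cochain -bar_eval_bdrS; last exact: mlin_left_eps.
transitivity (bar_eval (fun w => (-1) ^+ n.+1 *: (left_eps (beta n f) w : k^o)) x);
  last exact: (bar_evalZ (V := k^o) ((-1) ^+ n.+1)).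
apply: (@eq_bar_eval _ _ _ P k^o n.+1) => w wn.
exact: bdr_left_eps.
Qed.

Lemma of_cochain0 n : @of_cochain n 0 = 0.
Proof.
have := @of_cochain_lin n (-1) 0 0; rewrite scaler0 addr0 => ->.
by rewrite scaleN1r addNr.
Qed.

Lemma of_cochain_cocycle n f : is_cocycle n f -> is_ext_cocycle (@of_cochain n f).
Proof.
move=> [fc fb]; have fl := mlin_cochain fc; split; first exact: of_cochain_trivial.
by move=> y; rewrite of_cochain_d // fb of_cochain0 mulr0.
Qed.

Lemma of_cochain_coboundary n f : is_coboundary n f -> is_ext_coboundary (@of_cochain n f).
Proof.
case: n => [->|n [g gc ->]]; first exact: of_cochain0.
have gl := mlin_cochain gc.
exists ((-1) ^+ n.+1 *: of_cochain g).
  have := trivial_linear_lin ((-1) ^+ n.+1) (of_cochain_trivial (n := n) gl) (@trivial_linear0 _ _ HA _).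
  by rewrite addr0.
apply/funext => x; rewrite -[RHS]/((-1) ^+ n.+1 * of_cochain g (d n x)).
by rewrite of_cochain_d // mulrA sqr_sign mul1r.
Qed.

(** * From the resolution to cochains *)

(** The restriction along [theta] of a cochain of the resolution. *)
Definition to_cochain n (f : PM n -> k^o) : word -> k^o :=
  fun s => if size s == n then f (theta n s) else 0.

Lemma to_cochain_lin n : linear (@to_cochain n).
Proof.
move=> a f g; apply/funext => s; rewrite -[RHS]/(a * to_cochain f s + to_cochain g s).
by rewrite /to_cochain; case: ifP => _ //; rewrite mulr0 addr0.
Qed.

Lemma mlin_theta_comp n (f : PM n -> k^o) : trivial_linear HA f ->
  mlin (fun s => f (theta n s)).
Proof.
by move=> fl s1 s2 a x y; rewrite mlin_theta [LHS](trivial_linear_restr fl).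
Qed.

Lemma cochain_to_cochain n (f : PM n -> k^o) : trivial_linear HA f ->
  cochain n (to_cochain f).
Proof. by move=> fl; apply: cochain_mlin; exact: mlin_theta_comp. Qed.

Lemma beta_to_cochain n (f : PM n -> k^o) : trivial_linear HA f ->
  beta n (to_cochain f) = (-1) ^+ n.+1 *: to_cochain (f \o d n).
Proof.
move=> fl; apply/funext => s; rewrite -[RHS]/((-1) ^+ n.+1 * to_cochain (f \o d n) s).
rewrite /to_cochain; have [sn|sn] := eqVneq (size s) n.+1; last by rewrite beta_size ?mulr0.
case: s sn => [//|h t] [tn]; rewrite beta_bdr // tn eqxx; congr (_ * _).
rewrite -[RHS]/(f (d n (theta n.+1 (h :: t)))) d_theta //.
have fr := trivial_linear_restr fl.
have -> : f (h *: (theta n t : PM n) - bdr (theta n) (h :: t)) =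
    f (h *: (theta n t : PM n)) - f (bdr (theta n) (h :: t)) by exact: trivial_linearB.
rewrite trivial_linearZ //; congr (_ - _).
rewrite (bdr_morph HA fr); apply: bdr_ext => w [wn].
by rewrite wn tn eqxx.
Qed.

Lemma to_cochain_cocycle n (f : PM n -> k^o) : is_ext_cocycle f -> is_cocycle n (to_cochain f).
Proof.
move=> [fl fd]; split; first exact: cochain_to_cochain.
rewrite beta_to_cochain //; have -> : f \o d n = 0 by apply/funext => x; exact: fd.
have -> : @to_cochain n.+1 0 = 0 by apply/funext => s; rewrite /to_cochain; case: ifP.
by rewrite scaler0.
Qed.

Lemma to_cochain_coboundary n (f : PM n -> k^o) : is_ext_coboundary f ->
  is_coboundary n (to_cochain f).
Proof.
case: n f => [f ->|n f [g gl ->]].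
  by apply/funext => s; rewrite /to_cochain; case: ifP.
rewrite -[to_cochain _]scale1r -(sqr_sign n.+1).
by rewrite -scalerA -beta_to_cochain //; apply: coboundaryZ; exists (to_cochain g) => //; exact: cochain_to_cochain.
Qed.

(** The map [ptheta] is homotopic to the identity. *)
Lemma of_to_cochain n (f : PM n -> k^o) : is_ext_cocycle f ->
  is_ext_coboundary (of_cochain (to_cochain f) - f).
Proof.
move=> [fl fd].
have E x : of_cochain (to_cochain f) x = f (ptheta x).
  have fr := trivial_linear_restr fl.
  rewrite /of_cochain [RHS](bar_eval_morph _ _ fr).
  apply: (@eq_bar_eval _ _ _ P k^o n) => -[//|h t] [tn].
  by rewrite /= /to_cochain tn eqxx trivial_linearZ.
case: n f fl fd E => [|n] f fl fd E.
  apply/funext => x; rewrite -[LHS]/(of_cochain (to_cochain f) x - f x) E.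
  have -> : ptheta x = x + d 0 (res_homotopy x) by rewrite d_res_homotopy0 addrC subrK.
  by rewrite trivial_linearD // fd addr0 subrr.
exists (f \o res_homotopy).
  by move=> h x y /=; rewrite res_homotopyD res_homotopyZ trivial_linearD // trivial_linearZ.
apply/funext => x; rewrite -[LHS]/(of_cochain (to_cochain f) x - f x) E.
have -> : ptheta x = x + (d n.+1 (res_homotopy x) + res_homotopy (d n x)).
  by rewrite d_res_homotopyS subrK addrC subrK.
by rewrite !trivial_linearD // fd add0r addrC addKr.
Qed.

End Maps.

(** * The composite on the bar resolution *)

Section BackOnCochains.
Variables (k : comNzRingType) (H : algType k) (HA : hopf_algebra H).
Variable P : projective_resolution HA.
Hypothesis pH : projective (H : lmodType k).
Local Notation eps := (hEps HA).
Local Notation word := (seq H).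
Local Notation PM := (res_mod P).
Local Notation theta := (theta P pH).
Local Notation act_theta := (@act_theta _ _ _ P pH).
Local Notation lact := (lact HA).
Local Notation bdr := (bdr HA).
Local Notation cochain := (@cochain k H).
Local Notation is_cocycle := (is_cocycle HA).
Local Notation is_coboundary := (is_coboundary HA).
Local Notation beta := (beta HA).
Implicit Types (f g F G : word -> k^o) (s t u w : word) (h r : H).

Local Notation of_cochain n := (@of_cochain _ _ _ P n).
Local Notation to_cochain := (@to_cochain _ _ _ P pH _).

(** A homotopy from the identity of the bar resolution to the composite of the chain
maps through P sends h tensor t to h tensor z, where z is the value at 1 tensor t of the
composite minus the identity minus the homotopy applied to the boundary. Here is the
value of F on z; the value of F on h tensor z is obtained from the functional F (h :: .). *)
Fixpoint bar_homotopy n F t : k^o :=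
  bar_eval F (theta n t) - F (1 :: t)
  - bdr (match n with
         | 0 => fun=> 0 : k^o
         | m.+1 => fun w => if w is h :: u then bar_homotopy m (fun v => F (h :: v)) u else 0
         end) (1 :: t).

(** The value of F on the homotopy in degree n - 1, which is 0 for n = 0. *)
Definition bar_homotopy_pred n F : word -> k^o :=
  match n with
  | 0 => fun=> 0
  | m.+1 => fun w => if w is h :: u then bar_homotopy m (fun v => F (h :: v)) u else 0
  end.

Lemma bar_homotopyE n F t : bar_homotopy n F t =
  bar_eval F (theta n t) - F (1 :: t) - bdr (bar_homotopy_pred n F) (1 :: t).
Proof. by case: n. Qed.

Lemma eq_bar_homotopy n F G t : size t = n -> (forall w, size w = n.+1 -> F w = G w) ->
  bar_homotopy n F t = bar_homotopy n G t.
Proof.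
elim: n F G t => [|n IH] F G t tn FG;
  rewrite !bar_homotopyE (eq_bar_eval _ FG) (FG (1 :: t)) ?[size _]/= ?tn //.
congr (_ - _); apply: bdr_ext => -[//|h w] /= [wn].
apply: IH => [|v vn]; first by apply: succn_inj; rewrite -tn -wn.
by rewrite FG //= vn.
Qed.

Lemma bar_homotopy_lin n a F G t : bar_homotopy n (fun w => a *: F w + G w) t =
  a *: bar_homotopy n F t + bar_homotopy n G t.
Proof.
elim: n F G t => [|n IH] F G t; rewrite !bar_homotopyE bar_eval_lin.
  rewrite !bdr0 !subr0 scalerBr opprD; exact: addrACA.
have -> : bar_homotopy_pred n.+1 (fun w => a *: F w + G w) =
    (fun w => a *: bar_homotopy_pred n.+1 F w + bar_homotopy_pred n.+1 G w).
  by apply/funext => -[|h w] /=; rewrite ?scaler0 ?addr0 // IH.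
rewrite bdr_lin !scalerBr (opprD (a *: F _)) (addrACA (a *: bar_eval _ _)).
by rewrite opprD [LHS]addrACA.
Qed.

Lemma bar_homotopy0 n t : bar_homotopy n (fun=> 0) t = 0.
Proof.
have := bar_homotopy_lin n 1 (fun=> 0) (fun=> 0) t.
by rewrite scaler0 addr0 scale1r -[X in X = _]addr0 => /addrI.
Qed.

Lemma bar_homotopyZ n a F t :
  bar_homotopy n (fun w => a *: F w) t = a *: bar_homotopy n F t.
Proof.
have := bar_homotopy_lin n a F (fun=> 0) t; rewrite bar_homotopy0 addr0 => <-.
by congr bar_homotopy; apply/funext => w; rewrite addr0.
Qed.

Lemma bar_homotopyB n F G t : bar_homotopy n (fun w => F w - G w) t =
  bar_homotopy n F t - bar_homotopy n G t.
Proof.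
have <- : (fun w => (-1) *: G w + F w) = (fun w => F w - G w).
  by apply/funext => w; rewrite scaleN1r addrC.
by rewrite bar_homotopy_lin scaleN1r addrC.
Qed.

Lemma mlinZ F a x w : mlin F -> F (a *: x :: w) = a *: F (x :: w).
Proof.
move=> Fl; have F0 : F (0 :: w) = 0.
  by have := Fl [::] w (-1) 0 0; rewrite /= scaler0 addr0 scaleN1r addNr.
by have := Fl [::] w a x 0; rewrite /= F0 !addr0.
Qed.

Lemma bar_eval_restr n F : mlin F ->
  linear (fun x : restr (PM n) => bar_eval F (x : PM n) : k^o).
Proof.
move=> Fl a x y; rewrite bar_evalD // restrZ bar_evalHZ //; congr (_ + _).
transitivity (bar_eval (fun w => a *: F w) (x : PM n)); last exact: bar_evalZ.
apply: (@eq_bar_eval _ _ _ P k^o n) => -[//|z w] _ /=.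
by rewrite mulr_algl mlinZ.
Qed.

Lemma mlinB F G : mlin F -> mlin G -> mlin (fun w => F w - G w).
Proof. by move=> Fl Gl s1 s2 a x y; rewrite Fl Gl opprD addrACA scalerBr. Qed.

Lemma mlin_bar_homotopy n F : mlin F -> mlin (bar_homotopy n F).
Proof.
have E m G : bar_homotopy m G = (fun t => bar_eval G (theta m t) - G (1 :: t)
    - bdr (bar_homotopy_pred m G) (1 :: t)) by apply/funext => t; exact: bar_homotopyE.
elim: n F => [|n IH] F Fl; rewrite E.
all: apply: mlinB; first apply: mlinB; try exact: mlin_cons.
all: try by move=> s1 s2 a x y; rewrite mlin_theta [LHS]bar_eval_restr.
all: apply: mlin_cons; apply: mlin_bdr => s1 s2 a x y.
  by rewrite [RHS]addr0 scaler0.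
case: s1 => [|z s1] /=; last by rewrite IH //; exact: mlin_cons.
rewrite -bar_homotopy_lin; congr bar_homotopy; apply/funext => w.
exact: (Fl [::]).
Qed.

Lemma bar_homotopy_lact n h F :
  bar_homotopy_pred n (lact h F) = lact h (bar_homotopy_pred n F).
Proof. by apply/funext => w; case: n w => [|n] [|x w] //=; rewrite scaler0. Qed.

Lemma bar_homotopy_cons n F h t : mlin F ->
  bar_homotopy n (bdr (fun w => F (h :: w))) t = 0 ->
  bar_homotopy n (fun w => bdr F (h :: w)) t =
  bar_eval (lact h F) (theta n t) - F (h :: t) - bdr (bar_homotopy_pred n F) (h :: t).
Proof.
move=> Fl e.
have -> : bar_homotopy n (fun w => bdr F (h :: w)) t =
    bar_homotopy n (fun w => lact h F w - bdr (fun v => F (h :: v)) w) t by [].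
rewrite bar_homotopyB e subr0 bar_homotopyE bar_homotopy_lact bdr_lact.
by rewrite /lact mulr1.
Qed.

(** The element z in the recursion of [bar_homotopy] is a cycle. *)
Lemma bar_homotopy_bdr n F t : mlin F -> size t = n -> bar_homotopy n (bdr F) t = 0.
Proof.
elim: n F t => [|n IH] F t Fl tn; rewrite bar_homotopyE.
  case: t tn => // _; rewrite bar_eval_bdr0 aug_sectionE /=.
  by rewrite hEps1 !subr0 scaler0 subr0 subrr.
rewrite bar_eval_bdrS //.
have -> : bdr (bar_homotopy_pred n.+1 (bdr F)) (1 :: t) =
  bdr (fun w => (bar_eval F (act_theta n w) - F w) - bdr (bar_homotopy_pred n F) w) (1 :: t).
  apply: bdr_ext => w; rewrite /= tn => -[]; case: w => [//|h w] [wn].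
  rewrite bar_homotopy_cons //; last by apply: IH => //; exact: mlin_cons.
  by rewrite -bar_evalHZ.
rewrite !bdrB bdr_bdr subr0.
have gl := bar_eval_restr (n := n) Fl.
rewrite -(bdr_morph HA gl) bdr_act_theta; last by rewrite /= tn.
by rewrite /act_theta scale1r subrr.
Qed.

Lemma to_of_cochain n f : is_cocycle n f -> is_coboundary n (to_cochain (of_cochain n f) - f).
Proof.
move=> [fc fb]; have fl := mlin_cochain fc; have Fl := mlin_left_eps HA fl.
have E t : size t = n -> bar_eval (left_eps HA f) (theta n t) - f t =
    bdr (bar_homotopy_pred n (left_eps HA f)) (1 :: t).
  move=> tn; apply/subr0_eq; have := bar_homotopy_cons (h := 1) (t := t) Fl
    (bar_homotopy_bdr (mlin_cons 1 Fl) tn).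
  rewrite lact1 [left_eps HA f _]/= hEps1 mul1r => <-.
  rewrite (@eq_bar_homotopy _ _ (fun=> 0) _ tn); first exact: bar_homotopy0.
  move=> w wn; rewrite (bdr_left_eps _ (n := n)) ?[size _]/= ?wn //.
  by rewrite fb /= [_ * 0]mulr0 mulr0.
case: n f fc fb fl Fl E => [|n] f fc fb fl Fl E.
  apply/funext => s; rewrite -[LHS]/(to_cochain (of_cochain 0 f) s - f s) /to_cochain.
  have [/eqP s0|sn] := boolP (size s == 0%N); last by rewrite (fc.2 _ sn) subrr.
  by rewrite [LHS](E _ s0) bdr0.
pose v : word -> k^o := bar_homotopy n f.
pose v' : word -> k^o := fun s => if size s == n then v s else 0.
have vc : cochain n v' by apply: cochain_mlin; exact: mlin_bar_homotopy.
suff -> : to_cochain (of_cochain n.+1 f) - f = (-1) ^+ n.+1 *: beta n v'.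
  by apply: coboundaryZ; exists v'.
apply/funext => s; rewrite -[LHS]/(to_cochain (of_cochain n.+1 f) s - f s).
rewrite -[RHS]/((-1) ^+ n.+1 * beta n v' s) /to_cochain.
have [/eqP sn|sn] := boolP (size s == n.+1); last by rewrite (fc.2 _ sn) subrr beta_size ?mulr0.
rewrite [LHS](E _ sn).
transitivity (bdr (left_eps HA v') (1 :: s)).
  apply: bdr_ext => w; rewrite /= sn => -[]; case: w => [//|h w] [wn'].
  rewrite /= /v' wn' eqxx; exact: (bar_homotopyZ n (eps h) f w).
by rewrite (bdr_left_eps _ (n := n)) /= ?sn // hEps1 mul1r.
Qed.
End BackOnCochains.

(** If H is k-projective, cohomology computes Ext, by means of a comparison map from
the bar resolution. *)
Lemma bar_isomorphism (k : comNzRingType) (H : algType k) (HA : hopf_algebra H)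
    (P : projective_resolution HA) : projective (H : lmodType k) ->
  exists (theta : forall n, seq H -> res_mod P n)
         (Phi : forall n, {linear Ext P n -> cohomology HA n}),
    [/\ bar_comparison theta, induced_by_bar theta Phi & ext_computed_by Phi].
Proof.
move=> pH; exists (theta P pH).
have Phi n := subquotient_map (@to_cochain_lin _ _ _ P pH n)
  (@to_cochain_cocycle _ _ _ P pH n : forall f, ext_cocycles P n f -> cocycles HA n _)
  (@to_cochain_coboundary _ _ _ P pH n : forall f, ext_coboundaries P n f -> coboundaries HA n _).
have Psi n := subquotient_map (@of_cochain_lin _ _ _ P n)
  (@of_cochain_cocycle _ _ _ P n : forall f, cocycles HA n f -> ext_cocycles P n _)
  (@of_cochain_coboundary _ _ _ P n : forall f, coboundaries HA n f -> ext_coboundaries P n _).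
exists (fun n => projT1 (Phi n)); split; first exact: theta_bar_comparison.
  move=> n f fc /=; split; first exact: to_cochain_cocycle.
  exact: (projT2 (Phi n) f fc).
move=> n; exists (projT1 (Psi n)).
  apply: sq_class_ind => f fc.
  rewrite (projT2 (Phi n) f fc) [LHS](projT2 (Psi n)); last exact: to_cochain_cocycle.
  apply: sq_class_eq => //; last exact: of_to_cochain.
  by apply: of_cochain_cocycle; exact: to_cochain_cocycle.
apply: sq_class_ind => f fc.
rewrite (projT2 (Psi n) f fc) [LHS](projT2 (Phi n)); last exact: of_cochain_cocycle.
apply: sq_class_eq => //; last exact: to_of_cochain.
by apply: to_cochain_cocycle; exact: of_cochain_cocycle.
Qed.

Theorem corollary6p9 (k : comNzRingType) (H : algType k) (HA : hopf_algebra H)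
    (sigma sigma_inv : H)
    (sigma_grouplike : grouplike HA sigma)
    (sigma_invr : sigma * sigma_inv = 1) (sigma_invl : sigma_inv * sigma = 1)
    (twisted_involution :
       forall h : H, hS HA (hS HA h) = sigma * h * sigma_inv) :
  exists G : gerstenhaber_data (cohomology HA),
    induced_by_operad G /\ is_BV G /\
    forall P : projective_resolution HA,
      (forall Phi : forall n, {linear Ext P n -> cohomology HA n},
         ext_computed_by Phi ->
         exists G' : gerstenhaber_data (Ext P),
           transports Phi G' G /\ is_BV G') /\
      (projective (H : lmodType k) ->
         exists (theta : forall n, seq H -> res_mod P n)
                (Phi : forall n, {linear Ext P n -> cohomology HA n}),
           [/\ bar_comparison theta, induced_by_bar theta Phi &
               ext_computed_by Phi]).
Proof.
have BV := is_BV_G sigma_grouplike sigma_invl twisted_involution.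
exists (G_class sigma_grouplike sigma_invl twisted_involution); split.
  exact: (induced_by_operad_G sigma_grouplike sigma_invl twisted_involution).
split=> // P; split; last exact: bar_isomorphism.
by move=> Phi bij; exact: transport_BV.
Qed.
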